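(* Assume that the locally Lipschitz function $f:\mathbb{R}\to\mathbb{R}$ satisfies $$|f(u)-f(v)|\le c|u-v|\,(1+|u|^{\rho}+|v|^{\rho}),\qquad u,v\in\mathbb{R},$$ for some constant $c\ge 0$ and some exponent $0<\rho\le\frac{q-2}{2}$, where $q=\frac{2Q}{Q-2}$, and $$\limsup_{|u|\to\infty}\frac{f(u)}{u}<\mu_1.$$ Assume that the continuous function $\beta:\mathbb{R}\to\mathbb{R}$, with $\alpha(t)=\max\{\beta(t),0\}$ and $\gamma(t)=\max\{-\beta(t),0\}$, satisfies, for some constant $C_\beta\ge1$, $$1\le\int_t^{t+1}\beta(\tau)\,d\tau=\int_t^{t+1}\alpha(\tau)\,d\tau-\int_t^{t+1}\gamma(\tau)\,d\tau\le C_\beta\ \text{ for all } t\in\mathbb{R},\qquad \int_{-\infty}^{+\infty}\gamma(\tau)\,d\tau<\infty.$$ Let $s\in\mathbb{R}$, $(u_0,u_1)\in V$, and let $u$ be the weak solution, defined on its maximal interval of existence $[s,T)$, of $$\partial_{tt}u+\beta(t)\partial_tu=\mathcal{L}u+f(u)\ \text{ in }\Omega,\ t>s,\qquad u=0\ \text{ on }\partial\Omega,\qquad u(s)=u_0,\ \partial_tu(s)=u_1.$$ Then $(u(t),\partial_tu(t))$ is uniformly bounded in $V=X^{1/2}\times L^2(\Omega)$ for $t\in[s,T)$, and the solution exists globally, i.e. $T=\infty$.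
   Context: Setting. $\Omega\subset\mathbb{R}^N$ is a bounded domain with smooth boundary. $\mathcal{L}u=\sum_{i,j=1}^N\partial_{x_i}(a_{ij}\partial_{x_j}u)$ with measurable $a_{ij}=a_{ji}$ on $\mathbb{R}^N$. There is a family $X=\{X_1,\dots,X_m\}$ of vector fields $X_j=(\alpha_{j1},\dots,\alpha_{jN})$ on $\mathbb{R}^N$ with locally Lipschitz components, identified with the operators $X_j=\sum_k\alpha_{jk}\partial_{x_k}$, and $\mathcal{L}$ is uniformly $X$-elliptic: there is $C>0$ with $\frac1C\sum_{j}\langle X_j(x),\xi\rangle^2\le\sum_{i,j}a_{ij}(x)\xi_i\xi_j\le C\sum_j\langle X_j(x),\xi\rangle^2$ for all $x,\xi\in\mathbb{R}^N$. Standing hypotheses: the control (Carnot–Carathéodory) distance $d=d_X$ of $X$ is well defined, $(\mathbb{R}^N,d)$ is complete, the $d$-topology is the Euclidean one, and there is $A_0>1$ with $0<|B_{2r}|\le A_0|B_r|$ for every $d$-ball $B_r$ of radius $0<r<\infty$ ($|\cdot|$ is Lebesgue measure). There are constants $C,\nu\ge1$ such that for every $d$-ball $B_r$ and every $u\in C^1(\overline{B_{\nu r}})$ one has $\frac1{|B_r|}\int_{B_r}|u-u_r|\,dx\le Cr\frac1{|B_{\nu r}|}\int_{B_{\nu r}}|Xu|\,dx$, where $u_r=\frac1{|B_r|}\int_{B_r}u$ and $Xu=(X_1u,\dots,X_mu)$. $H$ is the closure of $C_0^1(\Omega)$ in the norm $\|u\|_H=(\sum_j\|X_ju\|_{L^2(\Omega)}^2)^{1/2}$.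 It is assumed that $H\hookrightarrow L^p(\Omega)$ for all $p\in[1,\frac{2Q}{Q-2}]$, compactly for $p<\frac{2Q}{Q-2}$, where $Q\le N$ ($Q>2$) is the dimension associated with $\mathcal{L}$. $A=-\mathcal{L}$ with homogeneous Dirichlet conditions is positive and self-adjoint in $L^2(\Omega)$ with compact inverse; $\mu_1>0$ is its first eigenvalue. $X^{\alpha}=\mathcal{D}(A^{\alpha})$ are its fractional power spaces, $X^{1/2}=H$, $X^0=L^2(\Omega)$. $a(u,v)=(-\mathcal{L}u,v)_{L^2(\Omega)}$ is the associated bilinear form on $H$. $V=H\times L^2(\Omega)$ has norm $\|(u,v)\|_V=(a(u,u)+\|v\|_{L^2(\Omega)}^2)^{1/2}$. Weak solution with initial time $s$: a function $u\in C([s,T);X^{1/2})\cap C^1((s,T);L^2(\Omega))$ with $u(s)=u_0$, $\partial_tu(s)=u_1$ and $\frac{d^2}{dt^2}\langle u,v\rangle_{L^2}+\beta(t)\frac{d}{dt}\langle u,v\rangle_{L^2}=-a(u,v)+\langle f(u),v\rangle$ for all $v\in X^{1/2}$, $t\in(s,T)$. For every initial datum in $V$ there is a unique such solution on a maximal interval $[s,T)$, with $(u,\partial_tu)\in C([s,T);V)$. *)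

(* Defs.v *)
From HB Require Import structures.
From mathcomp Require Import all_boot all_order all_algebra.
From mathcomp Require Import all_classical all_reals all_analysis.

Set Implicit Arguments.
Unset Strict Implicit.
Unset Printing Implicit Defensive.
Import Order.TTheory GRing.Theory Num.Theory.
Import numFieldNormedType.Exports.

Local Open Scope classical_set_scope.
Local Open Scope ring_scope.

(** * Lebesgue measure on R^N

    R^N is ['rV[R]_N]. The Lebesgue measure is the Caratheodory measure of the
    outer measure [A |-> inf (sum of volumes)] over countable covers of [A] by
    boxes, so that [caratheodory_type (leb_outer_measure R N)] is R^N with the
    (complete) sigma-algebra of Lebesgue measurable sets. *)

Definition box (R : realType) (N : nat) (c : 'rV[R]_N * 'rV[R]_N) :
    set 'rV[R]_N :=
  [set x | forall i, c.1 ord0 i < x ord0 i <= c.2 ord0 i].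

Definition box_vol (R : realType) (N : nat) (c : 'rV[R]_N * 'rV[R]_N) : R :=
  \prod_i Num.max 0 (c.2 ord0 i - c.1 ord0 i).

Definition leb_outer (R : realType) (N : nat) (A : set 'rV[R]_N) : \bar R :=
  ereal_inf [set (\esum_(c in C) (box_vol c)%:E)%E
    | C in [set C : set ('rV[R]_N * 'rV[R]_N) |
             countable C /\ A `<=` \bigcup_(c in C) box c]].

Section LebesgueRN.
Context (R : realType) (N : nat).
Implicit Types (A : set 'rV[R]_N) (c : 'rV[R]_N * 'rV[R]_N).

Let vol_ge0 c : (0 <= (box_vol c)%:E :> \bar R)%E.
Proof.
by rewrite lee_fin; apply: prodr_ge0 => i _; rewrite le_max lexx.
Qed.

Lemma leb_outer_ge0 A : (0 <= leb_outer A)%E.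
Proof. by apply: le_ereal_inf_tmp => x [C _ <-]; exact: esum_ge0. Qed.

Lemma leb_outer0 : leb_outer (set0 : set 'rV[R]_N) = 0%E.
Proof.
apply/eqP; rewrite eq_le leb_outer_ge0 andbT; apply: ereal_inf_lbound.
by exists set0; rewrite ?esum_set0//; split.
Qed.

Lemma le_leb_outer : {homo @leb_outer R N : A B / A `<=` B >-> (A <= B)%E}.
Proof.
move=> A B AB; apply/ereal_inf_le_tmp => x [C [cC BC] <-].
by exists C => //; split => //; exact: subset_trans AB BC.
Qed.

Lemma leb_outer_sigma_subadditive : sigma_subadditive (@leb_outer R N).
Proof.
move=> A; have [[i ioo]|] := pselect (exists i, leb_outer (A i) = +oo%E).
  rewrite (eseries_pinfty _ _ ioo) ?leey// => n _.
  by rewrite -ltNye (lt_le_trans _ (leb_outer_ge0 _)).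
rewrite -forallNE => Aoo.
apply/lee_addgt0Pr => _/posnumP[e].
apply: le_trans (epsilon_trick _ _ _) => //; last first.
  by move=> n; exact: leb_outer_ge0.
have /choice[C PC] n : exists C : set ('rV[R]_N * 'rV[R]_N),
    [/\ countable C, A n `<=` \bigcup_(c in C) box c &
     (\esum_(c in C) (box_vol c)%:E <=
      leb_outer (A n) + (e%:num / (2 ^ n.+1)%:R)%:E)%E].
  have fA : leb_outer (A n) \is a fin_num.
    by rewrite ge0_fin_numE; [rewrite ltey; exact/eqP/Aoo|exact: leb_outer_ge0].
  have en1 : (0 < e%:num / (2 ^ n.+1)%:R :> R) by [].
  have [_ [C [cC AC] <-] h] := lb_ereal_inf_adherent en1 fA.
  by exists C; split => //; exact: ltW.
apply: (@le_trans _ _ (\esum_(c in \bigcup_n C n) (box_vol c)%:E)%E).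
  apply: ereal_inf_lbound; exists (\bigcup_n C n) => //; split.
    by apply: bigcup_countable => // n _; have [] := PC n.
  move=> x [n _ Anx]; have [_ /(_ _ Anx)[c Cc cx] _] := PC n.
  by exists c => //; exists n.
rewrite seqDU_bigcup_eq esum_bigcupT// -nneseries_esumT; last first.
  by move=> n; exact: esum_ge0.
apply: lee_nneseries => n *; first exact: esum_ge0.
have [_ _] := PC n; apply: le_trans.
rewrite [leLHS]esum_mkcond [leRHS]esum_mkcond; apply: le_esum => c _.
case: ifPn => [|_]; last by case: ifPn.
by move=> /set_mem/(@subset_seqDU _ C n)/mem_set ->.
Qed.

HB.instance Definition _ := isOuterMeasure.Build R 'rV[R]_N (@leb_outer R N)
  leb_outer0 leb_outer_ge0 le_leb_outer leb_outer_sigma_subadditive.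

End LebesgueRN.

Definition leb_outer_measure (R : realType) (N : nat) :
    {outer_measure set 'rV[R]_N -> \bar R} := @leb_outer R N.

Definition leb (R : realType) (N : nat) :
    {measure set (caratheodory_type (leb_outer_measure R N)) -> \bar R} :=
  leb_outer_measure R N.

(** * Calculus on R^N *)

Definition dotv (R : realType) (N : nat) (x y : 'rV[R]_N) : R :=
  \sum_k x ord0 k * y ord0 k.

Definition partial (R : realType) (N : nat) (k : 'I_N) (u : 'rV[R]_N -> R) :
    'rV[R]_N -> R :=
  fun x => 'D_(delta_mx ord0 k) u x.

Definition C1 (R : realType) (N : nat) (u : 'rV[R]_N -> R) : Prop :=
  (forall x, differentiable u x) /\ (forall k, continuous (partial k u)).

Fixpoint Ck (R : realType) (N n : nat) (u : 'rV[R]_N -> R) : Prop :=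
  match n with
  | 0 => continuous u
  | n'.+1 => (forall x, differentiable u x) /\ (forall k, Ck n' (partial k u))
  end.

Definition Coo (R : realType) (N : nat) (u : 'rV[R]_N -> R) : Prop :=
  forall n, Ck n u.

(* [C^1] up to the boundary of the open set [B]. *)
Definition C1_closure (R : realType) (N : nat) (B : set 'rV[R]_N)
    (u : 'rV[R]_N -> R) : Prop :=
  [/\ {within closure B, continuous u},
      forall x, B x -> differentiable u x &
      forall k, exists g : 'rV[R]_N -> R,
        {within closure B, continuous g} /\
        forall x, B x -> g x = partial k u x].

Definition C1_0 (R : realType) (N : nat) (Omega : set 'rV[R]_N)
    (u : 'rV[R]_N -> R) : Prop :=
  [/\ C1 u, compact (closure [set x | u x != 0]) &
      closure [set x | u x != 0] `<=` Omega].

Definition smooth_boundary (R : realType) (N : nat) (Omega : set 'rV[R]_N) :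
    Prop :=
  forall x0, closure Omega x0 -> ~ interior Omega x0 ->
  exists2 psi : 'rV[R]_N -> R, Coo psi &
    (exists k, partial k psi x0 != 0) /\
    (\forall x \near x0, Omega x <-> psi x < 0).

Definition smooth_bounded_domain (R : realType) (N : nat)
    (Omega : set 'rV[R]_N) : Prop :=
  [/\ open Omega, connected Omega, Omega !=set0, bounded_set Omega &
      smooth_boundary Omega].

(** * The vector fields and the operator *)

Section Fields.
Context (R : realType) (N m : nat).
Implicit Types (X : 'I_m -> 'rV[R]_N -> 'rV[R]_N) (x y : 'rV[R]_N).

Definition loc_lipschitz_fields X : Prop :=
  forall j k, [locally [lipschitz (X j x ord0 k : R) | x in [set: 'rV[R]_N]]].

Definition Xop X (j : 'I_m) (u : 'rV[R]_N -> R) : 'rV[R]_N -> R :=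
  fun x => \sum_k X j x ord0 k * partial k u x.

Definition Xgrad_norm X (u : 'rV[R]_N -> R) (x : 'rV[R]_N) : R :=
  Num.sqrt (\sum_j Xop X j u x ^+ 2).

Definition X_elliptic X (a : 'rV[R]_N -> 'M[R]_N) : Prop :=
  exists2 C : R, 0 < C & forall x xi : 'rV[R]_N,
    C^-1 * (\sum_j dotv (X j x) xi ^+ 2)
      <= \sum_i \sum_j a x i j * xi ord0 i * xi ord0 j
      <= C * (\sum_j dotv (X j x) xi ^+ 2).

(** ** Control distance *)

Definition abs_continuous_on (g : R -> 'rV[R]_N) (b c : R) : Prop :=
  forall e : R, 0 < e -> exists2 d : R, 0 < d &
  forall (n : nat) (I : 'I_n -> R * R),
    (forall i, b <= (I i).1 /\ (I i).1 <= (I i).2 /\ (I i).2 <= c) ->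
    (forall i j, i != j -> (I i).2 <= (I j).1 \/ (I j).2 <= (I i).1) ->
    \sum_i ((I i).2 - (I i).1) < d ->
    \sum_i `|g (I i).2 - g (I i).1| < e.

Definition subunit X (T : R) (g : R -> 'rV[R]_N) : Prop :=
  abs_continuous_on g 0 T /\
  {ae lebesgue_measure, forall t : R, 0 <= t <= T ->
     derivable g t 1 /\
     forall xi, dotv ('D_1 g t) xi ^+ 2 <= \sum_j dotv (X j (g t)) xi ^+ 2}.

Definition travel_times X x y : set R :=
  [set T | 0 <= T /\ exists g, [/\ subunit X T g, g 0 = x & g T = y]].

Definition cc_dist X x y : R := inf (travel_times X x y).

Definition cc_ball X x (r : R) : set 'rV[R]_N := [set y | cc_dist X x y < r].

Definition cc_well_defined X : Prop := forall x y, travel_times X x y !=set0.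

Definition cc_complete X : Prop :=
  forall x_ : nat -> 'rV[R]_N,
    (forall e : R, 0 < e -> exists K, forall i j, (K <= i)%N -> (K <= j)%N ->
       cc_dist X (x_ i) (x_ j) < e) ->
    exists x, (fun n => cc_dist X (x_ n) x) @ \oo --> (0 : R).

Definition cc_euclidean_topology X : Prop :=
  forall A : set 'rV[R]_N,
    open A <-> (forall x, A x -> exists2 r : R, 0 < r & cc_ball X x r `<=` A).

Definition cc_doubling X : Prop :=
  exists2 A0 : R, 1 < A0 & forall x (r : R), 0 < r ->
    (0 < leb R N (cc_ball X x (2 * r)) <= A0%:E * leb R N (cc_ball X x r))%E.

Definition mean_on (B : set 'rV[R]_N) (u : 'rV[R]_N -> R) : R :=
  (fine (leb R N B))^-1 * \int[leb R N]_(x in B) u x.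

Definition cc_poincare X : Prop :=
  exists C nu : R, [/\ 1 <= C, 1 <= nu &
    forall x (r : R) (u : 'rV[R]_N -> R), 0 < r ->
      C1_closure (cc_ball X x (nu * r)) u ->
      mean_on (cc_ball X x r) (fun y => `|u y - mean_on (cc_ball X x r) u|)
        <= C * r * mean_on (cc_ball X x (nu * r)) (Xgrad_norm X u)].

Definition standing_hypotheses X (a : 'rV[R]_N -> 'M[R]_N) : Prop :=
  [/\ loc_lipschitz_fields X,
      (forall x i j, a x i j = a x j i),
      (forall i j, measurable_fun [set: caratheodory_type (leb_outer_measure R N)]
                     (fun x => a x i j)) &
      X_elliptic X a] /\
  [/\ cc_well_defined X, cc_complete X, cc_euclidean_topology X,
      cc_doubling X & cc_poincare X].

End Fields.

Definition crit_exp (R : realType) (Q : R) : R := 2 * Q / (Q - 2).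

(** * Function spaces on Omega

    Elements of L^p(Omega) are represented by functions on R^N, of which only
    the values on Omega matter, up to null sets. *)

Section Spaces.
Context (R : realType) (N m : nat).
Variables (Omega : set 'rV[R]_N) (X : 'I_m -> 'rV[R]_N -> 'rV[R]_N)
  (a : 'rV[R]_N -> 'M[R]_N).
Implicit Types (u v : 'rV[R]_N -> R) (phi : nat -> 'rV[R]_N -> R).

Definition inLp (p : R) u : Prop := (u \_ Omega) \in Lfun (leb R N) p%:E.

Definition Lpnorm (p : R) u : R :=
  fine (Lnorm (leb R N) p%:E (EFin \o (u \_ Omega))).

Definition L2inner u v : R := \int[leb R N]_(x in Omega) (u x * v x).

Definition Hnorm0 u : R := Num.sqrt (\sum_j Lpnorm 2 (Xop X j u) ^+ 2).

(* [(- L u, v)] after integration by parts. *)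
Definition form0 u v : R :=
  \int[leb R N]_(x in Omega)
    (\sum_i \sum_j a x i j * partial j u x * partial i v x).

Definition H_cauchy phi : Prop :=
  (forall n, C1_0 Omega (phi n)) /\
  forall e : R, 0 < e -> exists K, forall i j, (K <= i)%N -> (K <= j)%N ->
    Hnorm0 (phi i \- phi j) < e.

(** The completion [H] of [C1_0] is realized inside L^2(Omega): its elements
    are the L^2-limits of the sequences that are Cauchy in the norm of [H], and
    the norm and the form are extended by continuity. This represents the
    completion faithfully exactly when the map from it to L^2(Omega) is
    injective, which is [H_closable] and is part of the embeddings below. *)
Definition H_approx u phi : Prop :=
  H_cauchy phi /\ (fun n => Lpnorm 2 (phi n \- u)) @ \oo --> (0 : R).

Definition inH u : Prop := inLp 2 u /\ exists phi, H_approx u phi.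

Definition H_seq u : nat -> 'rV[R]_N -> R :=
  xget (fun _ _ => 0) [set phi | H_approx u phi].

Definition Hnorm u : R := limn (fun n => Hnorm0 (H_seq u n)).

Definition form u v : R := limn (fun n => form0 (H_seq u n) (H_seq v n)).

Definition H_closable : Prop :=
  forall phi, H_approx (fun _ => 0) phi ->
    (fun n => Hnorm0 (phi n)) @ \oo --> (0 : R).

Definition H_embeds (p : R) : Prop :=
  (forall u, inH u -> inLp p u) /\
  exists C : R, forall u, inH u -> Lpnorm p u <= C * Hnorm u.

Definition H_embeds_compactly (p : R) : Prop :=
  H_embeds p /\
  forall u_ : nat -> 'rV[R]_N -> R, (forall n, inH (u_ n)) ->
    (exists M : R, forall n, Hnorm (u_ n) <= M) ->
    exists k : nat -> nat, {homo k : i j / (i < j)%N} /\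
    exists2 w, inLp p w &
      (fun n => Lpnorm p (u_ (k n) \- w)) @ \oo --> (0 : R).

Definition sobolev_embeddings (Q : R) : Prop :=
  [/\ H_closable,
      forall p : R, 1 <= p <= crit_exp Q -> H_embeds p &
      forall p : R, 1 <= p < crit_exp Q -> H_embeds_compactly p].

(* [u] is in the domain of [A = - L] and [A u = g]. *)
Definition opA u g : Prop :=
  [/\ inH u, inLp 2 g & forall v, inH v -> form u v = L2inner g v].

Definition eigenvalueA (mu : R) : Prop :=
  exists2 u, opA u (fun x => mu * u x) &
    ~ ae_eq (leb R N) Omega u (fun _ => 0).

Definition first_eigenvalueA (mu1 : R) : Prop :=
  eigenvalueA mu1 /\ forall mu, eigenvalueA mu -> mu1 <= mu.

Definition inV u v : Prop := inH u /\ inLp 2 v.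

Definition Vnorm u v : R := Num.sqrt (form u u + Lpnorm 2 v ^+ 2).

(** * Weak solutions *)

Definition continuous_for (I : set R) (norm : ('rV[R]_N -> R) -> R)
    (w : R -> 'rV[R]_N -> R) : Prop :=
  forall t0, I t0 ->
    (fun t => norm (w t \- w t0)) @ within I (nbhs t0) --> (0 : R).

Definition clopen_time (s : R) (T : \bar R) : set R :=
  [set t | s <= t /\ (t%:E < T)%E].

Definition open_time (s : R) (T : \bar R) : set R :=
  [set t | s < t /\ (t%:E < T)%E].

(* [ut] is the time derivative of [u]; since [C^1((s,T);L^2)] does not see the
   time [s], the condition on the derivative at [s] is that [ut], continuous on
   [[s,T)], takes the value [u1] there. *)
Definition weak_solution (beta f : R -> R) (s : R) (T : \bar R)
    (u0 u1 : 'rV[R]_N -> R) (u ut : R -> 'rV[R]_N -> R) : Prop :=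
  [/\ (s%:E < T)%E,
      (forall t, clopen_time s T t -> inV (u t) (ut t)),
      continuous_for (clopen_time s T) Hnorm u &
      continuous_for (clopen_time s T) (Lpnorm 2) ut] /\
  [/\ (forall t, open_time s T t ->
         (fun h : R => Lpnorm 2 (fun x => h^-1 * (u (t + h) x - u t x) - ut t x))
           @ 0^' --> (0 : R)),
      ae_eq (leb R N) Omega (u s) u0,
      ae_eq (leb R N) Omega (ut s) u1 &
      forall v, inH v -> forall t, open_time s T t ->
        let g := fun r => L2inner (u r) v in
        [/\ derivable g t 1, derivable (g^`())%classic t 1 &
            (g^`(2))%classic t + beta t * (g^`())%classic t
              = - form (u t) v + L2inner (f \o u t) v]].

Definition maximal_weak_solution (beta f : R -> R) (s : R) (T : \bar R)
    (u0 u1 : 'rV[R]_N -> R) (u ut : R -> 'rV[R]_N -> R) : Prop :=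
  weak_solution beta f s T u0 u1 u ut /\
  forall (T' : \bar R) (u' ut' : R -> 'rV[R]_N -> R),
    weak_solution beta f s T' u0 u1 u' ut' ->
    (forall t, clopen_time s T t -> clopen_time s T' t ->
       ae_eq (leb R N) Omega (u' t) (u t)) ->
    (T' <= T)%E.

Definition well_posed (beta f : R -> R) : Prop :=
  forall (s : R) (u0 u1 : 'rV[R]_N -> R), inV u0 u1 ->
  exists (T : \bar R) (u ut : R -> 'rV[R]_N -> R),
    maximal_weak_solution beta f s T u0 u1 u ut /\
  forall (T' : \bar R) (u' ut' : R -> 'rV[R]_N -> R),
    maximal_weak_solution beta f s T' u0 u1 u' ut' ->
    T' = T /\
    forall t, clopen_time s T t -> ae_eq (leb R N) Omega (u' t) (u t).

End Spaces.

(** * Hypotheses on f and beta *)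

(* The filter of the neighbourhoods of infinity in [`|u| -> oo]. *)
Definition abs_infty (R : realType) : set (set R) :=
  [set V | exists M : R, forall x, M < `|x| -> V x].

Definition growth (R : realType) (f : R -> R) (c rho : R) : Prop :=
  forall u v : R,
    `|f u - f v| <= c * `|u - v| * (1 + `|u| `^ rho + `|v| `^ rho).

Definition neg_part (R : realType) (beta : R -> R) : R -> R :=
  fun t => Num.max (- beta t) 0.

(* Main.v *)
Require Import Defs.
From mathcomp Require Import all_boot all_order all_algebra.
From mathcomp Require Import all_classical all_reals all_analysis.
From mathcomp Require Import measurable_realfun.
From mathcomp Require Import ring lra.

(* Let F' = f. Along a weak solution the energy
   E = (a(u, u) + |u_t|^2) / 2 - \int F(u) satisfies E' = - beta |u_t|^2. Since
   limsup f(u)/u < mu_1 and mu_1 is the minimum of the Rayleigh quotient, there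
   are theta > 0 and C_1 with theta (a(u, u) + |u_t|^2) <= E + C_1. Hence
   E' <= gamma (E + C_1) / theta, and as gamma is integrable Gronwall's lemma
   bounds E and the norm of (u, u_t) in V.

   If T were finite, the forcing term - beta u_t + f(u) would be bounded in L^2
   on [s, T), and the energy identity for u(. + h) - u would show that (u, u_t)
   has a limit in V at T. The solution that starts from this limit at time T
   prolongs u, against maximality. *)

Set Implicit Arguments.
Unset Strict Implicit.
Unset Printing Implicit Defensive.
Import Order.TTheory GRing.Theory Num.Theory.
Import numFieldNormedType.Exports.

Local Open Scope classical_set_scope.
Local Open Scope ring_scope.

(** * Real functions *)

Section RealLemmas.
Context (R : realType).
Implicit Types (f df : R -> R) (x y l : R).

(** Two obstacles shape the proof. First, [wt] lies in [L] only, so the equation cannot be tested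
    with it. The energy identity is therefore proved once, for an abstract linear wave equation with
    continuous forcing, and then used twice: for the solution itself, and for the difference of the
    solution and a translate. Second, at the largest admissible [rho] the function [f \o u] is in
    L^2 exactly because [u] is in L^q, where the embedding of [H] is only continuous. The
    convergence at [T] thus rests on a bound of the forcing alone, and the continuity of
    [u |-> f \o u] on a Young inequality with a free parameter. Coercivity inserts
    [F x <= k / 2 * x ^+ 2 + C], with [k < mu1], into the Rayleigh inequality. As [mu1] is given as
    the least eigenvalue, that inequality requires the infimum of the Rayleigh quotient to be
    attained. Since functions equal almost everywhere are not identified, a continuation may start
    from a function other than the limit of [u]. Their difference has norm zero in [H] too, so the
    joined function is continuous. *)

Lemma cvg_dist_le (T : Type) (F : set_system T) {FF : Filter F} (f e : T -> R) l :
  (\forall x \near F, `|f x - l| <= e x) -> e x @[x --> F] --> (0 : R) ->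
  f x @[x --> F] --> l.
Proof.
move=> fe e0; apply/cvgrPdist_lt => eps eps0.
move/cvgrPdist_lt : e0 => /(_ _ eps0) e0.
near=> x.
have h1 : `|f x - l| <= e x by near: x.
have h2 : `|0 - e x| < eps by near: x.
rewrite distrC; apply: le_lt_trans h1 _.
by rewrite sub0r normrN in h2; apply: le_lt_trans h2; exact: ler_norm.
Unshelve. all: by end_near. Qed.

(** The product form holds trivially at [y = x], so full neighbourhoods replace punctured ones and
    remainders can be estimated directly. *)
Lemma is_deriveP f x l :
  is_derive x 1 f l <->
  forall e : R, 0 < e -> \forall y \near x, `|f y - f x - l * (y - x)| <= e * `|y - x|.
Proof.
split=> [[df fl] e e0|H].
  have /cvgrPdist_le/(_ _ e0) : (fun h : R => h^-1 *: (f (h *: 1 + x) - f x)) @ 0^' --> l.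
    by rewrite -fl; exact: df.
  move=> -[d /= d0 Hd].
  exists d => // y /=; have [->|yx] := eqVneq y x.
    by rewrite !subrr mulr0 subrr normr0 mulr0.
  move=> xyd.
  have yx0 : y - x != 0 by rewrite subr_eq0.
  have := Hd (y - x); rewrite /= sub0r normrN distrC => /(_ xyd yx0).
  rewrite [(y - x) *: 1]mulr1 subrK => h.
  rewrite [`|x - y|]distrC -ler_pdivrMr ?normr_gt0// -normfV -normrM mulrBl mulfK//.
  by move: h; rewrite /GRing.scale/= distrC mulrC.
have Hc : (fun h : R => h^-1 *: (f (h *: 1 + x) - f x)) @ 0^' --> l.
  apply/cvgrPdist_le => e e0; have [d /= d0 Hd] := H _ e0.
  exists d => //= h; rewrite /= sub0r normrN => hd h0.
  have := Hd (h + x); rewrite /= opprD addrCA subrr addr0 normrN => /(_ hd).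
  rewrite addrK -ler_pdivrMr ?normr_gt0// -normfV -normrM [_%:A]mulr1.
  by rewrite distrC mulrBl mulfK// /GRing.scale/= [h^-1 * _]mulrC.
split; first by apply/cvg_ex; exists l.
exact: cvg_lim Hc.
Qed.

Lemma is_derive_near f g x l : (\forall y \near x, f y = g y) ->
  is_derive x 1 f l -> is_derive x 1 g l.
Proof.
move=> fg /is_deriveP H; apply/is_deriveP => e e0.
have fgx : f x = g x := nbhs_singleton fg.
by move: (H _ e0); apply: filterS2 fg => y <-; rewrite -fgx.
Qed.

Lemma is_derive_addr f x h l : is_derive (x + h) 1 f l ->
  is_derive x 1 (fun y : R => f (y + h)) l.
Proof.
move=> /is_deriveP H; apply/is_deriveP => e /H [d /= d0 Hd].
exists d => // y /= xy; have := Hd (y + h) => /=.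
have -> : x + h - (y + h) = x - y by ring.
have -> : y + h - (x + h) = y - x by ring.
exact.
Qed.

Lemma is_derive_continuous f x l : is_derive x 1 f l -> {for x, continuous f}.
Proof. by move=> [df _]; apply/differentiable_continuous/derivable1_diffP. Qed.

Lemma mvt_le f df (a b e : R) :
  (forall x, a < x < b -> is_derive x 1 f (df x)) ->
  (forall x, a < x < b -> `|df x| <= e) ->
  forall x y, a < x < b -> a < y < b -> `|f y - f x| <= e * `|y - x|.
Proof.
move=> fd dfe.
have main x y : x < y -> a < x < b -> a < y < b -> `|f y - f x| <= e * `|y - x|.
  move=> xy ax ay.
  have xyP z : z \in `]x, y[ -> a < z < b by rewrite in_itv/= => /andP[]; lra.
  have [||z zxy ->] := @MVT _ f df _ _ xy.
  - by move=> z /xyP; exact: fd.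
  - apply: continuous_in_subspaceT => z; rewrite inE/= in_itv/= => /andP[xz zy].
    by apply: is_derive_continuous; apply: fd; lra.
  by rewrite normrM ler_wpM2r// dfe// xyP.
move=> x y ax ay; have [xy|yx|->] := ltgtP x y; first exact: main.
  by rewrite distrC [`|y - x|]distrC; exact: main.
by rewrite !subrr normr0 mulr0.
Qed.

Lemma derive_nonincr f df (a b : R) :
  (forall x, a < x < b -> is_derive x 1 f (df x)) ->
  (forall x, a < x < b -> df x <= 0) ->
  forall x y, a < x -> x <= y -> y < b -> f y <= f x.
Proof.
move=> fd dfe x y ax; rewrite le_eqVlt => /predU1P[->//|xy yb].
have xyP z : z \in `]x, y[ -> a < z < b by rewrite in_itv/= => /andP[]; lra.
have [||z zxy Hz] := @MVT _ f df _ _ xy.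
- by move=> z /xyP; exact: fd.
- apply: continuous_in_subspaceT => z; rewrite inE/= in_itv/= => /andP[xz zy].
  by apply: is_derive_continuous; apply: fd; lra.
by rewrite -subr_le0 Hz mulr_le0_ge0// ?subr_ge0 ?(ltW xy)// dfe// xyP.
Qed.

Lemma itv_primitive f (a b c d : R) : a < c -> c < d -> d < b ->
  (forall x, a < x < b -> {for x, continuous f}) ->
  exists F : R -> R, forall x, c < x < d -> is_derive x 1 F (f x).
Proof.
move=> ac cd db cf.
have intf : lebesgue_measure.-integrable `[c, d] (EFin \o f).
  apply: continuous_compact_integrable; first exact: segment_compact.
  apply: continuous_in_subspaceT => z; rewrite inE/= in_itv/= => /andP[cz zd].
  by apply: cf; lra.
exists (fun x => \int[lebesgue_measure]_(t in `[c, x]) f t) => x /andP[cx xd].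
have [] := continuous_FTC1_closed xd intf cx; first by apply: cf; lra.
by move=> df e; apply: (DeriveDef df); rewrite -derive1E.
Qed.

(** By the mean value theorem the difference quotient at [x] is a value of [df] at a nearby point
    other than [x], and [df] is continuous at [x]. This yields the equation at the time where two
    solutions are joined. *)
Lemma is_derive_extend f df (a b x : R) : a < x < b ->
  {for x, continuous f} ->
  (forall y, a < y < b -> y != x -> is_derive y 1 f (df y)) ->
  {for x, continuous df} -> is_derive x 1 f (df x).
Proof.
move=> /andP[ax xb] cf fd cdf; apply/is_deriveP => e e0.
move/cvgrPdist_le : cdf => /(_ _ e0) [d /= d0 Hd].
near=> y.
have ay : a < y by near: y; exact: lt_nbhsr.
have yb : y < b by near: y; exact: lt_nbhsl.
have xyd : `|x - y| < d by near: y; exists d.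
pose g z := f z - df x * z.
have gd z : a < z < b -> z != x -> is_derive z 1 g (df z - df x).
  move=> az zx; rewrite /g; have fz := fd _ az zx.
  have idz : is_derive z 1 (fun z : R => df x * z) (df x).
    have -> : (fun z : R => df x * z) = df x \*: (@id R) by apply/funext.
    by apply: is_derive_eq; rewrite [_ *: _]mulr1.
  exact: is_deriveB.
have cg : {for x, continuous g}.
  apply: cvgB => //; apply: cvgM => //; exact: cvg_cst.
have -> : f y - f x - df x * (y - x) = g y - g x by rewrite /g; ring.
have gc z : a < z < b -> {for z, continuous g}.
  have [->//|zx az] := eqVneq z x.
  by apply: is_derive_continuous (gd _ az zx).
have [xy|yx|->] := ltgtP x y; last by rewrite !subrr normr0 mulr0.
  have [||z + ->] := @MVT _ g (fun z : R => df z - df x) _ _ xy.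
  - move=> z; rewrite in_itv/= => /andP[xz zy]; apply: gd; first lra.
    by rewrite gt_eqF.
  - apply: continuous_in_subspaceT => z; rewrite inE/= in_itv/= => /andP[xz zy].
    by apply: gc; lra.
  rewrite in_itv/= => /andP[xz zy]; rewrite normrM ler_wpM2r// distrC.
  apply: Hd => /=; move: xyd; rewrite !ltr0_norm ?subr_lt0//; lra.
rewrite distrC [`|y - x|]distrC.
have [||z + ->] := @MVT _ g (fun z : R => df z - df x) _ _ yx.
- move=> z; rewrite in_itv/= => /andP[xz zy]; apply: gd; first lra.
  by rewrite lt_eqF.
- apply: continuous_in_subspaceT => z; rewrite inE/= in_itv/= => /andP[xz zy].
  by apply: gc; lra.
rewrite in_itv/= => /andP[xz zy]; rewrite normrM ler_wpM2r// distrC.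
apply: Hd => /=; move: xyd; rewrite !gtr0_norm ?subr_gt0//; lra.
Unshelve. all: by end_near. Qed.

End RealLemmas.

(** * Semi-inner products *)

(* Functions on R^N are not identified when they agree almost everywhere, so
   the forms are only semidefinite, and the algebraic laws are required on the
   domain [D] only, where the integrals make sense. *)
Record semi_inner (R : realType) (E : lmodType R) (D : set E)
    (b : E -> E -> R) : Prop := SemiInner {
  siD0 : D 0;
  siDlin : forall k u v, D u -> D v -> D (k *: u + v);
  silin : forall k u v w, D u -> D v -> D w ->
    b (k *: u + v) w = k * b u w + b v w;
  sisym : forall u v, D u -> D v -> b u v = b v u;
  sige0 : forall u, D u -> 0 <= b u u }.

Definition snrm (R : realType) (E : lmodType R) (b : E -> E -> R) (u : E) : R :=
  Num.sqrt (b u u).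

Section SemiInner.
Context (R : realType) (E : lmodType R) (D : set E) (b : E -> E -> R).
Hypothesis S : semi_inner D b.
Implicit Types (u v w : E) (k : R).
Local Notation n := (snrm b).

Lemma siDD u v : D u -> D v -> D (u + v).
Proof. by move=> Du Dv; rewrite -[u]scale1r; exact: (siDlin S). Qed.

Lemma siDZ k u : D u -> D (k *: u).
Proof. by move=> Du; rewrite -[_ *: _]addr0; apply: (siDlin S) => //; exact: (siD0 S). Qed.

Lemma siDN u : D u -> D (- u).
Proof. by move=> Du; rewrite -scaleN1r; exact: siDZ. Qed.

Lemma siDB u v : D u -> D v -> D (u - v).
Proof. by move=> Du Dv; apply: siDD => //; exact: siDN. Qed.

Lemma siaddl u v w : D u -> D v -> D w -> b (u + v) w = b u w + b v w.
Proof. by move=> Du Dv Dw; rewrite -{1}[u]scale1r (silin S)// mul1r. Qed.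

Lemma si0l w : D w -> b 0 w = 0.
Proof.
move=> Dw; have := siaddl (siD0 S) (siD0 S) Dw; rewrite addr0 => /eqP.
by rewrite -subr_eq subrr => /eqP.
Qed.

Lemma siscalel k u w : D u -> D w -> b (k *: u) w = k * b u w.
Proof.
move=> Du Dw; rewrite -[_ *: _]addr0 (silin S)//; last exact: (siD0 S).
by rewrite si0l// addr0.
Qed.

Lemma sioppl u w : D u -> D w -> b (- u) w = - b u w.
Proof. by move=> Du Dw; rewrite -scaleN1r siscalel// mulN1r. Qed.

Lemma sisubl u v w : D u -> D v -> D w -> b (u - v) w = b u w - b v w.
Proof. by move=> Du Dv Dw; rewrite siaddl ?sioppl//; exact: siDN. Qed.

Lemma siaddr u v w : D u -> D v -> D w -> b w (u + v) = b w u + b w v.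
Proof. by move=> *; rewrite ![b w _](sisym S) ?siaddl//; exact: siDD. Qed.

Lemma siscaler k u w : D u -> D w -> b w (k *: u) = k * b w u.
Proof. by move=> *; rewrite ![b w _](sisym S) ?siscalel//; exact: siDZ. Qed.

Lemma sisubr u v w : D u -> D v -> D w -> b w (u - v) = b w u - b w v.
Proof. by move=> *; rewrite ![b w _](sisym S) ?sisubl//; exact: siDB. Qed.

Lemma snrm_ge0 u : 0 <= n u. Proof. exact: sqrtr_ge0. Qed.

Lemma snrm_sqr u : D u -> n u ^+ 2 = b u u.
Proof. by move=> Du; rewrite sqr_sqrtr// (sige0 S). Qed.

Lemma si_cauchy_schwarz u v : D u -> D v -> `|b u v| <= n u * n v.
Proof.
move=> Du Dv.
have key k : 0 <= k ^+ 2 * b u u + 2 * k * b u v + b v v.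
  have Dku : D (k *: u + v) by exact: (siDlin S).
  have := sige0 S Dku; rewrite (silin S)// (siaddr (siDZ k Du) Dv Du) (siaddr (siDZ k Du) Dv Dv).
  rewrite !siscaler// (sisym S Dv Du); congr (0 <= _); ring.
rewrite -(@ler_pXn2r _ 2)// ?nnegrE ?mulr_ge0 ?snrm_ge0//.
rewrite exprMn !snrm_sqr// real_normK ?num_real//.
have uu := sige0 S Du; have vv := sige0 S Dv.
have [u0|u0] := eqVneq (b u u) 0.
  have [->|d0] := eqVneq (b u v) 0; first by rewrite expr0n/= u0 mul0r.
  (* If [b u u = 0] the quadratic [key] is affine in [k]; this [k] gives it the value [-1]. *)
  have := key (- (b v v + 1) / (2 * b u v)); rewrite u0 mulr0 add0r.
  suff -> : 2 * (- (b v v + 1) / (2 * b u v)) * b u v = - (b v v + 1) by lra.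
  by field.
have up : 0 < b u u by rewrite lt_def u0.
have := key (- b u v / b u u).
have -> : (- b u v / b u u) ^+ 2 * b u u + 2 * (- b u v / b u u) * b u v + b v v
   = b v v - b u v ^+ 2 / b u u by field.
by rewrite subr_ge0 ler_pdivrMr// mulrC.
Qed.

Lemma snrmZ k u : D u -> n (k *: u) = `|k| * n u.
Proof.
move=> Du; rewrite /snrm siscalel// ?siscaler//; last exact: siDZ.
by rewrite mulrA -expr2 sqrtrM ?sqr_ge0// sqrtr_sqr.
Qed.

Lemma snrmN u : D u -> n (- u) = n u.
Proof. by move=> Du; rewrite -scaleN1r snrmZ// normrN1 mul1r. Qed.

Lemma snrm_distC u v : D u -> D v -> n (u - v) = n (v - u).
Proof. by move=> Du Dv; rewrite -opprB snrmN//; exact: siDB. Qed.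

Lemma snrm0 : n 0 = 0.
Proof. by rewrite /snrm si0l ?sqrtr0//; exact: (siD0 S). Qed.

Lemma ler_snrmD u v : D u -> D v -> n (u + v) <= n u + n v.
Proof.
move=> Du Dv.
rewrite -(@ler_pXn2r _ 2)// ?nnegrE ?addr_ge0 ?snrm_ge0//.
have Duv := siDD Du Dv.
rewrite sqrrD !snrm_sqr// siaddl// !siaddr// (sisym S Dv Du).
have := si_cauchy_schwarz Du Dv; rewrite ler_norml => /andP[_]; lra.
Qed.

Lemma ler_snrmB u v w : D u -> D v -> D w -> n (u - w) <= n (u - v) + n (v - w).
Proof.
move=> Du Dv Dw; have -> : u - w = (u - v) + (v - w) by rewrite addrA subrK.
by apply: ler_snrmD; exact: siDB.
Qed.

Lemma ler_dist_snrm u v : D u -> D v -> `|n u - n v| <= n (u - v).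
Proof.
move=> Du Dv; rewrite ler_norml; apply/andP; split.
  have := ler_snrmD (siDB Dv Du) Du; rewrite subrK snrm_distC//; lra.
have := ler_snrmD (siDB Du Dv) Dv; rewrite subrK; lra.
Qed.

Lemma snrm_le u v : D u -> D v -> n u <= n v + n (u - v).
Proof. by move=> Du Dv; have := ler_dist_snrm Du Dv; rewrite ler_norml => /andP[_]; lra. Qed.

Lemma si_parallelogram u v : D u -> D v ->
  b (u - v) (u - v) = 2 * b u u + 2 * b v v - b (u + v) (u + v).
Proof.
move=> Du Dv; have Duv := siDD Du Dv; have Dmv := siDB Du Dv.
rewrite (siaddl Du Dv Duv) !(siaddr Du Dv)// (sisubl Du Dv Dmv) !(sisubr Du Dv)//.
ring.
Qed.

Lemma snrm_cvg (T : Type) (F : set_system T) {FF : Filter F} (w : T -> E) w0 :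
  D w0 -> (\forall x \near F, D (w x)) -> n (w x - w0) @[x --> F] --> (0 : R) ->
  n (w x) @[x --> F] --> n w0.
Proof.
move=> D0 Dw; apply: cvg_dist_le; apply: filterS Dw => x Dx.
exact: ler_dist_snrm.
Qed.

Lemma si_cvg (T : Type) (F : set_system T) {FF : Filter F} (w v : T -> E) w0 v0 :
  D w0 -> D v0 -> (\forall x \near F, D (w x)) -> (\forall x \near F, D (v x)) ->
  n (w x - w0) @[x --> F] --> (0 : R) -> n (v x - v0) @[x --> F] --> (0 : R) ->
  b (w x) (v x) @[x --> F] --> b w0 v0.
Proof.
move=> D0 D0' Dw Dv cw cv.
apply: (@cvg_dist_le _ _ _ _ _
  (fun x => n (w x - w0) * n (v x) + n w0 * n (v x - v0))).
  apply: filterS2 Dw Dv => x Dx Dx'.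
  have -> : b (w x) (v x) - b w0 v0 = b (w x - w0) (v x) + b w0 (v x - v0).
    by rewrite sisubl// sisubr//; ring.
  apply: le_trans (ler_normD _ _) _; apply: lerD.
    by apply: si_cauchy_schwarz => //; exact: siDB.
  by apply: si_cauchy_schwarz => //; exact: siDB.
rewrite -[X in _ --> X]addr0 -[X in _ --> X + _](mul0r (n v0)) -[X in _ --> _ + X](mulr0 (n w0)).
apply: cvgD; apply: cvgM => //; last exact: cvg_cst.
exact: snrm_cvg.
Qed.

Lemma si_cvgl (T : Type) (F : set_system T) {FF : Filter F} (w : T -> E) w0 v :
  D w0 -> D v -> (\forall x \near F, D (w x)) ->
  n (w x - w0) @[x --> F] --> (0 : R) -> b (w x) v @[x --> F] --> b w0 v.
Proof.
move=> D0 Dv Dw cw; apply: si_cvg => //; first exact: nearW.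
by rewrite subrr snrm0; exact: cvg_cst.
Qed.

End SemiInner.

(** * Abstract wave equations *)

Record wave_triple (R : realType) (E : lmodType R) (L H : set E)
    (ip form : E -> E -> R) : Prop := WaveTriple {
  wtL : semi_inner L ip;
  wtH : semi_inner H form;
  wtHL : H `<=` L;
  wtK : exists2 K, 0 <= K & forall u, H u -> snrm ip u <= K * snrm form u }.

(* [w] solves [w'' + A w = g] weakly on the interval ]c, d[, where [A] is the
   operator of [form] and [wt] is the derivative of [w]. *)
Record wave_on (R : realType) (E : lmodType R) (L H : set E)
    (ip form : E -> E -> R) (c d : R) (w wt g : R -> E) : Prop := WaveOn {
  woH : forall t, c < t < d -> H (w t);
  woL : forall t, c < t < d -> L (wt t);
  wog : forall t, c < t < d -> L (g t);
  wocH : forall t, c < t < d -> snrm form (w r - w t) @[r --> t] --> (0 : R);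
  wocL : forall t, c < t < d -> snrm ip (wt r - wt t) @[r --> t] --> (0 : R);
  wocg : forall t, c < t < d -> snrm ip (g r - g t) @[r --> t] --> (0 : R);
  wod : forall v, L v -> forall t, c < t < d ->
    is_derive t 1 (fun r : R => ip (w r) v) (ip (wt t) v);
  wodd : forall v, H v -> forall t, c < t < d ->
    is_derive t 1 (fun r : R => ip (wt r) v) (- form (w t) v + ip (g t) v) }.

Lemma near_in_itv (R : realType) (c d t : R) : c < t < d ->
  \forall r \near t, c < r < d.
Proof.
move=> /andP[ct td]; near=> r; apply/andP; split; near: r.
  exact: lt_nbhsr.
exact: lt_nbhsl.
Unshelve. all: by end_near. Qed.

(** Divide by [snrm ip x]. Derivatives are known only against fixed test elements; testing with the
    element to be estimated recovers a norm bound. *)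
Lemma snrm_test_le (R : realType) (E : lmodType R) (L : set E) (ip : E -> E -> R)
  (S : semi_inner L ip) (x : E) (B : R) : L x -> 0 <= B ->
  `|ip x x| <= B * snrm ip x -> snrm ip x <= B.
Proof.
move=> Lx B0; rewrite ger0_norm ?(sige0 S)// -(snrm_sqr S)// expr2.
have [->//|x0] := eqVneq (snrm ip x) 0.
by rewrite ler_pM2r// lt_def x0 (snrm_ge0 ip x).
Qed.

(** * Weak time derivatives and the product rule *)

Section Wave.
Context (R : realType) (E : lmodType R) (L H : set E) (ip form : E -> E -> R).
Hypothesis WT : wave_triple L H ip form.
Let SL := wtL WT.
Let SH := wtH WT.
Let HL := wtHL WT.
Local Notation nL := (snrm ip).
Local Notation nH := (snrm form).

Lemma nH_cvg_nL (T : Type) (F : set_system T) {FF : Filter F} (w : T -> E) w0 :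
  H w0 -> (\forall x \near F, H (w x)) -> nH (w x - w0) @[x --> F] --> (0 : R) ->
  nL (w x - w0) @[x --> F] --> (0 : R).
Proof.
move=> H0 Hw cw; have [K K0 HK] := wtK WT.
apply: (@cvg_dist_le _ _ _ _ _ (fun x => K * nH (w x - w0))).
  apply: filterS Hw => x Hx.
  by rewrite subr0 ger0_norm ?snrm_ge0// HK//; exact: (siDB SH).
by rewrite -(mulr0 K); apply: cvgM => //; exact: cvg_cst.
Qed.

(** The remainder [x] is itself the test element: the scalar mean value inequality for
    [ip (w s) x - s * ip z x] bounds [ip x x] by a multiple of [snrm ip x]. *)
Lemma weak_mvt (w wt : R -> E) (c d : R) (z : E) (e : R) : L z ->
  (forall t, c < t < d -> L (w t)) -> (forall t, c < t < d -> L (wt t)) ->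
  (forall v, L v -> forall t, c < t < d ->
    is_derive t 1 (fun r : R => ip (w r) v) (ip (wt t) v)) ->
  (forall t, c < t < d -> nL (wt t - z) <= e) ->
  forall t r, c < t < d -> c < r < d ->
    nL (w r - w t - (r - t) *: z) <= e * `|r - t|.
Proof.
move=> Lz Lw Lwt dw wtz t r ct cr.
have e0 : 0 <= e by apply: le_trans (wtz _ ct); exact: snrm_ge0.
set x := w r - w t - (r - t) *: z.
have Lx : L x.
  exact: (siDB SL (siDB SL (Lw _ cr) (Lw _ ct)) (siDZ SL _ Lz)).
apply: (snrm_test_le SL) => //; first by rewrite mulr_ge0.
have idx s : c < s < d -> is_derive s 1 (fun s : R => ip (w s) x - s * ip z x) (ip (wt s - z) x).
  move=> cs; rewrite (sisubl SL)//; last exact: Lwt.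
  apply: is_deriveB; first exact: dw.
  have -> : (fun s : R => s * ip z x) = ip z x \*: (@id R) by apply/funext => y /=; rewrite mulrC.
  by apply: is_derive_eq; rewrite [_ *: _]mulr1.
have bd s : c < s < d -> `|ip (wt s - z) x| <= e * nL x.
  move=> cs; apply: le_trans (si_cauchy_schwarz SL _ Lx) _.
    by apply: (siDB SL) => //; exact: Lwt.
  by rewrite ler_wpM2r ?snrm_ge0// wtz.
have := mvt_le idx bd ct cr; rewrite mulrAC; apply: le_trans.
rewrite le_eqVlt; apply/orP; left; apply/eqP; congr `|_|.
have Lwr := Lw _ cr; have Lwt0 := Lw _ ct.
rewrite {1}/x (sisubl SL)//; [|exact: (siDB SL)|exact: (siDZ SL)].
by rewrite (sisubl SL)// (siscalel SL)//; ring.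
Qed.

Section WaveOn.
Variables (c d : R) (w wt g : R -> E).
Hypothesis W : wave_on L H ip form c d w wt g.

Lemma wave_near_H t : c < t < d -> \forall r \near t, H (w r).
Proof. by move=> /near_in_itv; apply: filterS => r; exact: (woH W). Qed.

Lemma wave_near_L t : c < t < d -> \forall r \near t, L (wt r).
Proof. by move=> /near_in_itv; apply: filterS => r; exact: (woL W). Qed.

(** The equation bounds the derivative of [ip (wt r) v] by a multiple of [nH v], so [wt] is
    Lipschitz at [t] as a functional on [H]. Its continuity in [L] has no rate, and the product rule
    needs one. *)
Lemma wave_dual_lip t : c < t < d -> exists2 C, 0 <= C &
  \forall r \near t, forall v, H v -> `|ip (wt r - wt t) v| <= C * `|r - t| * nH v.
Proof.
move=> ct; have [K K0 HK] := wtK WT.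
pose C := (nH (w t) + 1) + (nL (g t) + 1) * K.
have C0 : 0 <= C.
  by rewrite addr_ge0 ?mulr_ge0// addr_ge0// snrm_ge0.
exists C => //.
have hH : \forall r \near t, nH (w r) <= nH (w t) + 1.
  move/cvgrPdist_le: (wocH W ct) => /(_ _ ltr01); move: (near_in_itv ct).
  apply: filterS2 => r cr; rewrite sub0r normrN ger0_norm ?snrm_ge0// => h.
  apply: le_trans (snrm_le SH (woH W cr) (woH W ct)) _; lra.
have hg : \forall r \near t, nL (g r) <= nL (g t) + 1.
  move/cvgrPdist_le: (wocg W ct) => /(_ _ ltr01); move: (near_in_itv ct).
  apply: filterS2 => r cr; rewrite sub0r normrN ger0_norm ?snrm_ge0// => h.
  apply: le_trans (snrm_le SL (wog W cr) (wog W ct)) _; lra.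
have [d0 /= d00 Hd] : \forall r \near t, [/\ c < r < d, nH (w r) <= nH (w t) + 1 & nL (g r) <= nL (g t) + 1].
  by near=> r; split; near: r => //; exact: near_in_itv.
exists d0 => // r /= rt v Hv.
have bnd s : t - d0 < s < t + d0 -> [/\ c < s < d, nH (w s) <= nH (w t) + 1 & nL (g s) <= nL (g t) + 1].
  by move=> ts; apply: Hd => /=; rewrite ltr_norml; apply/andP; split; lra.
have rt' : t - d0 < r < t + d0 by move: rt; rewrite ltr_norml => /andP[]; lra.
have tt : t - d0 < t < t + d0 by lra.
have Lv := HL Hv.
have cr : c < r < d by have [] := bnd _ rt'.
rewrite (sisubl SL (woL W cr) (woL W ct) Lv).
rewrite mulrAC.
apply: (@mvt_le _ (fun r : R => ip (wt r) v) (fun s : R => - form (w s) v + ip (g s) v)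
  _ _ _ _ _ _ _ tt rt') => s /bnd[cs h1 h2].
  exact: (wodd W).
have Hs := woH W cs; have Gs := wog W cs.
apply: le_trans (ler_normD _ _) _; rewrite normrN /C mulrDl; apply: lerD.
  apply: le_trans (si_cauchy_schwarz SH _ _) _ => //.
  by rewrite ler_wpM2r// snrm_ge0.
apply: le_trans (si_cauchy_schwarz SL _ _) _ => //.
apply: (@le_trans _ _ ((nL (g t) + 1) * nL v)); first by rewrite ler_wpM2r// snrm_ge0.
by rewrite -mulrA ler_wpM2l ?HK// addr_ge0// snrm_ge0.
Unshelve. all: by end_near. Qed.

(** Each factor is differentiable only against fixed elements. Freezing one factor at a time gives
    the terms of the derivative; what remains is the pairing of the two increments. It is
    [o(|r - t|)]: [wave_dual_lip] gives the rate for [wt] as a functional on [H], and the increment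
    of [w] tends to 0 in [H]. *)
Lemma wave_product h t : c < t < d -> c < t + h < d ->
  is_derive t 1 (fun r : R => ip (wt r) (w (r + h)))
    (- form (w t) (w (t + h)) + ip (g t) (w (t + h)) + ip (wt t) (wt (t + h))).
Proof.
move=> ct cth.
have cvh : (fun r : R => r + h) @ t --> t + h.
  by apply: cvgD; [exact: cvg_id|exact: cvg_cst].
have Hth : \forall r \near t, H (w (r + h)) := cvh _ (wave_near_H cth).
have Hwth := woH W cth; have Lwth := HL Hwth.
have Lwt := woL W ct; have Lwth' := woL W cth.
have h1 : is_derive t 1 (fun r : R => ip (wt r) (w (t + h))) (- form (w t) (w (t + h)) + ip (g t) (w (t + h))).
  exact: (wodd W).
have h2 : is_derive t 1 (fun r : R => ip (w (r + h)) (wt t)) (ip (wt (t + h)) (wt t)).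
  exact: (@is_derive_addr _ (fun r : R => ip (w r) (wt t)) t h _ (wod W Lwt cth)).
have h3 : is_derive t 1 (fun r : R => ip (wt r - wt t) (w (r + h) - w (t + h))) 0.
  apply/is_deriveP => e e0; have [C C0 HC] := wave_dual_lip ct.
  have ew : \forall r \near t, C * nH (w (r + h) - w (t + h)) <= e.
    have C1 : 0 < C + 1 by lra.
    have : \forall r \near t, nH (w (r + h) - w (t + h)) <= e / (C + 1) :=
      cvh _ (cvgr_le _ (wocH W cth) (e / (C + 1)) (divr_gt0 e0 C1)).
    move=> near_w; near=> r.
    have hr : nH (w (r + h) - w (t + h)) <= e / (C + 1) by near: r; exact: near_w.
    have : C * nH (w (r + h) - w (t + h)) <= (C + 1) * (e / (C + 1)).
      by apply: ler_pM => //; [exact: snrm_ge0|lra].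
    by rewrite mulrCA divff ?mulr1// gt_eqF.
  near=> r.
  have Hr : H (w (r + h)) by near: r.
  rewrite mul0r subr0 !subrr (si0l SL) ?subr0; last exact: (siD0 SL).
  have /(_ (w (r + h) - w (t + h)) (siDB SH Hr Hwth)) : forall v, H v -> `|ip (wt r - wt t) v| <= C * `|r - t| * nH v by near: r.
  move=> /le_trans; apply; rewrite mulrAC ler_wpM2r//.
  by near: r.
have : is_derive t 1 (fun r : R => ip (wt r) (w (t + h)) + ip (w (r + h)) (wt t) - ip (wt t) (w (t + h)) + ip (wt r - wt t) (w (r + h) - w (t + h)))
  ((- form (w t) (w (t + h)) + ip (g t) (w (t + h))) + ip (wt (t + h)) (wt t) - 0 + 0).
  exact: (is_deriveD (is_deriveB (is_deriveD h1 h2) (is_derive_cst (ip (wt t) (w (t + h))) t 1)) h3).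
rewrite subr0 addr0 (sisym SL Lwth' Lwt); apply: is_derive_near.
near=> r.
have Hr : L (w (r + h)) by apply: HL; near: r.
have Lr : L (wt r) by near: r; exact: wave_near_L.
by rewrite (sisym SL Hr)// (sisubl SL)//; [rewrite !(sisubr SL)//; ring|exact: (siDB SL)].
Unshelve. all: by end_near. Qed.

End WaveOn.
End Wave.

(** * The energy identity *)

Section WaveEnergy.
Context (R : realType) (E : lmodType R) (L H : set E) (ip form : E -> E -> R).
Hypothesis WT : wave_triple L H ip form.
Let SL := wtL WT.
Let SH := wtH WT.
Let HL := wtHL WT.
Local Notation nL := (snrm ip).
Local Notation nH := (snrm form).
Variables (c d : R) (w wt g : R -> E).
Hypothesis W : wave_on L H ip form c d w wt g.

Definition wave_energy (w wt : R -> E) (t : R) : R :=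
  form (w t) (w t) + ip (wt t) (wt t).

(* [wt t] is not an admissible test function, so the equation is tested with
   [(w (t + h) - w (t - h)) / (2 h)] instead, that is, [D h t / (2 h)] is
   differentiated. The derivative contains [(P h t - P h (t + h)) / (2 h)], which
   is removed by adding the mean value [(Pi (t + h) - Pi t) / (2 h)] where
   [Pi' = P h]. The sum tends to half of the energy as [h] tends to [0]. *)
Let P (h r : R) : R := form (w r) (w (r - h)) - ip (wt r) (wt (r - h)).

Let D (h r : R) : R := ip (wt r) (w (r + h)) - ip (wt r) (w (r - h)).

Let D_derive h t : c < t < d -> c < t + h < d -> c < t - h < d ->
  is_derive t 1 (D h) (ip (g t) (w (t + h) - w (t - h)) - P h (t + h) + P h t).
Proof.
move=> ct cth cth'; have := wave_product WT W ct cth'; have := wave_product WT W ct cth.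
move=> h1 h2; apply: (is_derive_eq (is_deriveB h1 h2)).
have [Hp Hm] := (woH W cth, woH W cth'); have [Lp Lm] := (HL Hp, HL Hm).
rewrite (sisubr SL Lp Lm (wog W ct)) /P addrK.
rewrite (sisym SH (woH W ct) Hp) (sisym SL (woL W ct) (woL W cth)); ring.
Qed.

(** The two times are independent because [P h] is later evaluated at an intermediate point that
    depends on [h]. *)
Let P_cvg t : c < t < d ->
  (fun p : R * R => form (w p.1) (w p.2) - ip (wt p.1) (wt p.2)) @ (t, t) -->
  form (w t) (w t) - ip (wt t) (wt t).
Proof.
move=> ct.
have c1 : fst @ nbhs (t, t) --> t by exact: cvg_fst.
have c2 : snd @ nbhs (t, t) --> t by exact: cvg_snd.
have [Ht Lt] := (woH W ct, woL W ct).
have nH1 := wave_near_H W ct; have nL1 := wave_near_L W ct.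
apply: cvgB.
  apply: (si_cvg SH) => //; [exact: c1 _ nH1|exact: c2 _ nH1| |].
    exact: (cvg_comp _ _ c1 (wocH W ct)).
  exact: (cvg_comp _ _ c2 (wocH W ct)).
apply: (si_cvg SL) => //; [exact: c1 _ nL1|exact: c2 _ nL1| |].
  exact: (cvg_comp _ _ c1 (wocL W ct)).
exact: (cvg_comp _ _ c2 (wocL W ct)).
Qed.

Let P_cont h t : c < t < d -> c < t - h < d -> {for t, continuous (P h)}.
Proof.
move=> ct cth.
have cvh : (fun r : R => r - h) @ t --> t - h.
  by apply: cvgB; [exact: cvg_id|exact: cvg_cst].
have [Ht Lt] := (woH W ct, woL W ct); have [Hh Lh] := (woH W cth, woL W cth).
have n1 := wave_near_H W ct; have n2 := wave_near_L W ct.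
have n3 := cvh _ (wave_near_H W cth); have n4 := cvh _ (wave_near_L W cth).
have c1 := wocH W ct; have c2 := wocL W ct.
have c3 := cvg_comp _ _ cvh (wocH W cth); have c4 := cvg_comp _ _ cvh (wocL W cth).
have cH := si_cvg SH Ht Hh n1 n3 c1 c3.
have cL := si_cvg SL Lt Lh n2 n4 c2 c4.
exact: cvgB (cH _) (cL _).
Qed.

Let wmvt t0 (a b e : R) : c <= a -> b <= d -> c < t0 < d ->
  (forall t, a < t < b -> nL (wt t - wt t0) <= e) ->
  forall t r, a < t < b -> a < r < b ->
  nL (w r - w t - (r - t) *: wt t0) <= e * `|r - t|.
Proof.
move=> ca bd ct0 He.
have sub t : a < t < b -> c < t < d by lra.
apply: (weak_mvt WT (woL W ct0) (w := w) (wt := wt)).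
- by move=> t /sub ct; apply: HL; exact: (woH W ct).
- by move=> t /sub ct; exact: (woL W ct).
- by move=> v Lv t /sub ct; exact: (wod W Lv ct).
- exact: He.
Qed.

(** Only the factor [w] varies in [D h t], so its weak derivative against the fixed element [wt t],
    used on both sides of [t], is enough. *)
Let limD t : c < t < d -> forall e : R, 0 < e -> exists2 h0, 0 < h0 &
  forall h, 0 < h -> h < h0 -> `|D h t / (2 * h) - ip (wt t) (wt t)| <= e.
Proof.
move=> ct e e0.
have := near_in_itv ct => -[d1 /= d10 H1].
have /is_deriveP/(_ _ e0)[d2 /= d20 H2] := wod W (woL W ct) ct.
exists (Num.min d1 d2); first by rewrite lt_min d10.
move=> h h0; rewrite lt_min => /andP[hd1 hd2].
have cp : c < t + h < d by apply: H1 => /=; rewrite opprD addrA subrr add0r normrN gtr0_norm.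
have cm : c < t - h < d by apply: H1 => /=; rewrite opprB addrC subrK gtr0_norm.
have := H2 (t + h); rewrite /= opprD addrA subrr add0r normrN (gtr0_norm h0) => /(_ hd2) hp.
have := H2 (t - h); rewrite /= opprB [t + (h - t)]addrC subrK (gtr0_norm h0) => /(_ hd2) hm.
have [Lp Lm] := (HL (woH W cp), HL (woH W cm)); have Lt := woL W ct.
rewrite /D (sisym SL Lt Lp) (sisym SL Lt Lm).
move: hp hm; set x := ip (w (t + h)) _; set y := ip (w (t - h)) _; set z := ip (w t) _; set v := ip (wt t) _.
have -> : t + h - t = h by ring.
have -> : t - h - t = - h by ring.
rewrite normrN (gtr0_norm h0) !ler_norml => /andP[a1 a2] /andP[a3 a4].
have -> : (x - y) / (2 * h) - v = (x - y - 2 * h * v) / (2 * h) by field; rewrite gt_eqF.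
have h20 : 0 < 2 * h by lra.
by rewrite ler_pdivlMr// ler_pdivrMr//; apply/andP; split; nra.
Qed.

(** [A h Pi] below is the corrected quotient, with limit half the energy. For every small [h] the
    function [A h Pi r - p * r] has derivative at most [e / 2] near [t0] ([key1]). The neighbourhood
    does not depend on [h], so the estimate survives the limit [h -> 0] at the two times [t] and
    [t0] ([key2]); doubling gives the claim. *)
Lemma wave_energy_derive t0 : c < t0 < d ->
  is_derive t0 1 (wave_energy w wt) (2 * ip (g t0) (wt t0)).
Proof.
move=> ct0; apply/is_deriveP => e e0.
set p := ip (g t0) (wt t0).
have [Lt0 Lg0] := (woL W ct0, wog W ct0).
(* The derivative of [A h Pi r - p * r] will be at most [e1 * M]: [nL (wt t0)] is the factor of the
   error in [g], and [nL (g t0) + 1] bounds [nL (g r)], the factor of the error in [wt]. *)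
pose M := nL (wt t0) + nL (g t0) + 1.
have M0 : 0 < M by rewrite /M; have := snrm_ge0 ip (wt t0); have := snrm_ge0 ip (g t0); lra.
pose e1 := Num.min 1 (e / 2 / M).
have e10 : 0 < e1 by rewrite lt_min ltr01 !divr_gt0.
have e1M : e1 * M <= e / 2 by rewrite -ler_pdivlMr// ge_min lexx orbT.
have e11 : e1 <= 1 by rewrite ge_min lexx.
have [dl /= dl0 Hdl] : \forall r \near t0, [/\ c < r < d, nL (wt r - wt t0) <= e1 & nL (g r - g t0) <= e1].
  have h1 := near_in_itv ct0.
  have h2 := cvgr_le _ (wocL W ct0) e1; have h3 := cvgr_le _ (wocg W ct0) e1.
  by near=> r; split; near: r; [exact: h1|exact: h2|exact: h3].
have Hb r : t0 - dl < r < t0 + dl -> [/\ c < r < d, nL (wt r - wt t0) <= e1 & nL (g r - g t0) <= e1].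
  by move=> tr; apply: Hdl => /=; rewrite ltr_norml; apply/andP; split; lra.
have sub r : t0 - dl < r < t0 + dl -> c < r < d by move=> /Hb[].
have ca : c <= t0 - dl.
  rewrite leNgt; apply/negP => h.
  have /sub : t0 - dl < c < t0 + dl by move: ct0; lra.
  by rewrite ltxx.
have bd : t0 + dl <= d.
  rewrite leNgt; apply/negP => h.
  have /sub : t0 - dl < d < t0 + dl by move: ct0; lra.
  by rewrite ltxx andbF.
(* Half the radius, so that [r + h] and [r - h] stay where the estimates hold when [h < dl2 / 2]. *)
pose dl2 := dl / 2.
exists dl2; first by rewrite /= divr_gt0.
move=> t /= tt0.
have It : t0 - dl2 < t < t0 + dl2 by move: tt0; rewrite ltr_norml => /andP[]; lra.
have It0 : t0 - dl2 < t0 < t0 + dl2 by rewrite /dl2; lra.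
have exPi h : 0 < h -> h < dl2 / 2 -> exists Pi, forall x, t0 - dl2 < x < t0 + dl2 + h -> is_derive x 1 Pi (P h x).
  move=> h0 hdl.
  apply: (@itv_primitive _ (P h) (t0 - dl + h) (t0 + dl)); rewrite /dl2 in hdl *; try lra.
  by move=> x xi; apply: P_cont; apply: sub; lra.
pose A h Pi r := D h r / (2 * h) + (Pi (r + h) - Pi r) / (2 * h) : R.
have key1 (h : R) (Pi : R -> R) : 0 < h -> h < dl2 / 2 ->
    (forall x : R, t0 - dl2 < x < t0 + dl2 + h -> is_derive x 1 Pi (P h x)) ->
    `|A h Pi t - p * t - (A h Pi t0 - p * t0)| <= e / 2 * `|t - t0|.
  move=> h0 hdl dPi.
  pose dA r := ip (g r) (w (r + h) - w (r - h)) / (2 * h) - p.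
  apply: (@mvt_le _ (fun r : R => A h Pi r - p * r) dA (t0 - dl2) (t0 + dl2)) => //.
    move=> r Ir.
    have [r1 r2 r3] : [/\ c < r < d, c < r + h < d & c < r - h < d].
      by split; apply: sub; rewrite /dl2 in hdl Ir *; lra.
    have q1 := D_derive r1 r2 r3.
    have q2 : is_derive r 1 (fun y : R => Pi (y + h)) (P h (r + h)).
      by apply: is_derive_addr; apply: dPi; lra.
    have q3 : is_derive r 1 Pi (P h r) by apply: dPi; lra.
    have idz : is_derive r 1 (fun z : R => p * z) p.
      have -> : (fun z : R => p * z) = p \*: (@id R) by apply/funext.
      by apply: is_derive_eq; rewrite [_ *: _]mulr1.
    have -> : (fun r : R => A h Pi r - p * r) = ((2 * h)^-1 \*: (D h \+ ((fun y : R => Pi (y + h)) \- Pi))) \- (fun z : R => p * z).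
      by apply/funext => y /=; rewrite /A /= [in RHS]/GRing.scale/=; ring.
    (* The values of [P h] at [r] and [r + h] coming from [D_derive] cancel against those coming
       from [Pi]. *)
    apply: is_derive_eq; rewrite /dA [_ *: _]mulrC; congr (_ * _ - _); ring.
  move=> r Ir; rewrite /dA.
  have [r1 r1' r1''] : [/\ c < r < d, nL (wt r - wt t0) <= e1 & nL (g r - g t0) <= e1].
    by apply: Hb; rewrite /dl2 in Ir; lra.
  have rp : t0 - dl < r + h < t0 + dl by rewrite /dl2 in Ir hdl; lra.
  have rm : t0 - dl < r - h < t0 + dl by rewrite /dl2 in Ir hdl; lra.
  have := wmvt ca bd ct0 (fun t It => let: And3 _ q _ := Hb t It in q) rm rp.
  set y := w (r + h) - w (r - h).
  have -> : r + h - (r - h) = 2 * h by ring.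
  have h20 : 0 < 2 * h by lra.
  rewrite (gtr0_norm h20) => Hy.
  have Ly : L y by apply: (siDB SL); apply: HL; [exact: (woH W (sub _ rp))|exact: (woH W (sub _ rm))].
  have Lr := wog W r1.
  have Lwz : L (y - (2 * h) *: wt t0) by apply: (siDB SL) => //; exact: (siDZ SL).
  have Lgz : L (g r - g t0) by exact: (siDB SL).
  have -> : ip (g r) y / (2 * h) - p = (ip (g r) (y - (2 * h) *: wt t0) + 2 * h * ip (g r - g t0) (wt t0)) / (2 * h).
    rewrite (sisubr SL Ly (siDZ SL _ Lt0) Lr) (siscaler SL _ Lt0 Lr) (sisubl SL Lr Lg0 Lt0) -/p.
    by field; rewrite gt_eqF.
  rewrite normrM normfV (gtr0_norm h20) ler_pdivrMr//.
  apply: le_trans (ler_normD _ _) _; rewrite [X in _ + X]normrM (gtr0_norm h20).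
  have c1 := si_cauchy_schwarz SL Lr Lwz; have c2 := si_cauchy_schwarz SL Lgz Lt0.
  have gr : nL (g r) <= nL (g t0) + e1 by apply: le_trans (snrm_le SL Lr Lg0) _; rewrite lerD2l.
  apply: (@le_trans _ _ ((nL (g t0) + 1) * (e1 * (2 * h)) + 2 * h * (e1 * nL (wt t0)))).
    apply: lerD.
      apply: le_trans c1 _; apply: ler_pM => //; [exact: snrm_ge0|exact: snrm_ge0|lra].
    rewrite ler_wpM2l ?(ltW h20)//; apply: le_trans c2 _.
    by rewrite ler_wpM2r// snrm_ge0.
  have -> : (nL (g t0) + 1) * (e1 * (2 * h)) + 2 * h * (e1 * nL (wt t0)) = (e1 * M) * (2 * h).
    by rewrite /M; ring.
  by rewrite ler_wpM2r// ltW.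
have key2 (s : R) : t0 - dl2 < s < t0 + dl2 -> forall eta : R, 0 < eta -> exists2 h0 : R, 0 < h0 &
    forall (h : R) (Pi : R -> R), 0 < h -> h < h0 -> h < dl2 / 2 ->
    (forall x : R, t0 - dl2 < x < t0 + dl2 + h -> is_derive x 1 Pi (P h x)) ->
    `|A h Pi s - wave_energy w wt s / 2| <= eta.
  move=> Is eta eta0.
  have cs : c < s < d by apply: sub; rewrite /dl2 in Is; lra.
  have e20 : 0 < eta / 2 by lra.
  have [h1 h10 Hh1] := limD cs e20.
  have /cvgrPdist_le/(_ _ eta0)[[B1 B2] /= [[b1 /= b10 Hb1] [b2 /= b20 Hb2]] HB] := P_cvg cs.
  exists (Num.min h1 (Num.min b1 b2)); first by rewrite !lt_min h10 b10.
  move=> h Pi h0; rewrite !lt_min => /and3P[hh1 hb1 hb2] hdl dPi.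
  have h20 : 0 < 2 * h by lra.
  have ssh : s < s + h by lra.
  (* The mean of [P h] over [[s, s + h]] is its value at some [x], to which the joint limit at
     [(s, s)] applies. *)
  have [||x] := @MVT _ Pi (P h) s (s + h) ssh.
  - by move=> x; rewrite in_itv/= => /andP[x1 x2]; apply: dPi; lra.
  - apply: continuous_in_subspaceT => z; rewrite inE/= in_itv/= => /andP[xz zy].
    by apply: is_derive_continuous; apply: dPi; lra.
  rewrite in_itv/= => /andP[x1 x2] HPi.
  have q1 : B1 x by apply: Hb1 => /=; rewrite ltr_norml; apply/andP; split; lra.
  have q2 : B2 (x - h) by apply: Hb2 => /=; rewrite ltr_norml; apply/andP; split; lra.
  have /= Hlim := HB (x, x - h) (conj q1 q2).
  have := Hh1 _ h0 hh1.
  rewrite /A HPi /wave_energy.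
  have -> : P h x * (s + h - s) / (2 * h) = P h x / 2 by field; rewrite gt_eqF.
  move: Hlim; rewrite -/(P h x).
  set x1' := D h s / _; set x2' := P h x; set x3 := form _ _; set x4 := ip _ _.
  by rewrite !ler_norml => /andP[? ?] /andP[? ?]; apply/andP; split; lra.
apply/ler_addgt0Pr => eta eta0.
have e4 : 0 < eta / 4 by lra.
have [h1 h10 H1] := key2 _ It _ e4; have [h2 h20 H2] := key2 _ It0 _ e4.
pose h := Num.min (Num.min h1 h2) (dl2 / 2) / 2.
have mp : 0 < Num.min (Num.min h1 h2) (dl2 / 2).
  by rewrite !lt_min h10 h20 /dl2 !divr_gt0.
have h0 : 0 < h by rewrite divr_gt0.
have : h < Num.min (Num.min h1 h2) (dl2 / 2) by rewrite /h; lra.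
rewrite !lt_min => /andP[/andP[hh1 hh2] hdl].
have [Pi dPi] := exPi h h0 hdl.
have := key1 _ _ h0 hdl dPi; have := H1 _ _ h0 hh1 hdl dPi; have := H2 _ _ h0 hh2 hdl dPi.
have : 0 <= `|t - t0| by [].
move: (A h Pi t) (A h Pi t0) (wave_energy w wt t) (wave_energy w wt t0) `|t - t0|.
move=> a1 a2 k1 k2 z z0.
rewrite !ler_norml => /andP[? ?] /andP[? ?] /andP[? ?]; apply/andP; split; lra.
Unshelve. all: by end_near. Qed.

End WaveEnergy.

(** * Cauchy property at an end time and joining of waves *)

Section WaveExtend.
Context (R : realType) (E : lmodType R) (L H : set E) (ip form : E -> E -> R).
Hypothesis WT : wave_triple L H ip form.
Let SL := wtL WT.
Let SH := wtH WT.
Let HL := wtHL WT.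
Local Notation nL := (snrm ip).
Local Notation nH := (snrm form).

Lemma wave_on_shift_sub (c d : R) (w wt g : R -> E) (h : R) :
  wave_on L H ip form c d w wt g -> 0 < h ->
  wave_on L H ip form c (d - h) (fun t => w (t + h) - w t)
    (fun t => wt (t + h) - wt t) (fun t => g (t + h) - g t).
Proof.
move=> W h0.
have sub t : c < t < d - h -> c < t < d /\ c < t + h < d by split; lra.
have cvh (t : R) : (fun r : R => r + h) @ t --> t + h.
  by apply: cvgD; [exact: cvg_id|exact: cvg_cst].
have aux (D : set E) (b : E -> E -> R) (S : semi_inner D b) (z : R -> E) (t : R) : c < t < d - h ->
    (forall t, c < t < d -> D (z t)) ->
    (forall t, c < t < d -> snrm b (z r - z t) @[r --> t] --> (0 : R)) ->
    snrm b (z (r + h) - z r - (z (t + h) - z t)) @[r --> t] --> (0 : R).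
  move=> ct Dz cz; have [ct1 ct2] := sub _ ct.
  have c1 := cvg_comp _ _ (cvh t) (cz _ ct2); have c2 := cz _ ct1.
  have c12 : (fun r : R => snrm b (z (r + h) - z (t + h)) + snrm b (z r - z t)) @ t --> (0 : R).
    by rewrite -[X in _ --> X]addr0; exact: cvgD c1 c2.
  refine (cvg_dist_le _ c12).
  near=> r; have cr : c < r < d - h by near: r; exact: near_in_itv.
  have [cr1 cr2] := sub _ cr.
  rewrite subr0 ger0_norm ?snrm_ge0//=.
  have -> : z (r + h) - z r - (z (t + h) - z t) = (z (r + h) - z (t + h)) - (z r - z t).
    by rewrite !opprB addrACA [RHS]addrACA; congr (_ + _); rewrite addrC.
  have D1 := siDB S (Dz _ cr2) (Dz _ ct2); have D2 := siDB S (Dz _ cr1) (Dz _ ct1).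
  by have := ler_snrmD S D1 (siDN S D2); rewrite (snrmN S D2).
split.
- by move=> t /sub[c1 c2]; apply: (siDB SH); exact: (woH W).
- by move=> t /sub[c1 c2]; apply: (siDB SL); exact: (woL W).
- by move=> t /sub[c1 c2]; apply: (siDB SL); exact: (wog W).
- move=> t ct; apply: (aux _ _ SH _ _ ct); [exact: (woH W)|exact: (wocH W)].
- move=> t ct; apply: (aux _ _ SL _ _ ct); [exact: (woL W)|exact: (wocL W)].
- move=> t ct; apply: (aux _ _ SL _ _ ct); [exact: (wog W)|exact: (wocg W)].
- move=> v Lv t ct; have [c1 c2] := sub _ ct.
  rewrite (sisubl SL (woL W c2) (woL W c1) Lv).
  have := is_deriveB (@is_derive_addr _ (fun r : R => ip (w r) v) t h _ (wod W Lv c2)) (wod W Lv c1).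
  apply: (@is_derive_near _ (fun r : R => ip (w (r + h)) v - ip (w r) v)).
  have := near_in_itv ct; apply: filterS => r /sub[r1 r2].
  by rewrite (sisubl SL)//; apply: HL; exact: (woH W).
- move=> v Hv t ct; have [c1 c2] := sub _ ct; have Lv := HL Hv.
  rewrite (sisubl SL (wog W c2) (wog W c1) Lv) (sisubl SH (woH W c2) (woH W c1) Hv).
  have := is_deriveB (@is_derive_addr _ (fun r : R => ip (wt r) v) t h _ (wodd W Hv c2)) (wodd W Hv c1).
  move=> h1; apply: (@is_derive_near _ (fun r : R => ip (wt (r + h)) v - ip (wt r) v)).
    have := near_in_itv ct; apply: filterS => r /sub[r1 r2].
    by rewrite (sisubl SL)//; exact: (woL W).
  by apply: (is_derive_eq h1); ring.
Unshelve. all: by end_near. Qed.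

(* The energy of the difference of [w] and its translate by [h] is small at [t0]
   for small [h], and its derivative is at most [8 G B]. *)
Lemma wave_cauchy (c d : R) (w wt g : R -> E) (G B : R) :
  wave_on L H ip form c d w wt g -> c < d ->
  (forall t, c < t < d -> nL (g t) <= G) ->
  (forall t, c < t < d -> nL (wt t) <= B) ->
  forall e : R, 0 < e -> exists2 t1, c < t1 < d & forall t r, t1 < t < d -> t1 < r < d ->
    form (w r - w t) (w r - w t) + ip (wt r - wt t) (wt r - wt t) <= e.
Proof.
move=> W cd gG wtB e e0.
have G0 : 0 <= G.
  by apply: le_trans (gG ((c + d) / 2) _); [exact: snrm_ge0|lra].
have B0 : 0 <= B.
  by apply: le_trans (wtB ((c + d) / 2) _); [exact: snrm_ge0|lra].
(* [2 * ip (zg s) (zt s)] is at most [2 * (2 * G) * (2 * B)]; the added ones make [M] positive. *)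
pose M := 8 * (G + 1) * (B + 1).
have M0 : 0 < M by rewrite /M !mulr_gt0//; lra.
(* From [t0] on, the energy of a difference changes by at most [M * (d - t0) <= e / 2]. The time
   [t0] is fixed before the shift, whose size is then limited by continuity at [t0]. *)
pose t0 := Num.max ((c + d) / 2) (d - e / 2 / M).
have eM : 0 < e / 2 / M by rewrite !divr_gt0.
have ct0 : c < t0 < d.
  by rewrite /t0 lt_max gt_max; apply/andP; split; [apply/orP; left|apply/andP; split]; lra.
have t0M : M * (d - t0) <= e / 2.
  have h : d - e / 2 / M <= t0 by rewrite /t0 le_max lexx orbT.
  have : d - t0 <= e / 2 / M by lra.
  by rewrite ler_pdivlMr// mulrC.
have [Ht0 Lt0] := (woH W ct0, woL W ct0).
have [h0 /= h00 Hh0] : \forall r \near t0, c < r < d /\ form (w r - w t0) (w r - w t0) + ip (wt r - wt t0) (wt r - wt t0) <= e / 2.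
  have e4 : 0 < Num.min 1 (e / 4) by rewrite lt_min ltr01 divr_gt0.
  have n1 := cvgr_le _ (wocH W ct0) (Num.min 1 (e / 4)) e4.
  have n2 := cvgr_le _ (wocL W ct0) (Num.min 1 (e / 4)) e4.
  have n3 := near_in_itv ct0.
  near=> r; have cr : c < r < d by near: r; exact: n3.
  have : nH (w r - w t0) <= Num.min 1 (e / 4) by near: r; exact: n1.
  have : nL (wt r - wt t0) <= Num.min 1 (e / 4) by near: r; exact: n2.
  rewrite -(snrm_sqr SH (siDB SH (woH W cr) Ht0)) -(snrm_sqr SL (siDB SL (woL W cr) Lt0)).
  have := snrm_ge0 ip (wt r - wt t0); have := snrm_ge0 form (w r - w t0).
  move: (nL _) (nH _) => x y y0 x0; rewrite !le_min => /andP[x1 x2] /andP[y1 y2]; split => //.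
  by rewrite !expr2; nra.
(* Two times beyond [t1] differ by less than [h0], so their difference is an admissible shift at
   [t0]. *)
pose t1 := Num.max t0 (d - h0).
have ct1 : t0 <= t1 by rewrite le_max lexx.
have ct1' : d - h0 <= t1 by rewrite le_max lexx orbT.
have t1d : t1 < d by rewrite /t1 gt_max; apply/andP; split; lra.
exists t1; first by lra.
have main t r : t < r -> t1 < t < d -> t1 < r < d ->
    form (w r - w t) (w r - w t) + ip (wt r - wt t) (wt r - wt t) <= e.
  move=> tr t1t t1r.
  have h0' : 0 < r - t by lra.
  have Z := wave_on_shift_sub W h0'.
  set z := (fun s => w (s + (r - t)) - w s) in Z.
  set zt := (fun s => wt (s + (r - t)) - wt s) in Z.
  set zg := (fun s => g (s + (r - t)) - g s) in Z.
  have iE s (cs : c < s < d - (r - t)) := wave_energy_derive WT Z cs.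
  have -> : form (w r - w t) (w r - w t) + ip (wt r - wt t) (wt r - wt t) = wave_energy ip form z zt t.
    by rewrite /wave_energy /z /zt [t + _]addrC subrK.
  have bd s : c < s < d - (r - t) -> `|2 * ip (zg s) (zt s)| <= M.
    move=> cs; rewrite normrM ger0_norm//.
    have s1 : c < s < d by lra.
    have s2 : c < s + (r - t) < d by lra.
    have Lg1 := wog W s1; have Lg2 := wog W s2; have Lw1 := woL W s1; have Lw2 := woL W s2.
    have : `|ip (zg s) (zt s)| <= (2 * G) * (2 * B).
      apply: le_trans (si_cauchy_schwarz SL (siDB SL Lg2 Lg1) (siDB SL Lw2 Lw1)) _.
      apply: ler_pM; rewrite ?snrm_ge0//.
        apply: le_trans (ler_snrmD SL Lg2 (siDN SL Lg1)) _; rewrite (snrmN SL Lg1).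
        by have := gG _ s1; have := gG _ s2; lra.
      apply: le_trans (ler_snrmD SL Lw2 (siDN SL Lw1)) _; rewrite (snrmN SL Lw1).
      by have := wtB _ s1; have := wtB _ s2; lra.
    move=> h1; apply: (@le_trans _ _ (8 * (G * B))); first lra.
    by rewrite /M -mulrA ler_wpM2l//; nra.
  have c1 : c < t0 < d - (r - t) by lra.
  have c2 : c < t < d - (r - t) by lra.
  have := mvt_le iE bd c1 c2.
  have t0r : `|t0 - (t0 + (r - t))| < h0.
    by rewrite opprD addrA subrr add0r normrN gtr0_norm//; lra.
  have [_] := Hh0 (t0 + (r - t)) t0r.
  rewrite -/(wave_energy ip form z zt t0).
  have : M * (t - t0) <= e / 2 by apply: le_trans t0M; rewrite ler_wpM2l ?(ltW M0)//; lra.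
  rewrite (@ger0_norm _ (t - t0)); last by lra.
  by rewrite ler_norml => ? ? /andP[]; lra.
move=> t r t1t t1r; have [tr|rt|->] := ltgtP t r; first exact: main.
  have := main _ _ rt t1r t1t.
  rewrite -(opprB (w r)) -(opprB (wt r)).
  have ct : c < t < d by lra.
  have cr : c < r < d by lra.
  have D1 := siDB SH (woH W cr) (woH W ct); have D2 := siDB SL (woL W cr) (woL W ct).
  by rewrite (sioppl SH D1 (siDN SH D1)) (sioppl SL D2 (siDN SL D2)) (sisym SH D1 (siDN SH D1)) (sisym SL D2 (siDN SL D2)) (sioppl SH D1 D1) (sioppl SL D2 D2) !opprK.
by rewrite !subrr (si0l SH (siD0 SH)) (si0l SL (siD0 SL)) addr0 ltW.
Unshelve. all: by end_near. Qed.

(** The derivatives are given only away from the joining time [T]. At [T] they follow from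
    [is_derive_extend], as the functions and their proposed derivatives are continuous there. *)
Lemma wave_on_glue (c d T : R) (w wt g : R -> E) : c < T < d ->
  (forall t, c < t < d -> H (w t)) ->
  (forall t, c < t < d -> L (wt t)) ->
  (forall t, c < t < d -> L (g t)) ->
  (forall t, c < t < d -> nH (w r - w t) @[r --> t] --> (0 : R)) ->
  (forall t, c < t < d -> nL (wt r - wt t) @[r --> t] --> (0 : R)) ->
  (forall t, c < t < d -> nL (g r - g t) @[r --> t] --> (0 : R)) ->
  (forall v, L v -> forall t, c < t < d -> t != T ->
    is_derive t 1 (fun r : R => ip (w r) v) (ip (wt t) v)) ->
  (forall v, H v -> forall t, c < t < d -> t != T ->
    is_derive t 1 (fun r : R => ip (wt r) v) (- form (w t) v + ip (g t) v)) ->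
  wave_on L H ip form c d w wt g.
Proof.
move=> cT Hw Lwt Lg cw cwt cg dw dwt.
have nH1 t : c < t < d -> \forall r \near t, H (w r).
  by move=> /near_in_itv; apply: filterS => r; exact: Hw.
have nL1 t : c < t < d -> \forall r \near t, L (wt r).
  by move=> /near_in_itv; apply: filterS => r; exact: Lwt.
have nL2 t : c < t < d -> \forall r \near t, L (w r).
  by move=> /near_in_itv; apply: filterS => r /Hw; exact: HL.
have nL3 t : c < t < d -> \forall r \near t, L (g r).
  by move=> /near_in_itv; apply: filterS => r; exact: Lg.
have c1 v t : L v -> c < t < d -> {for t, continuous (fun r : R => ip (w r) v)}.
  move=> Lv ct; apply: (si_cvgl SL (HL (Hw _ ct)) Lv (nL2 _ ct)).
  exact: (nH_cvg_nL WT (Hw _ ct) (nH1 _ ct) (cw _ ct)).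
have c2 v t : L v -> c < t < d -> {for t, continuous (fun r : R => ip (wt r) v)}.
  by move=> Lv ct; exact: (si_cvgl SL (Lwt _ ct) Lv (nL1 _ ct) (cwt _ ct)).
have c3 v t : L v -> c < t < d -> {for t, continuous (fun r : R => ip (g r) v)}.
  by move=> Lv ct; exact: (si_cvgl SL (Lg _ ct) Lv (nL3 _ ct) (cg _ ct)).
have c4 v t : H v -> c < t < d -> {for t, continuous (fun r : R => form (w r) v)}.
  by move=> Hv ct; exact: (si_cvgl SH (Hw _ ct) Hv (nH1 _ ct) (cw _ ct)).
split => //.
- move=> v Lv t ct; have [->|tT] := eqVneq t T; last exact: dw.
  apply: (@is_derive_extend _ _ (fun r : R => ip (wt r) v) _ _ _ cT); [exact: c1|exact: dw|exact: c2].
- move=> v Hv t ct; have [->|tT] := eqVneq t T; last exact: dwt.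
  apply: (@is_derive_extend _ _ (fun r : R => - form (w r) v + ip (g r) v) _ _ _ cT); [|exact: dwt|].
    by apply: c2 => //; exact: HL.
  by apply: cvgD; [apply: cvgN; exact: c4|apply: c3 => //; exact: HL].
Qed.

End WaveExtend.

Lemma snrm_derive_weak (R : realType) (E : lmodType R) (L : set E) (ip : E -> E -> R)
    (SL : semi_inner L ip) (w : R -> E) (t : R) (wt v : E) :
  (\forall r \near t, L (w r)) -> L wt -> L v ->
  snrm ip (h^-1 *: (w (t + h) - w t) - wt) @[h --> 0^'] --> (0 : R) ->
  is_derive t 1 (fun r : R => ip (w r) v) (ip wt v).
Proof.
move=> nw Lwt Lv /cvgrPdist_le cw; apply/is_deriveP => e e0.
have Lt := nbhs_singleton nw.
have e1 : 0 < e / (snrm ip v + 1) by rewrite divr_gt0// ltr_wpDl// snrm_ge0.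
have [d /= d0 Hd] := cw _ e1; have [d' /= d'0 Hd'] := nw.
exists (Num.min d d'); first by rewrite /= lt_min d0.
move=> r /=; rewrite lt_min => /andP[rd rd'].
have [->|rt] := eqVneq r t; first by rewrite !subrr mulr0 subrr normr0 mulr0.
have rt0 : r - t != 0 by rewrite subr_eq0.
have Lr : L (w r) by exact: Hd'.
have := Hd (r - t); rewrite /= sub0r normrN distrC => /(_ rd rt0).
rewrite sub0r normrN ger0_norm ?snrm_ge0// [t + _]addrC subrK => Hle.
set x := (r - t)^-1 *: (w r - w t) - wt in Hle.
have Lx : L x by apply: (siDB SL) => //; apply: (siDZ SL); exact: (siDB SL).
have -> : ip (w r) v - ip (w t) v - ip wt v * (r - t) = (r - t) * ip x v.
  rewrite /x (sisubl SL _ Lwt Lv); last by apply: (siDZ SL); exact: (siDB SL).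
  by rewrite (siscalel SL _ (siDB SL Lr Lt) Lv) (sisubl SL Lr Lt Lv); field.
rewrite normrM [`|r - t|]distrC mulrC ler_wpM2r//.
apply: le_trans (si_cauchy_schwarz SL Lx Lv) _.
apply: (@le_trans _ _ (e / (snrm ip v + 1) * (snrm ip v + 1))); last first.
  by rewrite divfK// gt_eqF// ltr_wpDl// snrm_ge0.
by apply: ler_pM; rewrite ?snrm_ge0 ?lerDl.
Qed.

(** The weak derivative is a derivative in norm because [wt] is continuous in norm: apply [weak_mvt]
    with [z = wt t]. A weak solution has to be differentiable in this sense. *)
Lemma wave_on_derive (R : realType) (E : lmodType R) (L H : set E)
    (ip form : E -> E -> R) (WT : wave_triple L H ip form)
    (c d : R) (w wt g : R -> E) (t : R) :
  wave_on L H ip form c d w wt g -> c < t < d ->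
  snrm ip (h^-1 *: (w (t + h) - w t) - wt t) @[h --> 0^'] --> (0 : R).
Proof.
move=> W ct; have SL := wtL WT.
have HL := wtHL WT.
apply/cvgrPdist_le => e e0.
have [d0 /= d00 Hd0] : \forall r \near t, c < r < d /\ snrm ip (wt r - wt t) <= e.
  have n1 := cvgr_le _ (wocL W ct) _ e0; have n2 := near_in_itv ct.
  by near=> r; split; near: r; [exact: n2|exact: n1].
have Hb r : t - d0 < r < t + d0 -> c < r < d /\ snrm ip (wt r - wt t) <= e.
  by move=> tr; apply: Hd0 => /=; rewrite ltr_norml; apply/andP; split; lra.
exists d0 => // h /=; rewrite sub0r normrN => hd h0.
rewrite sub0r normrN ger0_norm ?snrm_ge0//.
have th : t - d0 < t + h < t + d0 by move: hd; rewrite ltr_norml => /andP[]; lra.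
have tt : t - d0 < t < t + d0 by lra.
have [cth _] := Hb _ th.
have m1 s : t - d0 < s < t + d0 -> L (w s) by move=> /Hb[cs _]; apply: HL; exact: (woH W).
have m2 s : t - d0 < s < t + d0 -> L (wt s) by move=> /Hb[cs _]; exact: (woL W).
have m3 v : L v -> forall s, t - d0 < s < t + d0 ->
    is_derive s 1 (fun r : R => ip (w r) v) (ip (wt s) v).
  by move=> Lv s /Hb[cs _]; exact: (wod W).
have m4 s : t - d0 < s < t + d0 -> snrm ip (wt s - wt t) <= e by move=> /Hb[].
have := weak_mvt WT (woL W ct) m1 m2 m3 m4 tt th.
have -> : t + h - t = h by ring.
have Lh := m1 _ th; have Lt := m1 _ tt; have Lwt := woL W ct.
have -> : h^-1 *: (w (t + h) - w t) - wt t = h^-1 *: (w (t + h) - w t - h *: wt t).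
  by rewrite [RHS]scalerBr scalerA mulVf// scale1r.
rewrite (snrmZ SL); last by apply: (siDB SL); [exact: (siDB SL)|exact: (siDZ SL)].
by rewrite normfV ler_pdivrMl ?normr_gt0 // mulrC.
Unshelve. all: by end_near. Qed.

(** * Lebesgue measure and L^2 *)

(** [max 0 (p - q)] is the side of a box from [q] to [p]; the hyperplane at [b] cuts it into two
    sides of no larger total length. *)
Lemma max_sub_split (R : realDomainType) (p q b : R) :
  Num.max 0 (Num.min p b - q) + Num.max 0 (p - Num.max q b) <= Num.max 0 (p - q).
Proof.
case: (leP p b) => pb; case: (leP q b) => qb; case: (leP 0 (p - q)) => pq.
all: do ?case: (leP 0 (b - q)) => bq; do ?case: (leP 0 (p - b)) => bp; lra.
Qed.

Section LebOpen.
Context (R : realType) (N : nat).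
Local Notation RN := (caratheodory_type (leb_outer_measure R N)).
Implicit Types (c : 'rV[R]_N * 'rV[R]_N) (C : set ('rV[R]_N * 'rV[R]_N)).

Lemma box_vol_ge0 c : 0 <= box_vol c.
Proof. by apply: prodr_ge0 => i _; rewrite le_max lexx. Qed.

(** [f] may send different boxes to the same one, so the sum over the image is pulled back along a
    section [g] of [f]. *)
Lemma esum_image_le (f : 'rV[R]_N * 'rV[R]_N -> 'rV[R]_N * 'rV[R]_N) C :
  (\esum_(c in f @` C) (box_vol c)%:E <= \esum_(c in C) (box_vol (f c))%:E)%E.
Proof.
have /choice[g Hg] d : exists c, (f @` C) d -> C c /\ f c = d.
  have [[c Cc <-]|nd] := pselect ((f @` C) d); first by exists c.
  by exists d => /nd.
have gi : set_inj (f @` C) g.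
  move=> x y /set_mem/Hg[_ fx] /set_mem/Hg[_ fy] xy.
  by rewrite -fx -fy xy.
have -> : (\esum_(c in f @` C) (box_vol c)%:E = \esum_(c in f @` C) (box_vol (f (g c)))%:E)%E.
  by apply: eq_esum => c /Hg[_ ->].
rewrite -(@esum_image R _ _ _ _ (fun c => (box_vol (f c))%:E) gi).
rewrite esum_mkcond [leRHS]esum_mkcond; apply: le_esum => c _.
case: ifPn => [/set_mem[d /Hg[Cd _] <-]|_]; first by rewrite mem_set.
by case: ifPn => // _; rewrite lee_fin box_vol_ge0.
Qed.

Lemma leb_outer_le (A : set 'rV[R]_N) C : countable C ->
  A `<=` \bigcup_(c in C) box c ->
  (leb_outer A <= \esum_(c in C) (box_vol c)%:E)%E.
Proof. by move=> cC AC; apply: ereal_inf_lbound; exists C. Qed.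

(** Caratheodory's criterion: each box [c] of a cover is cut along the hyperplane into [f1 c] and
    [f2 c]. Only the side [i] changes, so the volumes add up to at most that of [c]. *)
Lemma halfspace_measurable (i : 'I_N) (b : R) :
  measurable ([set x : 'rV[R]_N | x ord0 i <= b] : set RN).
Proof.
set A := [set x : 'rV[R]_N | x ord0 i <= b].
apply: le_caratheodory_measurable => X.
apply: le_ereal_inf_tmp => _ [C [cC XC] <-].
pose f1 c := (c.1, \row_j if j == i then Num.min (c.2 ord0 j) b else c.2 ord0 j) : 'rV[R]_N * 'rV[R]_N.
pose f2 c := (\row_j (if j == i then Num.max (c.1 ord0 j) b else c.1 ord0 j), c.2) : 'rV[R]_N * 'rV[R]_N.
have h1 : (leb_outer (X `&` A) <= \esum_(c in C) (box_vol (f1 c))%:E)%E.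
  apply: le_trans (leb_outer_le (C := f1 @` C) _ _) (esum_image_le _ _).
    exact: sub_countable (card_image_le _ _) cC.
  move=> x [/XC[c Cc cx] /= xb]; exists (f1 c); first by exists c.
  move=> j /=; rewrite mxE; case: eqP => [->|_]; last exact: cx.
  by rewrite le_min xb andbT; exact: cx.
have h2 : (leb_outer (X `&` ~` A) <= \esum_(c in C) (box_vol (f2 c))%:E)%E.
  apply: le_trans (leb_outer_le (C := f2 @` C) _ _) (esum_image_le _ _).
    exact: sub_countable (card_image_le _ _) cC.
  move=> x [/XC[c Cc cx] /= /negP]; rewrite -ltNge => xb; exists (f2 c); first by exists c.
  move=> j /=; rewrite mxE; case: eqP => [->|_]; last exact: cx.
  by rewrite gt_max xb andbT; exact: cx.
apply: le_trans (leeD h1 h2) _.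
rewrite -esumD; [|by move=> *; rewrite lee_fin box_vol_ge0..].
apply: le_esum => c _; rewrite -EFinD lee_fin /box_vol.
rewrite (bigD1 i)//= [X in _ + X <= _](bigD1 i)//= [leRHS](bigD1 i)//= !mxE eqxx.
have e1 : \prod_(j < N | j != i) Num.max 0 ((f1 c).2 ord0 j - c.1 ord0 j) = \prod_(j < N | j != i) Num.max 0 (c.2 ord0 j - c.1 ord0 j).
  by apply: eq_bigr => j ji; rewrite mxE (negbTE ji).
have e2 : \prod_(j < N | j != i) Num.max 0 (c.2 ord0 j - (f2 c).1 ord0 j) = \prod_(j < N | j != i) Num.max 0 (c.2 ord0 j - c.1 ord0 j).
  by apply: eq_bigr => j ji; rewrite mxE (negbTE ji).
rewrite e1 e2 -mulrDl; apply: ler_wpM2r.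
  by apply: prodr_ge0 => j _; rewrite le_max lexx.
exact: max_sub_split.
Qed.

Lemma box_measurable c : measurable (box c : set RN).
Proof.
have -> : box c = \bigcap_(i in [set: 'I_N])
    ([set x : 'rV[R]_N | x ord0 i <= c.2 ord0 i] `\` [set x : 'rV[R]_N | x ord0 i <= c.1 ord0 i]).
  apply/seteqP; split=> x /= H i.
    by move=> _; move: (H i) => /andP[c1 c2]; split => //=; apply/negP; rewrite -ltNge.
  by have [c1 /negP] := H i I; rewrite -ltNge => -> /=.
apply: fin_bigcap_measurable; first exact: finite_finset.
by move=> i _; apply: measurableD; exact: halfspace_measurable.
Qed.

(** The norm is the maximum norm, so each point of [U] lies in a box with rational corners inside
    [U], and there are countably many such boxes. *)
Lemma open_leb_measurable (U : set 'rV[R]_N) : open U -> measurable (U : set RN).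
Proof.
move=> oU.
pose emb (q : 'rV[rat]_N * 'rV[rat]_N) : 'rV[R]_N * 'rV[R]_N :=
  (map_mx ratr q.1, map_mx ratr q.2).
pose B q : set RN := if `[< box (emb q) `<=` U >] then box (emb q) else set0.
have -> : U = \bigcup_q B q.
  apply/seteqP; split=> [x Ux|x [q _]]; last first.
    by rewrite /B; case: asboolP => // ? ?; auto.
  move: oU; rewrite openE => /(_ _ Ux) /nbhs_ballP[e /= e0 eU].
  have /choice[p Hp] i : exists r : rat, x ord0 i - e < ratr r < x ord0 i.
    have : x ord0 i - e < x ord0 i by rewrite ltrBlDr ltrDl.
    by move=> /rat_in_itvoo[r]; rewrite in_itv/= => ?; exists r.
  have /choice[q Hq] i : exists r : rat, x ord0 i < ratr r < x ord0 i + e.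
    have : x ord0 i < x ord0 i + e by rewrite ltrDl.
    by move=> /rat_in_itvoo[r]; rewrite in_itv/= => ?; exists r.
  have qU : box (emb (\row_i p i, \row_i q i)) `<=` U.
    move=> y Hy; apply: eU; split=> // k i; rewrite [k]ord1 /ball/=.
    move: (Hy i) (Hp i) (Hq i); rewrite /= !mxE ltr_norml => /andP[a1 a2] /andP[a3 a4] /andP[a5 a6].
    by apply/andP; split; lra.
  exists (\row_i p i, \row_i q i) => //; rewrite /B asboolT// => i /=.
  rewrite !mxE; have /andP[_ ->] := Hp i.
  by have /andP[/ltW -> _] := Hq i.
apply: countable_bigcupT_measurable; first exact: countableP.
by move=> q; rewrite /B; case: ifP => _; [exact: box_measurable|exact: measurable0].
Qed.

Lemma continuous_leb_measurable (f : 'rV[R]_N -> R) : continuous f ->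
  measurable_fun [set: RN] f.
Proof.
move=> cf; apply: (measurability _ (RGenOInfty.measurableE R)) => //.
move=> /= _ [_ [x ->] <-]; rewrite setTI; apply: open_leb_measurable.
by move/continuousP : cf; apply; exact: interval_open.
Qed.

Lemma bounded_leb_fin (A : set 'rV[R]_N) : bounded_set A ->
  (leb_outer A < +oo)%E.
Proof.
move=> [M [_ HM]].
pose b : R := M + 1.
(* Boxes are open at the lower corner, hence [- b - 1] instead of [- b]. *)
pose c : 'rV[R]_N * 'rV[R]_N := (\row_i (- b - 1), \row_i b).
apply: (@le_lt_trans _ _ (box_vol c)%:E); last exact: ltry.
apply: le_trans (leb_outer_le (C := [set c]) _ _) _; first exact: countable1.
  move=> x Ax; exists c => // i; rewrite !mxE.
  have : `|x| <= b by apply: (HM b) => //; rewrite /b ltrDl.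
  have : `|x ord0 i| <= `|x|.
    by rewrite [leRHS]/Num.Def.normr /= mx_normrE; apply/bigmax_geP; right => /=; exists (ord0, i).
  by rewrite ler_norml => /andP[h1 h2] h3; apply/andP; split; lra.
by rewrite esum_set1// lee_fin box_vol_ge0.
Qed.

End LebOpen.

Section LebesgueOn.
Context d (T : measurableType d) (R : realType) (mu : {measure set T -> \bar R}).
Variables (D : set T) (mD : measurable D).
Implicit Types (f g : T -> R) (p : R).

Lemma Lfun_restrictP p f : 0 < p ->
  (f \_ D) \in Lfun mu p%:E <->
  measurable_fun D f /\ mu.-integrable D (EFin \o (fun x => `|f x| `^ p)).
Proof.
move=> p0.
have restr x : `|(f \_ D) x| `^ p = ((fun x => `|f x| `^ p) \_ D) x.
  by rewrite !patchE; case: ifP => // _; rewrite normr0 powR0// gt_eqF.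
have mpow : measurable_fun D f -> measurable_fun D (fun x => `|f x| `^ p).
  move=> mf; apply: (measurableT_comp (measurable_powR _)).
  exact: measurableT_comp.
have eqI : (\int[mu]_x (`|(EFin \o (f \_ D)) x| `^ p) = \int[mu]_(x in D) `|(`|f x| `^ p)%:E|)%E.
  rewrite [RHS]integral_mkcond; apply: eq_integral => x _ /=.
  rewrite restr !patchE; case: ifP => _ //; by rewrite [in RHS]ger0_norm ?powR_ge0.
have Nlt : (Lnorm mu p%:E (EFin \o (f \_ D)) < +oo)%E <-> (\int[mu]_(x in D) `|(`|f x| `^ p)%:E| < +oo)%E.
  have := @powR_Lnorm _ _ _ mu (EFin \o (f \_ D)) p; rewrite eqI gt_eqF// => /(_ isT) <-.
  split; first exact: poweR_lty.
  by apply: lty_poweRy; rewrite gt_eqF.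
split.
  rewrite inE => /andP[mf]; rewrite inE/= => /Nlt fin.
  have mf' : measurable_fun D f.
    by move: mf; rewrite inE/= => mf; apply/(measurable_restrictT _ mD).
  split=> //; apply/integrableP; split => //.
  by apply/measurable_EFinP; exact: mpow.
move=> [mf /integrableP[_ fin]]; apply/andP; split; rewrite inE/=.
  by apply/(measurable_restrictT _ mD).
exact/Nlt.
Qed.

Lemma Lnorm_restrict_powR p f : 0 < p -> (f \_ D) \in Lfun mu p%:E ->
  fine (Lnorm mu p%:E (EFin \o (f \_ D))) `^ p = \int[mu]_(x in D) (`|f x| `^ p).
Proof.
move=> p0 Lf.
have := Lf; rewrite inE => /andP[_]; rewrite inE/= => fin.
have finN : Lnorm mu p%:E (EFin \o (f \_ D)) \is a fin_num.
  by rewrite ge0_fin_numE ?Lnorm_ge0.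
apply: EFin_inj; rewrite -poweR_EFin fineK// powR_Lnorm ?gt_eqF//.
have [_ intf] := (Lfun_restrictP f p0).1 Lf.
rewrite /Rintegral fineK; last exact: integrable_fin_num.
rewrite [RHS]integral_mkcond; apply: eq_integral => x _ /=.
by rewrite !patchE; case: ifP => // _; rewrite normr0 powR0// gt_eqF.
Qed.

Lemma Lnorm_restrict_ge0 p f : 0 <= fine (Lnorm mu p%:E (EFin \o (f \_ D))).
Proof. by rewrite fine_ge0// Lnorm_ge0. Qed.

Lemma L2_restrictP f : (f \_ D) \in Lfun mu 2%:E <->
  measurable_fun D f /\ mu.-integrable D (EFin \o (fun x => f x ^+ 2)).
Proof.
have -> : (fun x => f x ^+ 2) = (fun x => `|f x| `^ 2).
  by apply/funext => x; rewrite powR_mulrn// real_normK// num_real.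
exact: Lfun_restrictP.
Qed.

Lemma L2_mul_integrable f g : (f \_ D) \in Lfun mu 2%:E -> (g \_ D) \in Lfun mu 2%:E ->
  mu.-integrable D (EFin \o (fun x => f x * g x)).
Proof.
move=> /L2_restrictP[mf intf] /L2_restrictP[mg intg].
apply: (le_integrable mD _ _ (integrableD mD intf intg)).
  by apply/measurable_EFinP; exact: measurable_funM.
move=> x _ /=; rewrite lee_fin.
have h1 : 0 <= f x ^+ 2 + g x ^+ 2 by rewrite addr_ge0// sqr_ge0.
rewrite (ger0_norm h1) ler_norml; apply/andP; split.
  by have := sqr_ge0 (f x + g x); rewrite sqrrD; nra.
by have := sqr_ge0 (f x - g x); rewrite sqrrB; nra.
Qed.

Lemma semi_inner_L2 : semi_inner (E := T -> R) [set f | (f \_ D) \in Lfun mu 2%:E]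
  (fun f g => \int[mu]_(x in D) (f x * g x)).
Proof.
have D0 : ((0 : T -> R) \_ D) \in Lfun mu 2%:E.
  apply/L2_restrictP; split; first exact: measurable_cst.
  have -> : EFin \o (fun x => (0 : T -> R) x ^+ 2) = cst 0%E.
    by apply/funext => x /=; rewrite expr0n.
  exact: integrable0.
split => //=.
- move=> k u v Lu Lv; apply/L2_restrictP.
  have [mu' iu] := (L2_restrictP u).1 Lu; have [mv iv] := (L2_restrictP v).1 Lv.
  split; first by apply: measurable_funD => //; exact: measurable_funM.
  have := integrableD mD (integrableD mD (integrableZl mD (k ^+ 2) iu)
     (integrableZl mD (2 * k) (L2_mul_integrable Lu Lv))) iv.
  apply: eq_integrable => // x _ /=; rewrite -!EFinM -!EFinD; congr EFin.
  have -> : (k *: u + v) x = k * u x + v x by []. ring.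
- move=> k u v w Lu Lv Lw.
  rewrite -RintegralZl//; last exact: L2_mul_integrable.
  rewrite -RintegralD//; last exact: L2_mul_integrable.
    by apply: eq_Rintegral => x _ /=; rewrite mulrDl mulrA.
  by have := integrableZl mD k (L2_mul_integrable Lu Lw); apply: eq_integrable.
- by move=> u v Lu Lv; apply: eq_Rintegral => x _; rewrite mulrC.
- by move=> u Lu; apply: Rintegral_ge0 => x _; rewrite -expr2 sqr_ge0.
Qed.

Lemma Lnorm2_restrictE f : (f \_ D) \in Lfun mu 2%:E ->
  fine (Lnorm mu 2%:E (EFin \o (f \_ D))) = snrm (E := T -> R) (fun f g => \int[mu]_(x in D) (f x * g x)) f.
Proof.
move=> Lf; rewrite /snrm.
have -> : \int[mu]_(x in D) (f x * f x) = fine (Lnorm mu 2%:E (EFin \o (f \_ D))) ^+ 2.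
  rewrite -powR_mulrn ?Lnorm_restrict_ge0// Lnorm_restrict_powR//.
  by apply: eq_Rintegral => x _; rewrite powR_mulrn// real_normK ?num_real// expr2.
by rewrite sqrtr_sqr ger0_norm// Lnorm_restrict_ge0.
Qed.

End LebesgueOn.

(** The increments are at most [sqrt C / 2 ^ j], so the telescoping series converges. The weight
    [4 ^ j] lets the hypothesis speak of squares, which is what an L^2 estimate controls. *)
Lemma sqr_le_geometric_series_cvg (R : realType) (u : nat -> R) (C : R) :
  (forall j, 4 ^+ j * (u j.+1 - u j) ^+ 2 <= C) -> cvgn u.
Proof.
move=> H.
have C0 : 0 <= C by apply: le_trans (H 0%N); rewrite mulr_ge0// sqr_ge0.
have bd j : `|u j.+1 - u j| <= Num.sqrt C * (2^-1) ^+ j.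
  rewrite -(@ler_pXn2r _ 2)// ?nnegrE ?mulr_ge0 ?sqrtr_ge0 ?exprn_ge0//.
  rewrite real_normK ?num_real// exprMn sqr_sqrtr// -exprM mulnC exprM.
  have -> : (2^-1 ^+ 2 : R) = 4^-1 by rewrite exprVn; congr (_^-1); ring.
  rewrite exprVn ler_pdivlMr ?exprn_gt0//; rewrite mulrC; exact: H.
have cv : cvgn (series (telescope u)).
  apply: normed_cvg.
  apply: (@series_le_cvg _ _ (geometric (Num.sqrt C) 2^-1)) => //.
  - by move=> n /=; exact: normr_ge0.
  - by move=> n /=; rewrite mulr_ge0 ?sqrtr_ge0 ?exprn_ge0.
  - by apply: is_cvg_geometric_series; rewrite ger0_norm// invf_lt1// ltr1n.
have -> : u = (fun n => u 0%N + series (telescope u) n).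
  by apply/funext => n; rewrite -eq_sum_telescope.
by apply: is_cvgD => //; exact: is_cvg_cst.
Qed.

Lemma limn_einf_ub (R : realType) (h : nat -> \bar R) (J : nat) (c : \bar R) :
  (forall j, (J <= j)%N -> (h j <= c)%E) -> (limn_einf h <= c)%E.
Proof.
move=> H; rewrite limn_einf_lim; apply: lime_le; first exact: is_cvg_einfs.
apply: nearW => n.
apply: (@le_trans _ _ (h (maxn n J))); last by apply: H; rewrite leq_maxr.
by apply: ereal_inf_lbound; exists (maxn n J) => //=; rewrite leq_maxl.
Qed.

(** * Completeness of L^2 *)

Section L2Complete.
Context d (T : measurableType d) (R : realType) (mu : {measure set T -> \bar R}).
Variables (D : set T) (mD : measurable D).
Local Notation L := [set f : T -> R | (f \_ D) \in Lfun mu 2%:E].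
Local Notation ip := (fun f g : T -> R => \int[mu]_(x in D) (f x * g x)).
Let SL := semi_inner_L2 mu mD.

Lemma L2_ip_integral (f : T -> R) : L f ->
  (\int[mu]_(x in D) ((f x) ^+ 2)%:E = (ip f f)%:E)%E.
Proof.
move=> Lf; have [mf intf] := (L2_restrictP mu mD f).1 Lf.
rewrite /Rintegral fineK; last first.
  by apply: integrable_fin_num => //; exact: L2_mul_integrable.
by apply: eq_integral => x _; rewrite expr2.
Qed.

(** The Riesz-Fischer theorem. Along a fast subsequence the weighted squares of the increments have
    an integrable sum, so the subsequence converges almost everywhere; Fatou's lemma carries the
    Cauchy estimates to the limit. *)
Lemma L2_complete (f : nat -> T -> R) : (forall n, L (f n)) ->
  (forall e : R, 0 < e -> exists K, forall i j, (K <= i)%N -> (K <= j)%N ->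
     snrm (E := T -> R) ip (f i \- f j) <= e) ->
  exists2 w : T -> R, L w & snrm (E := T -> R) ip (f n \- w) @[n --> \oo] --> (0 : R).
Proof.
move=> Lf Cf.
have LB i j : L (f i \- f j) := siDB SL (Lf i) (Lf j).
(* Chosen so that [4 ^ j * e j] is [1 / 2 ^ j.+1], and these sum to 1. *)
pose e j : R := (4 ^+ j * 2 ^+ j.+1)^-1.
have e0 j : 0 < e j by rewrite invr_gt0 mulr_gt0 ?exprn_gt0.
have /choice[N HN] j : exists N, forall i k, (N <= i)%N -> (N <= k)%N -> ip (f i \- f k) (f i \- f k) <= e j.
  have s0 : 0 < Num.sqrt (e j) by rewrite sqrtr_gt0.
  have [K HK] := Cf _ s0; exists K => i k Ki Kk.
  rewrite -(snrm_sqr SL (LB i k)) -[leRHS]sqr_sqrtr ?(ltW (e0 j))//.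
  by rewrite ler_pXn2r ?nnegrE ?snrm_ge0 ?sqrtr_ge0// HK.
(* Summing the thresholds makes [k] monotone and keeps it above both [N j] and [j]. *)
pose k j := (\sum_(i < j.+1) (N i).+1)%N.
have Nk j : (N j <= k j)%N by rewrite /k big_ord_recr/= (leq_trans (leqnSn _))// leq_addl.
have jk j : (j <= k j)%N.
  by rewrite /k -[leqLHS](card_ord j) -sum1_card big_ord_recr/= (leq_trans _ (leq_addr _ _))// leq_sum.
have kS j : (k j <= k j.+1)%N by rewrite /k [leqRHS]big_ord_recr/= leq_addr.
have kmono i j : (i <= j)%N -> (k i <= k j)%N.
  by move=> ij; rewrite -(subnKC ij); elim: (j - i)%N => [|m IH]; rewrite ?addn0// addnS (leq_trans IH).
pose g j := f (k j).
pose s j x : \bar R := (4 ^+ j * (g j.+1 x - g j x) ^+ 2)%:E.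
have Ld j : L (g j.+1 \- g j) by exact: LB.
have mdj j : measurable_fun D (g j.+1 \- g j) := ((L2_restrictP mu mD _).1 (Ld j)).1.
have ms j : measurable_fun D (s j).
  apply/measurable_EFinP; apply: measurable_funM => //.
  by apply: (measurable_funX 2); exact: mdj.
have s0 j x : D x -> (0 <= s j x)%E.
  by move=> _; rewrite lee_fin; apply: mulr_ge0; [rewrite exprn_ge0|exact: sqr_ge0].
have Is j : (\int[mu]_(x in D) s j x <= (1 / (2 ^ (j + 1))%:R)%:E)%E.
  rewrite /s; under eq_integral do rewrite EFinM.
  rewrite ge0_integralZl//.
  - have -> : (\int[mu]_(x in D) ((g j.+1 x - g j x) ^+ 2)%:E = (ip (g j.+1 \- g j) (g j.+1 \- g j))%:E)%E.
      exact: (L2_ip_integral (Ld j)).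
    rewrite -EFinM lee_fin addn1 div1r natrX.
    have -> : (2 ^+ j.+1)^-1 = 4 ^+ j * e j :> R.
      by rewrite /e invfM mulrA divff ?mul1r// gt_eqF// exprn_gt0.
    have h := HN j (k j.+1) (k j) (leq_trans (Nk j) (kS j)) (Nk j).
    by apply: ler_wpM2l; [exact: exprn_ge0|exact: h].
  - by apply/measurable_EFinP; apply: (measurable_funX 2); exact: mdj.
  - by move=> x _; rewrite lee_fin sqr_ge0.
pose S x : \bar R := (\sum_(j <oo) s j x)%E.
have IS : (\int[mu]_(x in D) S x <= 1%:E)%E.
  rewrite integral_nneseries//.
  have := @cvg_geometric_eseries_half R 1 0; rewrite expr0 divr1 => /cvg_lim h.
  have <- : (\sum_(j <oo) (1 / (2 ^ (j + 1))%:R)%:E = 1%:E :> \bar R)%E by exact: h.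
  apply: lee_nneseries => j *; [by apply: integral_ge0 => x; exact: s0|exact: Is].
have mS : measurable_fun D S by apply: ge0_emeasurable_sum => // j x Dx _; exact: s0.
have S0 x : D x -> (0 <= S x)%E by move=> Dx; apply: nneseries_ge0 => j _ _; exact: s0.
have intS : mu.-integrable D S.
  apply/integrableP; split => //.
  under eq_integral => x /set_mem Dx do rewrite gee0_abs ?S0//.
  by apply: le_lt_trans IS _; rewrite ltry.
have [B [mB B0 HB]] := integrable_ae mD intS.
pose A := D `\` B.
have mA : measurable A by exact: measurableD.
have cvA x : A x -> cvgn (g ^~ x).
  move=> [Dx nBx].
  have Sx : S x \is a fin_num.
    by apply: contrapT => /negP h; apply: nBx; apply: HB => /= /(_ Dx); exact/negP.
  apply: (@sqr_le_geometric_series_cvg _ _ (fine (S x))) => j.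
  rewrite -lee_fin fineK//.
  have h := @nneseries_lim_ge _ (s ^~ x) xpredT 0 j.+1 (fun i _ _ => s0 i x Dx).
  apply: le_trans h; rewrite big_nat_recr//= leeDr// sume_ge0// => i _.
  exact: s0.
(* The value 0 off [A] makes [w] measurable on all of [D]; the part of [D] outside [A] is
   negligible. *)
pose w x : R := if `[< A x >] then limn (g ^~ x) else 0.
have cvw x : A x -> g ^~ x @ \oo --> w x.
  by move=> Ax; rewrite /w asboolT//; exact: cvA.
have mg j : measurable_fun D (g j) := ((L2_restrictP mu mD _).1 (Lf (k j))).1.
have mf n : measurable_fun D (f n) := ((L2_restrictP mu mD _).1 (Lf n)).1.
have AD : A `<=` D by move=> x [].
have mwA : measurable_fun A w.
  apply: (@measurable_fun_cvg _ _ _ _ g) => // m.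
  exact: measurable_funS (mg m).
have mw : measurable_fun D w.
  have -> : w = w \_ A.
    apply/funext => x; rewrite patchE; case: ifPn => // /negP h.
    by rewrite /w asboolF// => Ax; apply: h; rewrite inE.
  apply: measurable_funTS.
  exact/(measurable_restrictT _ mA).
(* Fatou's lemma along the subsequence: a bound on squared distances to [f m] passes to the limit
   [w]. *)
have key m (c : R) : (exists K, forall j, (K <= j)%N -> ip (f j \- f m) (f j \- f m) <= c) ->
    (\int[mu]_(x in D) ((w x - f m x) ^+ 2)%:E <= c%:E)%E.
  move=> [K HK].
  have mwf : measurable_fun D (fun x => (w x - f m x) ^+ 2).
    by apply: (measurable_funX 2); exact: measurable_funB.
  rewrite (@ge0_negligible_integral _ _ _ mu D B)//; last 2 first.
  - exact/measurable_EFinP.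
  - by move=> x _; rewrite lee_fin sqr_ge0.
  pose h j x := ((g j x - f m x) ^+ 2)%:E : \bar R.
  have mh j : measurable_fun D (h j).
    by apply/measurable_EFinP; apply: (measurable_funX 2); exact: measurable_funB.
  have -> : (\int[mu]_(x in D `\` B) ((w x - f m x) ^+ 2)%:E = \int[mu]_(x in A) limn_einf (h ^~ x))%E.
    apply: eq_integral => x /set_mem Ax.
    have : h ^~ x @ \oo --> ((w x - f m x) ^+ 2)%:E.
      apply: cvg_EFin; first exact: nearW.
      have cb : (fun j => g j x - f m x) @ \oo --> w x - f m x.
        by apply: cvgB; [exact: cvw|exact: cvg_cst].
      exact: (cvgM cb cb).
    by move=> /cvg_limn_einf_sup[].
  apply: le_trans (fatou _ _ _ _) _ => //.
  - by move=> j; exact: measurable_funS (mh j).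
  - by move=> j x _; rewrite lee_fin sqr_ge0.
  apply: (@limn_einf_ub _ _ K) => j Kj.
  apply: (@le_trans _ _ (\int[mu]_(x in D) h j x)%E).
    by apply: ge0_subset_integral => // x _; rewrite lee_fin sqr_ge0.
  rewrite [leLHS](L2_ip_integral (LB (k j) m)) lee_fin; apply: HK.
  apply: leq_trans Kj _; elim: j => // j IH; exact: (leq_trans _ (kS j)).
have Lwf m : (exists c, exists K, forall j, (K <= j)%N -> ip (f j \- f m) (f j \- f m) <= c) -> L (w \- f m).
  move=> [c Hc]; apply/(L2_restrictP mu mD); split; first exact: measurable_funB.
  apply/integrableP; split.
    by apply/measurable_EFinP; apply: (measurable_funX 2); exact: measurable_funB.
  under eq_integral do rewrite /= ger0_norm ?sqr_ge0//.
  by apply: le_lt_trans (key _ _ Hc) _; rewrite ltry.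

have main (e' : R) : 0 < e' -> exists K, forall m, (K <= m)%N -> forall j, (K <= j)%N -> ip (f j \- f m) (f j \- f m) <= e' ^+ 2.
  move=> e'0; have [K HK] := Cf _ e'0; exists K => m Km j Kj.
  by rewrite -(snrm_sqr SL (LB j m)) ler_pXn2r ?nnegrE ?snrm_ge0 ?(ltW e'0)// HK.
have [K0 HK0] := main 1 ltr01.
have LwK : L (w \- f K0).
  by apply: Lwf; exists (1 ^+ 2); exists K0 => j Kj; exact: HK0.
have Lw : L w.
  have -> : w = (w \- f K0) + f K0 by apply/funext => x; rewrite /= fctE subrK.
  exact: (siDD SL).
exists w => //.
apply/cvgrPdist_le => e1 e10; have [K HK] := main _ e10.
exists K => // n /= Kn.
rewrite sub0r normrN ger0_norm ?snrm_ge0//.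
rewrite (snrm_distC SL (Lf n) Lw).
have Lwn : L (w \- f n) by exact: (siDB SL Lw (Lf n)).
rewrite -(@ler_pXn2r _ 2)// ?nnegrE ?snrm_ge0 ?(ltW e10)// (snrm_sqr SL Lwn).
rewrite -lee_fin -(L2_ip_integral Lwn).
by apply: key; exists K => j Kj; exact: HK.
Qed.

End L2Complete.

(** * Completion of a form *)

Section Completion.
Context (R : realType) (E : lmodType R) (L C : set E) (ip hip : E -> E -> R).
Hypotheses (SL : semi_inner L ip) (SC : semi_inner C hip) (CL : C `<=` L).
Local Notation nL := (snrm ip).
Local Notation nC := (snrm hip).

Definition approx_by (u : E) (phi : nat -> E) : Prop :=
  [/\ forall n, C (phi n),
      forall e : R, 0 < e -> exists K, forall i j, (K <= i)%N -> (K <= j)%N ->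
        nC (phi i - phi j) < e &
      nL (phi n - u) @[n --> \oo] --> (0 : R)].

Definition form_completion (u : E) : Prop := L u /\ exists phi, approx_by u phi.

Hypothesis closable : forall phi, approx_by 0 phi -> nC (phi n) @[n --> \oo] --> (0 : R).

Lemma approx_lin k u v phi psi : L u -> L v -> approx_by u phi -> approx_by v psi ->
  approx_by (k *: u + v) (fun n => k *: phi n + psi n).
Proof.
move=> Lu Lv [Cp Hp Lp] [Cq Hq Lq]; split.
- by move=> n; exact: (siDlin SC).
- move=> e e0; have k0 : 0 < `|k| + 1 by rewrite ltr_wpDl.
  have e1 : 0 < e / 2 / (`|k| + 1) by rewrite !divr_gt0.
  have e2 : 0 < e / 2 by rewrite divr_gt0.
  have [K1 H1] := Hp _ e1; have [K2 H2] := Hq _ e2.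
  exists (maxn K1 K2) => i j; rewrite !geq_max => /andP[i1 i2] /andP[j1 j2].
  have -> : k *: phi i + psi i - (k *: phi j + psi j) = k *: (phi i - phi j) + (psi i - psi j).
    by rewrite scalerBr opprD addrACA.
  have D1 := siDB SC (Cp i) (Cp j); have D2 := siDB SC (Cq i) (Cq j).
  apply: le_lt_trans (ler_snrmD SC (siDZ SC k D1) D2) _.
  rewrite (snrmZ SC k D1); have := H1 _ _ i1 j1; rewrite ltr_pdivlMr// => h1.
  have h2 := H2 _ _ i2 j2; have := snrm_ge0 hip (phi i - phi j).
  move=> x0.
  have : `|k| * nC (phi i - phi j) <= nC (phi i - phi j) * (`|k| + 1) by rewrite mulrDr mulr1 mulrC lerDl.
  by lra.
- have c12 : (fun n => `|k| * nL (phi n - u) + nL (psi n - v)) @ \oo --> (0 : R).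
    rewrite -[X in _ --> X]addr0 -[X in _ --> X + _](mulr0 `|k|).
    by apply: cvgD => //; apply: cvgM => //; exact: cvg_cst.
  refine (cvg_dist_le _ c12); apply: nearW => n.
  rewrite subr0 ger0_norm ?snrm_ge0//.
  have -> : k *: phi n + psi n - (k *: u + v) = k *: (phi n - u) + (psi n - v).
    by rewrite scalerBr opprD addrACA.
  have D1 := siDB SL (CL (Cp n)) Lu; have D2 := siDB SL (CL (Cq n)) Lv.
  by rewrite -(snrmZ SL k D1); exact: (ler_snrmD SL (siDZ SL k D1) D2).
Qed.

Lemma approx_cst phi : C phi -> approx_by phi (fun=> phi).
Proof.
move=> Cp; split => //; last by rewrite subrr (snrm0 SL); exact: cvg_cst.
by move=> e e0; exists 0%N => i j _ _; rewrite subrr (snrm0 SC).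
Qed.

Lemma completionP : forall u, C u -> form_completion u.
Proof. by move=> u Cu; split; [exact: CL|exists (fun=> u); exact: approx_cst]. Qed.

Lemma completion_lin k u v : form_completion u -> form_completion v -> form_completion (k *: u + v).
Proof.
move=> [Lu [p Hp]] [Lv [q Hq]]; split; first exact: (siDlin SL).
by exists (fun n => k *: p n + q n); exact: approx_lin.
Qed.

(** Closability enters here: the difference of two approximations of [u] approximates 0. Limits of
    forms therefore do not depend on the approximation. *)
Lemma approx_null_sub u phi psi : L u -> approx_by u phi -> approx_by u psi ->
  nC (phi n - psi n) @[n --> \oo] --> (0 : R).
Proof.
move=> Lu Hp Hq; have H := approx_lin (-1) Lu Lu Hq Hp.
have e : (fun n => -1 *: psi n + phi n) = (fun n => phi n - psi n).
  by apply/funext => n; rewrite scaleN1r addrC.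
rewrite e scaleN1r addrC subrr in H; exact: closable H.
Qed.

Lemma approx_bounded u phi : approx_by u phi -> exists2 M, 0 < M & forall n, nC (phi n) <= M.
Proof.
move=> [Cp Hp _]; have [K HK] := Hp 1 ltr01.
pose M := \sum_(i < K.+1) nC (phi i).
have M0 : 0 <= M by apply: sumr_ge0 => i _; exact: snrm_ge0.
exists (M + 1); first by rewrite ltr_wpDl.
have leM i : (i <= K)%N -> nC (phi i) <= M.
  move=> iK; rewrite /M (bigD1 (Ordinal (iK : (i < K.+1)%N)))//= lerDl.
  by apply: sumr_ge0 => j _; exact: snrm_ge0.
move=> n; have [nK|Kn] := leqP n K; first by have := leM _ nK; lra.
apply: le_trans (snrm_le SC (Cp n) (Cp K)) _.
by apply: lerD; [exact: leM|rewrite ltW// HK// ltnW].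
Qed.

Section Ext.
Variables (b : E -> E -> R) (K0 : R).
Hypotheses (SB : semi_inner C b) (K00 : 0 <= K0)
  (bK : forall u, C u -> snrm b u <= K0 * nC u).
Variable sq : E -> nat -> E.
Hypothesis sqP : forall u, form_completion u -> approx_by u (sq u).

(** [sq] is any choice of approximating sequences; [bext_cvg] shows that the value does not depend
    on it. *)
Definition bext (u v : E) : R := limn (fun n => b (sq u n) (sq v n)).

Let b_bound u v : C u -> C v -> `|b u v| <= K0 ^+ 2 * (nC u * nC v).
Proof.
move=> Cu Cv; apply: le_trans (si_cauchy_schwarz SB Cu Cv) _.
rewrite expr2 mulrACA; apply: ler_pM; rewrite ?snrm_ge0//; exact: bK.
Qed.

Let b_cvg u v phi psi : approx_by u phi -> approx_by v psi ->
  cvgn (fun n => b (phi n) (psi n)).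
Proof.
move=> Hp Hq; have [Cp Kp _] := Hp; have [Cq Kq _] := Hq.
have [M1 M10 HM1] := approx_bounded Hp; have [M2 M20 HM2] := approx_bounded Hq.
pose K := K0 ^+ 2 + 1.
have K1 : 0 < K by rewrite ltr_wpDl// sqr_ge0.
have K01 : K0 ^+ 2 <= K by rewrite lerDl.
apply/cauchy_cvgP/cauchy_ballP => e e0; rewrite near_map2.
pose e1 := e / 2 / (K * (M1 + M2)).
have KM : 0 < K * (M1 + M2) by rewrite mulr_gt0// addr_gt0.
have e10 : 0 < e1 by rewrite !divr_gt0.
have [N1 HN1] := Kp _ e10; have [N2 HN2] := Kq _ e10.
exists ([set n | (maxn N1 N2 <= n)%N], [set n | (maxn N1 N2 <= n)%N]) => /=.
  by split; exact: nbhs_infty_ge.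
move=> [i j] /= [] /[!geq_max] /andP[i1 i2] /andP[j1 j2].
rewrite /ball/=.
have -> : b (phi i) (psi i) - b (phi j) (psi j) = b (phi i - phi j) (psi i) + b (phi j) (psi i - psi j).
  by rewrite (sisubl SB)// (sisubr SB)//; ring.
have D1 := siDB SC (Cp i) (Cp j); have D2 := siDB SC (Cq i) (Cq j).
have b1 := b_bound D1 (Cq i); have b2 := b_bound (Cp j) D2.
apply: le_lt_trans (ler_normD _ _) _.
apply: (@le_lt_trans _ _ (K * (e1 * M2) + K * (M1 * e1))).
  apply: lerD; [apply: le_trans b1 _|apply: le_trans b2 _]; apply: ler_pM; rewrite ?sqr_ge0 ?mulr_ge0 ?snrm_ge0//.
    by apply: ler_pM; rewrite ?snrm_ge0// ltW// HN1.
  by apply: ler_pM; rewrite ?snrm_ge0// ltW// HN2.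
have -> : K * (e1 * M2) + K * (M1 * e1) = e / 2.
  have nK : K != 0 by rewrite gt_eqF.
  have nM : M1 + M2 != 0 by rewrite gt_eqF// addr_gt0.
  by rewrite /e1; field; rewrite nK nM.
by rewrite ltr_pdivrMr// ltr_pMr// ltr1n.
Qed.

Lemma bext_cvg u v phi psi : L u -> L v -> approx_by u phi -> approx_by v psi ->
  b (phi n) (psi n) @[n --> \oo] --> bext u v.
Proof.
move=> Lu Lv Hp Hq.
have Hu : form_completion u by split => //; exists phi.
have Hv : form_completion v by split => //; exists psi.
have Sp := sqP Hu; have Sq := sqP Hv.
have Sc : b (sq u n) (sq v n) @[n --> \oo] --> bext u v by exact: b_cvg Sp Sq.
have [M1 M10 HM1] := approx_bounded Hp; have [M2 M20 HM2] := approx_bounded Sq.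
have [Cp _ _] := Hp; have [Cq _ _] := Hq; have [Csp _ _] := Sp; have [Csq _ _] := Sq.
have n1 := approx_null_sub Lu Hp Sp; have n2 := approx_null_sub Lv Hq Sq.
have d0 : (fun n => b (phi n) (psi n) - b (sq u n) (sq v n)) @ \oo --> (0 : R).
  have c12 : (fun n => K0 ^+ 2 * (nC (phi n - sq u n) * M2 + M1 * nC (psi n - sq v n))) @ \oo --> (0 : R).
    rewrite -[X in _ --> X](mulr0 (K0 ^+ 2)); apply: cvgM; first exact: cvg_cst.
    rewrite -[X in _ --> X]addr0 -[X in _ --> X + _](mul0r M2) -[X in _ --> _ + X](mulr0 M1).
    by apply: cvgD; apply: cvgM => //; exact: cvg_cst.
  refine (cvg_dist_le _ c12); apply: nearW => n; rewrite subr0.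
  have -> : b (phi n) (psi n) - b (sq u n) (sq v n) =
      b (phi n - sq u n) (sq v n) + b (phi n) (psi n - sq v n).
    by rewrite (sisubl SB)// (sisubr SB)//; ring.
  apply: le_trans (ler_normD _ _) _; rewrite mulrDr; apply: lerD.
    apply: le_trans (b_bound (siDB SC (Cp n) (Csp n)) (Csq n)) _.
    by rewrite ler_wpM2l ?sqr_ge0// ler_wpM2l ?snrm_ge0.
  apply: le_trans (b_bound (Cp n) (siDB SC (Cq n) (Csq n))) _.
  by rewrite ler_wpM2l ?sqr_ge0// ler_wpM2r ?snrm_ge0.
have -> : (fun n => b (phi n) (psi n)) = (fun n => (b (phi n) (psi n) - b (sq u n) (sq v n)) + b (sq u n) (sq v n)).
  by apply/funext => n; rewrite subrK.
by rewrite -[X in _ --> X]add0r; apply: cvgD.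
Qed.

Lemma semi_inner_bext : semi_inner form_completion bext.
Proof.
split.
- split; first exact: (siD0 SL).
  by exists (fun=> 0); apply: approx_cst; exact: (siD0 SC).
- by move=> k u v; exact: completion_lin.
- move=> k u v w [Lu [p Hp]] [Lv [q Hq]] [Lw [r Hr]].
  have Cp n : C (p n) by have [] := Hp.
  have Cq n : C (q n) by have [] := Hq.
  have Cr n : C (r n) by have [] := Hr.
  have h1 := bext_cvg (siDlin SL k Lu Lv) Lw (approx_lin k Lu Lv Hp Hq) Hr.
  have h2 : (fun n => b (k *: p n + q n) (r n)) @ \oo --> k * bext u w + bext v w.
    have -> : (fun n => b (k *: p n + q n) (r n)) = (fun n => k * b (p n) (r n) + b (q n) (r n)).
      by apply/funext => n; rewrite (silin SB).
    apply: cvgD; last exact: bext_cvg.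
    by apply: cvgM; [exact: cvg_cst|exact: bext_cvg].
  exact: (cvg_unique _ h1 h2).
- move=> u v [Lu [p Hp]] [Lv [q Hq]].
  have h1 := bext_cvg Lu Lv Hp Hq; have h2 := bext_cvg Lv Lu Hq Hp.
  have e : (fun n => b (p n) (q n)) = (fun n => b (q n) (p n)).
    by apply/funext => n; rewrite (sisym SB)//; [have [] := Hp|have [] := Hq].
  rewrite e in h1; exact: (cvg_unique _ h1 h2).
- move=> u [Lu [p Hp]]; have h1 := bext_cvg Lu Lu Hp Hp.
  have c := cvgP _ h1; have <- := cvg_lim (@Rhausdorff R) h1.
  apply: limr_ge => //; apply: nearW => n; apply: (sige0 SB); by have [] := Hp.
Qed.

Lemma snrm_bext_cvg u phi : L u -> approx_by u phi ->
  snrm b (phi n) @[n --> \oo] --> snrm bext u.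
Proof.
move=> Lu Hp; have h := bext_cvg Lu Lu Hp Hp.
by apply: (cvg_comp _ _ h); exact: sqrt_continuous.
Qed.

Lemma bext_C u v : C u -> C v -> bext u v = b u v.
Proof.
move=> Cu Cv; have h := bext_cvg (CL Cu) (CL Cv) (approx_cst Cu) (approx_cst Cv).
exact: (cvg_unique _ h (cvg_cst _)).
Qed.

(** For fixed [n] the sequence [phi n - phi m], indexed by [m], approximates [phi n - u]. The norm
    of the latter is thus a limit of norms that the Cauchy condition makes small. *)
Lemma bext_dense u phi : L u -> approx_by u phi ->
  snrm bext (phi n - u) @[n --> \oo] --> (0 : R).
Proof.
move=> Lu Hp; have [Cp Kp Lp] := Hp.
apply/cvgrPdist_le => e e0.
have e1 : 0 < e / (K0 + 1) by rewrite divr_gt0// ltr_wpDl.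
have [K HK] := Kp _ e1.
exists K => // n /= Kn; rewrite sub0r normrN ger0_norm ?snrm_ge0//.
have Ln : L (phi n - u) by exact: (siDB SL (CL (Cp n)) Lu).
have Hn : approx_by (phi n - u) (fun m => phi n - phi m).
  have := approx_lin (-1) Lu (CL (Cp n)) Hp (approx_cst (Cp n)).
  have -> : (fun m => -1 *: phi m + phi n) = (fun m => phi n - phi m).
    by apply/funext => m; rewrite scaleN1r addrC.
  by rewrite scaleN1r addrC.
have h := snrm_bext_cvg Ln Hn; have c := cvgP _ h.
rewrite -(cvg_lim (@Rhausdorff R) h); apply: limr_le => //.
exists K => // m /= Km.
apply: le_trans (bK (siDB SC (Cp n) (Cp m))) _.
apply: (@le_trans _ _ ((K0 + 1) * (e / (K0 + 1)))); last by rewrite mulrCA divff ?mulr1// gt_eqF// ltr_wpDl.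
apply: ler_pM => //; [exact: snrm_ge0|by rewrite lerDl|by rewrite ltW// HK].
Qed.

(** The constant sequence 0 approximates [z]. This lets functions that agree almost everywhere be
    exchanged in the energy norm. *)
Lemma bext_null z : L z -> nL z = 0 -> form_completion z /\ snrm bext z = 0.
Proof.
move=> Lz z0.
have Hz : approx_by z (fun=> 0).
  split; first by move=> n; exact: (siD0 SC).
    by move=> e e0; exists 0%N => i j _ _; rewrite subrr (snrm0 SC).
  by rewrite sub0r (snrmN SL Lz) z0; exact: cvg_cst.
split; first by split => //; exists (fun=> 0).
have h := snrm_bext_cvg Lz Hz; rewrite (snrm0 SB) in h.
exact: (cvg_unique _ h (cvg_cst _)).
Qed.

End Ext.

Lemma bext_dom (b1 b2 : E -> E -> R) (K1 K2 K : R) (sq : E -> nat -> E) :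
  semi_inner C b1 -> semi_inner C b2 ->
  (forall u, C u -> snrm b1 u <= K1 * nC u) ->
  (forall u, C u -> snrm b2 u <= K2 * nC u) ->
  (forall u, form_completion u -> approx_by u (sq u)) ->
  (forall u, C u -> snrm b1 u <= K * snrm b2 u) ->
  forall u, form_completion u -> snrm (bext b1 sq) u <= K * snrm (bext b2 sq) u.
Proof.
move=> S1 S2 h1 h2 sqP h12 u Hu; have [Lu _] := Hu.
have Hs := sqP _ Hu; have [Cs _ _] := Hs.
have c1 := snrm_bext_cvg S1 h1 sqP Lu Hs.
have c2 := snrm_bext_cvg S2 h2 sqP Lu Hs.
have c3 : (fun n => K * snrm b2 (sq u n)) @ \oo --> K * snrm (bext b2 sq) u.
  by apply: cvgM => //; exact: cvg_cst.
rewrite -(cvg_lim (@Rhausdorff R) c1) -(cvg_lim (@Rhausdorff R) c3).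
apply: ler_lim; [exact: cvgP c1|exact: cvgP c3|].
by apply: nearW => n; exact: h12.
Qed.

Section Complete.
Variable sq : E -> nat -> E.
Hypothesis sqP : forall u, form_completion u -> approx_by u (sq u).
Local Notation B := (bext hip sq).

(** Diagonal choice: [phi n] in [C] is taken within [1 / n.+1] of [u n] in both norms. It inherits
    the Cauchy property of [u] and hence approximates [w]. *)
Lemma completion_complete (u : nat -> E) (w : E) :
  (forall n, form_completion (u n)) -> L w -> nL (u n - w) @[n --> \oo] --> (0 : R) ->
  (forall e : R, 0 < e -> exists K, forall i j, (K <= i)%N -> (K <= j)%N ->
     snrm B (u i - u j) <= e) ->
  form_completion w /\ snrm B (u n - w) @[n --> \oo] --> (0 : R).
Proof.
move=> Hu Lw uw Cu.
have h1 : forall v, C v -> snrm hip v <= 1 * nC v by move=> v _; rewrite mul1r.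
have SB := semi_inner_bext SC h1 sqP.
have Lu n : L (u n) by have [] := Hu n.
have e0 n : 0 < n.+1%:R^-1 :> R by rewrite invr_gt0.
have /choice[phi Hphi] n : exists p, [/\ C p, snrm B (p - u n) <= n.+1%:R^-1 & nL (p - u n) <= n.+1%:R^-1].
  have Hs := sqP (Hu n); have [Cs _ Ls] := Hs.
  have d1 := cvgr_le _ (bext_dense SC ler01 h1 sqP (Lu n) Hs) _ (e0 n).
  have d2 := cvgr_le _ Ls _ (e0 n).
  have [K _ HK] : \forall m \near \oo, snrm B (sq (u n) m - u n) <= n.+1%:R^-1 /\ nL (sq (u n) m - u n) <= n.+1%:R^-1.
    by near=> m; split; near: m; [exact: d1|exact: d2].
  by have [h h'] := HK K (leqnn _); exists (sq (u n) K).
have Cphi n : C (phi n) by have [] := Hphi n.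
have Hp n : form_completion (phi n) := completionP (Cphi n).
have inv_cvg : (fun n => n.+1%:R^-1 : R) @ \oo --> (0 : R) by exact: cvg_harmonic.
have Hw : approx_by w phi.
  split => //.
    move=> e e0'; have e4 : 0 < e / 4 by rewrite divr_gt0.
    have [K1 HK1] := Cu _ e4.
    have [K2 _ HK2] := cvgr_le _ inv_cvg _ e4.
    exists (maxn K1 K2) => i j; rewrite !geq_max => /andP[i1 i2] /andP[j1 j2].
    have Dp := siDB SC (Cphi i) (Cphi j).
    have -> : nC (phi i - phi j) = snrm B (phi i - phi j).
      by rewrite /snrm (bext_C SC h1 sqP Dp Dp).
    have [_ p1 _] := Hphi i; have [_ p2 _] := Hphi j.
    apply: le_lt_trans (ler_snrmB SB (Hp i) (Hu i) (Hp j)) _.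
    have q1 := ler_snrmB SB (Hu i) (Hu j) (Hp j).
    rewrite (snrm_distC SB (Hu j) (Hp j)) in q1.
    have r1 := HK1 _ _ i1 j1.
    have r2 : i.+1%:R^-1 <= e / 4 := HK2 _ i2.
    have r3 : j.+1%:R^-1 <= e / 4 := HK2 _ j2.
    by have := le_trans p1 r2; have := le_trans p2 r3; move: q1 r1; lra.
  have c12 : (fun n => n.+1%:R^-1 + nL (u n - w)) @ \oo --> (0 : R).
    by rewrite -[X in _ --> X]addr0; exact: cvgD.
  refine (cvg_dist_le _ c12); apply: nearW => n.
  rewrite subr0 ger0_norm ?snrm_ge0//.
  apply: le_trans (ler_snrmB SL (CL (Cphi n)) (Lu n) Lw) _.
  by rewrite lerD2r; have [] := Hphi n.
have Cw : form_completion w by split => //; exists phi.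
split => //.
have c12 : (fun n => n.+1%:R^-1 + snrm B (phi n - w)) @ \oo --> (0 : R).
  rewrite -[X in _ --> X]addr0; apply: cvgD => //.
  exact: (bext_dense SC ler01 h1 sqP Lw Hw).
refine (cvg_dist_le _ c12); apply: nearW => n.
rewrite subr0 ger0_norm ?snrm_ge0//.
apply: le_trans (ler_snrmB SB (Hu n) (Hp n) Cw) _.
by rewrite lerD2r (snrm_distC SB (Hu n) (Hp n)); have [] := Hphi n.
Unshelve. all: by end_near. Qed.

End Complete.
End Completion.

(** * Primitives and inequalities for real powers *)

Lemma global_primitive (R : realType) (f : R -> R) : continuous f ->
  exists F : R -> R, forall x : R, is_derive x 1 F (f x).
Proof.
move=> cf.
have /choice[G HG] (n : nat) : exists F : R -> R, forall x : R, - (n.+1%:R) < x < n.+1%:R -> is_derive x 1 F (f x).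
  have h1 : n.+1%:R < n.+2%:R :> R by rewrite ltr_nat.
  have h2 : 0 < n.+1%:R :> R by rewrite ltr0Sn.
  by apply: (@itv_primitive _ f (- (n.+2%:R)) n.+2%:R) => [||//|x _]; [lra|lra|exact: cf].
(* Primitives on nested intervals differ by constants, so after subtraction of the value at 0 the
   interval used for [x] does not matter. *)
pose k (x : R) := Num.bound `|x|.
have kP (x : R) : `|x| < (k x).+1%:R.
  by apply: lt_trans (archi_boundP (normr_ge0 x)) _; rewrite ltr_nat.
have agree n p (x : R) : (n <= p)%N -> - (n.+1%:R) < x < n.+1%:R -> G n x - G n 0 = G p x - G p 0.
  move=> np xn.
  have np' : n.+1%:R <= p.+1%:R :> R by rewrite ler_nat.
  have d1 (y : R) : - (n.+1%:R) < y < n.+1%:R -> is_derive y 1 (fun y : R => G n y - G p y) (f y - f y).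
    by move=> yn; apply: is_deriveB; apply: HG; lra.
  have n0 : - (n.+1%:R) < (0 : R) < n.+1%:R by rewrite oppr_lt0 ltr0Sn.
  have z y : - (n.+1%:R) < y < n.+1%:R -> `|f y - f y| <= 0 by rewrite subrr normr0.
  have h := mvt_le d1 z n0 xn; rewrite mul0r in h.
  by move: h; rewrite normr_le0 => /eqP; lra.
exists (fun x => G (k x) x - G (k x) 0) => x.
have xk' : - (k x).+1%:R < x < (k x).+1%:R by rewrite -ltr_norml.
have : is_derive x 1 (fun y : R => G (k x) y - G (k x) 0) (f x - 0).
  exact: (is_deriveB (HG _ _ xk') (is_derive_cst (G (k x) 0) x 1)).
rewrite subr0; apply: is_derive_near.
have nx : \forall y \near x, - (k x).+1%:R < y < (k x).+1%:R.
  move/andP : xk' => [h1 h2]; near=> y; apply/andP; split; near: y.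
    exact: lt_nbhsr.
  exact: lt_nbhsl.
apply: filterS nx => y yk.
have yky : - (k y).+1%:R < y < (k y).+1%:R.
  by rewrite -ltr_norml.
have [h|h] := leqP (k x) (k y); first exact: agree.
by rewrite (agree _ _ _ (ltnW h)).
Unshelve. all: by end_near. Qed.

Lemma powR_le_add1 (R : realType) (x r s : R) : 0 <= x -> 0 < r <= s ->
  x `^ r <= 1 + x `^ s.
Proof.
move=> x0 /andP[r0 rs]; have s0 := lt_le_trans r0 rs.
have [x1|x1] := leP x 1.
  have : x `^ r <= 1 `^ r by apply: ge0_ler_powR; rewrite ?nnegrE// ltW.
  by rewrite powR1 => h; apply: le_trans h _; rewrite lerDl powR_ge0.
by apply: (@le_trans _ _ (x `^ s)); [rewrite ler_powR// ltW|rewrite lerDr].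
Qed.

(** Compare [d] with [e * u]: bounding the smaller of the two by the larger leaves one of the
    summands on the right. *)
Lemma young_powR (R : realType) (d u e q : R) : 0 <= d -> 0 <= u -> 0 < e -> 2 < q ->
  d ^+ 2 * u `^ (q - 2) <= e ^+ 2 * u `^ q + e `^ (2 - q) * d `^ q.
Proof.
move=> d0 u0 e0 q2.
have sq (x : R) : 0 <= x -> x ^+ 2 * x `^ (q - 2) = x `^ q.
  rewrite le_eqVlt => /predU1P[<-|x0].
    by rewrite expr0n mul0r powR0// gt_eqF//; lra.
  rewrite -powR_mulrn ?ltW// -powRD; last by apply/implyP => _; rewrite gt_eqF.
  by congr (_ `^ _); ring.
have h1 : 0 <= e ^+ 2 * u `^ q by rewrite mulr_ge0 ?powR_ge0 ?sqr_ge0.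
have h2 : 0 <= e `^ (2 - q) * d `^ q by rewrite mulr_ge0 ?powR_ge0.
have q20 : 0 <= q - 2 by lra.
have [de|ed] := leP d (e * u).
  apply: (@le_trans _ _ (e ^+ 2 * u `^ q)); last by rewrite lerDl.
  rewrite -(sq u)// mulrA -exprMn ler_wpM2r ?powR_ge0//.
  by rewrite ler_pXn2r ?nnegrE ?mulr_ge0 ?(ltW e0).
apply: (@le_trans _ _ (e `^ (2 - q) * d `^ q)); last by rewrite lerDr.
have ud : u <= e^-1 * d by rewrite mulrC ler_pdivlMr// mulrC ltW.
have : u `^ (q - 2) <= (e^-1 * d) `^ (q - 2).
  by apply: ge0_ler_powR; rewrite ?nnegrE ?mulr_ge0 ?invr_ge0 ?(ltW e0).
rewrite powRM ?invr_ge0 ?(ltW e0)//.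
have -> : e^-1 `^ (q - 2) = e `^ (2 - q).
  by rewrite -powR_inv1 ?(ltW e0)// -powRrM; congr (_ `^ _); ring.
move=> h; rewrite -(sq d)// [leRHS]mulrCA; apply: ler_wpM2l; first exact: sqr_ge0.
exact: h.
Qed.

(** * Nemytskii operators *)

Section Growth.
Context (R : realType) (f : R -> R) (c rho q : R).
Hypotheses (c0 : 0 <= c) (q2 : 2 < q) (rho0 : 0 < rho <= (q - 2) / 2)
  (fg : growth f c rho).
Let s := (q - 2) / 2.

(** The exponent satisfies [2 + 2 * s = q], so the weight is square integrable for functions in L^q.
    The 3 collects the 1 of [growth] and two more from replacing powers [rho] by powers [s]. *)
Definition growth_weight (u v : R) : R :=
  c * `|v - u| * (3 + 2 * `|u| `^ s + 2 * `|v| `^ s).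

(** The point [x] is free because the bound serves both for [v] and for the intermediate point of
    the mean value theorem in [primitive_taylor]. *)
Lemma growth_le (u v x : R) : `|x| `^ s <= `|u| `^ s + `|v| `^ s -> `|x - u| <= `|v - u| ->
  `|f x - f u| <= growth_weight u v.
Proof.
move=> hx xu; apply: le_trans (fg _ _) _; rewrite /growth_weight.
have p1 := powR_le_add1 (normr_ge0 x) rho0.
have p2 := powR_le_add1 (normr_ge0 u) rho0.
apply: ler_pM; rewrite ?mulr_ge0 ?addr_ge0 ?powR_ge0//.
  by rewrite ler_wpM2l.
rewrite -/s in p1 p2; have := powR_ge0 `|v| s; move: hx p1 p2; lra.
Qed.

Lemma growth_sub u v : `|f v - f u| <= growth_weight u v.
Proof. by apply: growth_le => //; rewrite lerDr powR_ge0. Qed.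

Lemma growth_continuous : continuous f.
Proof.
move=> x; pose K := c * (3 + 2 * `|x| `^ s + 2 * (`|x| + 1) `^ s).
have c3 : (fun y : R => K * `|y - x|) @ x --> (0 : R).
  have c1 : (fun y : R => y - x) @ x --> x - x.
    by apply: cvgB; [exact: cvg_id|exact: cvg_cst].
  have c2 := cvg_norm c1; rewrite subrr normr0 in c2.
  have c4 : (fun y : R => K * `|y - x|) @ x --> K * 0.
    by apply: cvgM; [exact: cvg_cst|exact: c2].
  by rewrite mulr0 in c4.
apply: (cvg_dist_le _ c3); near=> y.
apply: le_trans (growth_sub _ _) _; rewrite /growth_weight /K mulrAC.
apply: ler_wpM2r => //; apply: ler_wpM2l => //.
rewrite lerD2l ler_wpM2l//; apply: ge0_ler_powR; rewrite ?nnegrE ?addr_ge0//.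
  by rewrite divr_ge0// subr_ge0 ltW.
have : `|x - y| <= 1 by near: y; apply: cvgr_dist_le; [exact: cvg_id|exact: ltr01].
move=> h; have := ler_normB x (x - y); rewrite opprB addrC subrK; lra.
Unshelve. all: by end_near. Qed.

(* The free parameter [e] replaces Hoelder's inequality when the weight is shown
   to tend to [0] in L^2: first [e] is chosen, then [v - u] is small in L^q. *)
Lemma growth_weight_sqr (u v e : R) : 0 < e ->
  growth_weight u v ^+ 2 <= 12 * c ^+ 2 * (e ^+ 2 * (9 + `|u| `^ q + `|v| `^ q) + 11 * (e `^ (2 - q) * `|v - u| `^ q)).
Proof.
move=> e0; have s2 (x : R) : (`|x| `^ s) ^+ 2 = `|x| `^ (q - 2).
  rewrite -powR_mulrn ?powR_ge0// -powRrM; congr (_ `^ _).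
  by rewrite /s; field.
have y1 := young_powR (normr_ge0 (v - u)) (normr_ge0 u) e0 q2.
have y2 := young_powR (normr_ge0 (v - u)) (normr_ge0 v) e0 q2.
have y3 := young_powR (normr_ge0 (v - u)) ler01 e0 q2.
rewrite !powR1 !mulr1 in y3.
rewrite -s2 in y1; rewrite -s2 in y2.
rewrite /growth_weight.
set d := `|v - u| in y1 y2 y3 *; set z := e `^ (2 - q) * _ in y1 y2 y3 *.
set x := `|u| `^ s in y1 *; set y := `|v| `^ s in y2 *.
have x0 : 0 <= x := powR_ge0 _ _; have y0 : 0 <= y := powR_ge0 _ _.
have d0 : 0 <= d ^+ 2 := sqr_ge0 d.
(* A square of three summands costs a factor 3, and [2 ^ 2] a factor 4, hence 12. The 11 of the
   result is [9 + 1 + 1], from the three uses of [young_powR]. *)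
have h1 : (3 + 2 * x + 2 * y) ^+ 2 <= 12 * (9 + x ^+ 2 + y ^+ 2).
  have := sqr_ge0 (x - y); have := sqr_ge0 (x - 3); have := sqr_ge0 (y - 3); have := sqr_ge0 x; have := sqr_ge0 y; rewrite !expr2; nra.
have -> : (c * d * (3 + 2 * x + 2 * y)) ^+ 2 = c ^+ 2 * (d ^+ 2 * (3 + 2 * x + 2 * y) ^+ 2) by ring.
have -> : 12 * c ^+ 2 * (e ^+ 2 * (9 + `|u| `^ q + `|v| `^ q) + 11 * z) =
   c ^+ 2 * (12 * (e ^+ 2 * (9 + `|u| `^ q + `|v| `^ q) + 11 * z)) by ring.
apply: ler_wpM2l; first exact: sqr_ge0.
apply: le_trans (ler_wpM2l d0 h1) _.
have -> : d ^+ 2 * (12 * (9 + x ^+ 2 + y ^+ 2)) = 12 * (9 * d ^+ 2 + d ^+ 2 * x ^+ 2 + d ^+ 2 * y ^+ 2) by ring.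
by rewrite ler_wpM2l//; move: y1 y2 y3; lra.
Qed.

Variable F : R -> R.
Hypothesis dF : forall x : R, is_derive x 1 F (f x).

Lemma primitive_taylor u v : `|F v - F u - f u * (v - u)| <= `|v - u| * growth_weight u v.
Proof.
have s0 : 0 <= s by rewrite /s divr_ge0// subr_ge0 ltW.
have cF x : {for x, continuous F} by apply: is_derive_continuous (dF x).
have [x [h1 h2 h3]] : exists x, [/\ `|x| `^ s <= `|u| `^ s + `|v| `^ s, `|x - u| <= `|v - u| & F v - F u = f x * (v - u)].
  have xb x : Num.min u v <= x <= Num.max u v -> `|x| `^ s <= `|u| `^ s + `|v| `^ s.
    move=> /andP[x1 x2].
    have : `|x| <= `|u| \/ `|x| <= `|v|.
      have [x0|x0] := leP 0 x.
        rewrite ger0_norm//; move: x2; rewrite le_max => /orP[h|h]; [left|right]; apply: le_trans h _; exact: ler_norm.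
      rewrite ltr0_norm//; move: x1; rewrite ge_min => /orP[h|h]; [left|right]; rewrite -normrN; apply: le_trans (ler_norm _); rewrite lerN2//.
    by move=> [h|h]; [apply: ler_wpDr|apply: ler_wpDl]; rewrite ?powR_ge0//; apply: ge0_ler_powR; rewrite ?nnegrE.
  have [uv|vu|uv] := ltgtP u v.
  - have [x + hF] := MVT uv (fun x _ => dF x) (continuous_in_subspaceT (fun x _ => cF x)).
    rewrite in_itv/= => /andP[x1 x2]; exists x; split => //.
      by apply: xb; rewrite ge_min le_max (ltW x1) (ltW x2) orbT.
    by rewrite !gtr0_norm ?subr_gt0//; lra.
  - have [x + hF] := MVT vu (fun x _ => dF x) (continuous_in_subspaceT (fun x _ => cF x)).
    rewrite in_itv/= => /andP[x1 x2]; exists x; split => //.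
    + by apply: xb; rewrite ge_min le_max (ltW x1) (ltW x2) orbT.
    + by rewrite !ltr0_norm ?subr_lt0//; lra.
    + by rewrite -opprB hF; ring.
  - by exists u; rewrite uv !subrr mulr0; split => //; rewrite lerDl powR_ge0.
rewrite h3 -mulrBl normrM mulrC ler_wpM2l//.
exact: growth_le.
Qed.

End Growth.

Section Nemytskii.
Context d (T : measurableType d) (R : realType) (mu : {measure set T -> \bar R}).
Variables (D : set T) (mD : measurable D) (fD : (mu D < +oo)%E).
Local Notation E := (T -> R).
Local Notation L := [set g : E | (g \_ D) \in Lfun mu 2%:E].
Local Notation ip := (fun g h : E => \int[mu]_(x in D) (g x * h x)).
Local Notation nL := (snrm (E := E) ip).
Let SL := semi_inner_L2 mu mD.
Variables (f F : R -> R) (c rho q : R).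
Hypotheses (c0 : 0 <= c) (q2 : 2 < q) (rho0 : 0 < rho <= (q - 2) / 2)
  (fg : growth f c rho) (dF : forall x : R, is_derive x 1 F (f x)).

Definition inLq (u : E) : Prop :=
  measurable_fun D u /\ mu.-integrable D (EFin \o (fun x => `|u x| `^ q)).

Definition Iq (u : E) : R := \int[mu]_(x in D) (`|u x| `^ q).

Lemma Iq_ge0 u : 0 <= Iq u.
Proof. by apply: Rintegral_ge0 => x _; exact: powR_ge0. Qed.

Lemma cst_integrable (k : R) : mu.-integrable D (EFin \o (fun _ : T => k)).
Proof.
apply: measurable_bounded_integrable => //; exists `|k|; split; first exact: num_real.
by move=> y ky x _; exact: ltW.
Qed.

Lemma L2_dom (g h : E) : measurable_fun D g -> (forall x, D x -> `|g x| <= h x) ->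
  L h -> L g /\ nL g <= nL h.
Proof.
move=> mg gh Lh; have [mh ih] := (L2_restrictP mu mD h).1 Lh.
have gh2 x : D x -> g x ^+ 2 <= h x ^+ 2.
  move=> Dx; rewrite -[leLHS]real_normK ?num_real// ler_pXn2r ?nnegrE ?gh//.
  by apply: le_trans (gh _ Dx).
have ig : mu.-integrable D (EFin \o (fun x => g x ^+ 2)).
  apply: le_integrable ih => //; first by apply/measurable_EFinP; exact: (measurable_funX 2).
  by move=> x Dx /=; rewrite lee_fin !ger0_norm ?sqr_ge0// gh2.
split; first exact/(L2_restrictP mu mD).
rewrite /snrm ler_wsqrtr//; under eq_Rintegral do rewrite -expr2.
by under [leRHS]eq_Rintegral do rewrite -expr2; apply: le_Rintegral.
Qed.

Lemma cst_L2 (k : R) : L (fun=> k).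
Proof.
by apply/(L2_restrictP mu mD); split; [exact: measurable_cst|exact: cst_integrable].
Qed.

Let weight (u v : E) : E := fun x => growth_weight c q (u x) (v x).

Lemma weight_L2 (u v : E) : inLq u -> inLq v -> inLq (v - u) ->
  L (weight u v) /\ forall e : R, 0 < e ->
  nL (weight u v) ^+ 2 <= 12 * c ^+ 2 * (e ^+ 2 * (9 * fine (mu D) + Iq u + Iq v) + 11 * (e `^ (2 - q) * Iq (v - u))).
Proof.
move=> [mu' iu] [mv iv] [mw iw].
have mp (g : E) (s : R) : measurable_fun D g -> measurable_fun D (fun x => `|g x| `^ s).
  move=> mg; apply: (measurableT_comp (measurable_powR _)); exact: measurableT_comp.
have mW : measurable_fun D (weight u v).
  apply: measurable_funM.
    by apply: measurable_funM => //; apply: measurableT_comp => //; exact: measurable_funB.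
  apply: measurable_funD; first apply: measurable_funD => //.
    by apply: measurable_funM => //; exact: mp.
  by apply: measurable_funM => //; exact: mp.
have iR (e : R) : mu.-integrable D (EFin \o (fun x => 12 * c ^+ 2 * (e ^+ 2 * (9 + `|u x| `^ q + `|v x| `^ q) + 11 * (e `^ (2 - q) * `|(v - u) x| `^ q)))).
  have h1 := integrableD mD (integrableD mD (cst_integrable 9) iu) iv.
  have h2 := integrableD mD (integrableZl mD (e ^+ 2) h1) (integrableZl mD 11 (integrableZl mD (e `^ (2 - q)) iw)).
  by have := integrableZl mD (12 * c ^+ 2) h2; apply: eq_integrable.
have iW : mu.-integrable D (EFin \o (fun x => weight u v x ^+ 2)).
  apply: le_integrable (iR 1) => //; first by apply/measurable_EFinP; exact: (measurable_funX 2).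
  move=> x Dx /=; rewrite lee_fin ger0_norm ?sqr_ge0//; apply: le_trans (ler_norm _).
  by apply: growth_weight_sqr.
have LW : L (weight u v) by exact/(L2_restrictP mu mD).
split => // e e0; rewrite (snrm_sqr SL LW).
under eq_Rintegral do rewrite -expr2.
apply: le_trans (_ : \int[mu]_(x in D) (12 * c ^+ 2 * (e ^+ 2 * (9 + `|u x| `^ q + `|v x| `^ q) + 11 * (e `^ (2 - q) * `|(v - u) x| `^ q))) <= _).
  by apply: le_Rintegral => // x Dx; apply: growth_weight_sqr.
have i9 := cst_integrable 9.
have i9u : mu.-integrable D (EFin \o (fun x => 9 + `|u x| `^ q)) by exact: (integrableD mD i9 iu).
have i9uv : mu.-integrable D (EFin \o (fun x => 9 + `|u x| `^ q + `|v x| `^ q)) by exact: (integrableD mD i9u iv).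
have iz k : mu.-integrable D (EFin \o (fun x => k * `|(v - u) x| `^ q)).
  by have := integrableZl mD k iw; apply: eq_integrable.
have iz2 : mu.-integrable D (EFin \o (fun x => 11 * (e `^ (2 - q) * `|(v - u) x| `^ q))).
  by have := integrableZl mD 11 (iz (e `^ (2 - q))); apply: eq_integrable.
have i1 : mu.-integrable D (EFin \o (fun x => e ^+ 2 * (9 + `|u x| `^ q + `|v x| `^ q))).
  by have := integrableZl mD (e ^+ 2) i9uv; apply: eq_integrable.
have i2 : mu.-integrable D (EFin \o (fun x => e ^+ 2 * (9 + `|u x| `^ q + `|v x| `^ q) + 11 * (e `^ (2 - q) * `|(v - u) x| `^ q))).
  exact: (integrableD mD i1 iz2).
rewrite RintegralZl// RintegralD// !RintegralZl//.
by rewrite (RintegralD mD i9u iv) (RintegralD mD i9 iu) Rintegral_cst.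
Qed.

Lemma measurable_comp_f (u : E) : measurable_fun D u -> measurable_fun D (f \o u).
Proof.
move=> mu'; apply: (@measurableT_comp _ _ _ _ _ _ f) => //.
apply: continuous_measurable_fun; exact: (growth_continuous c0 q2 rho0 fg).
Qed.

Lemma inLq0 : inLq 0.
Proof.
split; first exact: measurable_cst.
have -> : (fun x : T => `|(0 : E) x| `^ q) = fun=> 0.
  by apply/funext => x; rewrite normr0 powR0// gt_eqF//; have := q2; lra.
exact: cst_integrable.
Qed.

Lemma nemytskii_L2 (u : E) : inLq u -> L (f \o u) /\
  nL (f \o u) <= nL (fun=> f 0) + Num.sqrt (12 * c ^+ 2 * (9 * fine (mu D) + 12 * Iq u)).
Proof.
move=> hu; have [mu' _] := hu.
have u0 : inLq (u - 0) by rewrite subr0.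
have [LW HW] := weight_L2 inLq0 hu u0.
have [Lg ng] : L (f \o u - fun=> f 0) /\ nL (f \o u - fun=> f 0) <= nL (weight 0 u).
  apply: L2_dom => //; first by apply: measurable_funB => //; exact: measurable_comp_f.
  move=> x Dx; exact: (growth_sub c0 rho0 fg).
have Lfu : L (f \o u).
  have -> : f \o u = (f \o u - fun=> f 0) + (fun=> f 0) by rewrite subrK.
  by apply: (siDD SL) => //; exact: cst_L2.
split => //.
apply: le_trans (snrm_le SL Lfu (cst_L2 (f 0))) _; rewrite lerD2l.
apply: le_trans ng _.
(* The comparison is with the zero function and [e = 1]: [Iq u] then occurs once plus eleven times,
   hence the 12 of the statement. *)
have := HW 1 ltr01; rewrite expr1n mul1r powR1 mul1r subr0.
have -> : Iq 0 = 0.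
  transitivity (\int[mu]_(x in D) (0 : R)); last by rewrite Rintegral_cst// mul0r.
  by apply: eq_Rintegral => x _; rewrite normr0 powR0// gt_eqF//; have := q2; lra.
rewrite addr0 => h.
rewrite -[leLHS]ger0_norm ?snrm_ge0// -sqrtr_sqr ler_wsqrtr//.
apply: le_trans h _; rewrite ler_wpM2l ?mulr_ge0 ?sqr_ge0//; lra.
Qed.

Lemma nemytskii_sub (u v : E) : inLq u -> inLq v -> inLq (v - u) ->
  nL ((f \o v) - (f \o u)) <= nL (weight u v).
Proof.
move=> hu hv huv; have [LW HW] := weight_L2 hu hv huv.
have [mu' _] := hu; have [mv _] := hv.
apply: (L2_dom _ _ LW).2; first by apply: measurable_funB; exact: measurable_comp_f.
by move=> x Dx; exact: (growth_sub c0 rho0 fg).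
Qed.

Lemma weight_cvg (I : Type) (G : set_system I) {FG : Filter G} (w : I -> E) (w0 : E) (M : R) :
  inLq w0 -> (\forall i \near G, [/\ inLq (w i), inLq (w i - w0) & Iq (w i) <= M]) ->
  Iq (w i - w0) @[i --> G] --> (0 : R) ->
  nL (weight w0 (w i)) @[i --> G] --> (0 : R).
Proof.
move=> h0 hw cw; apply/cvgrPdist_le => e e0.
pose A := 12 * c ^+ 2; have A0 : 0 <= A by rewrite mulr_ge0// sqr_ge0.
pose B := 9 * fine (mu D) + Iq w0 + `|M|.
have B0 : 0 <= B by rewrite !addr_ge0 ?Iq_ge0// mulr_ge0// fine_ge0.
pose K := A * (B + 1) + 1.
have K0 : 0 < K by rewrite ltr_wpDl// mulr_ge0// addr_ge0.
(* First [eta1] makes the terms bounded by [B] small. Its negative power is then a fixed constant,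
   against which [Iq (w i - w0)] becomes small. *)
pose eta1 := Num.min 1 (e ^+ 2 / 2 / K).
have eta0 : 0 < eta1 by rewrite lt_min ltr01 !divr_gt0// exprn_gt0.
have eta2 : A * (eta1 ^+ 2 * B) <= e ^+ 2 / 2.
  have h1 : eta1 ^+ 2 <= eta1.
    by rewrite expr2 ger_pMr// ge_min lexx.
  have h2 : eta1 <= e ^+ 2 / 2 / K by rewrite ge_min lexx orbT.
  apply: (@le_trans _ _ (K * (e ^+ 2 / 2 / K))); last by rewrite mulrCA divff ?mulr1// gt_eqF.
  have -> : A * (eta1 ^+ 2 * B) = A * B * eta1 ^+ 2 by ring.
  apply: ler_pM.
  - exact: mulr_ge0.
  - exact: sqr_ge0.
  - have -> : K = A * B + A + 1 by rewrite /K; ring.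
    by move: A0; lra.
  - exact: le_trans h1 h2.
pose Z := A * (11 * eta1 `^ (2 - q)) + 1.
have Z0 : 0 < Z by rewrite ltr_wpDl// !mulr_ge0// powR_ge0.
have eZ : 0 < e ^+ 2 / 2 / Z by rewrite !divr_gt0// exprn_gt0.
have c1 := cvgr_le _ cw (e ^+ 2 / 2 / Z) eZ.
near=> i.
have [hi hi0 hM] : [/\ inLq (w i), inLq (w i - w0) & Iq (w i) <= M] by near: i; exact: hw.
have hI : Iq (w i - w0) <= e ^+ 2 / 2 / Z by near: i; exact: c1.
rewrite sub0r normrN ger0_norm ?snrm_ge0//.
have [LW HW] := weight_L2 h0 hi hi0.
rewrite -(@ler_pXn2r _ 2)// ?nnegrE ?snrm_ge0 ?(ltW e0)//.
apply: le_trans (HW _ eta0) _; rewrite mulrDr [leRHS]splitr; apply: lerD.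
  apply: le_trans eta2; rewrite -/A; apply: ler_wpM2l => //; apply: ler_wpM2l; first exact: sqr_ge0.
  by rewrite /B lerD2l; apply: le_trans hM _; exact: ler_norm.
rewrite -/A; apply: (@le_trans _ _ (Z * Iq (w i - w0))).
  by rewrite /Z mulrDl mul1r !mulrA; have := Iq_ge0 (w i - w0); lra.
apply: (@le_trans _ _ (Z * (e ^+ 2 / 2 / Z))); first by rewrite ler_wpM2l// ltW.
by rewrite mulrCA divff ?mulr1// gt_eqF.
Unshelve. all: by end_near. Qed.

Definition potential (u : E) : R := \int[mu]_(x in D) F (u x).

Lemma potential_taylor_aux (u v : E) : inLq u -> inLq v -> inLq (v - u) -> L u -> L v ->
  mu.-integrable D (EFin \o (fun x => F (v x) - F (u x) - f (u x) * (v x - u x))) /\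
  `|\int[mu]_(x in D) (F (v x) - F (u x) - f (u x) * (v x - u x))| <= nL (v - u) * nL (weight u v).
Proof.
move=> hu hv huv Lu Lv.
have [LW HW] := weight_L2 hu hv huv.
have [mu' _] := hu; have [mv _] := hv.
have mF (g : E) : measurable_fun D g -> measurable_fun D (fun x => F (g x)).
  move=> mg; apply: (@measurableT_comp _ _ _ _ _ _ F) => //.
  by apply: continuous_measurable_fun => x; exact: is_derive_continuous (dF x).
pose av : E := fun x => `|v x - u x|.
have Lvu : L (v - u) by exact: (siDB SL).
have Lav : L av /\ nL av <= nL (v - u).
  have Lnn : L (fun x => `|v x - u x|).
    have [mvu ivu] := (L2_restrictP mu mD _).1 Lvu.
    apply/(L2_restrictP mu mD); split; first exact: measurableT_comp.
    by apply: eq_integrable ivu => // x _ /=; rewrite real_normK ?num_real.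
  split => //; rewrite /snrm ler_wsqrtr// le_eqVlt; apply/orP; left; apply/eqP.
  by apply: eq_Rintegral => x _; rewrite -!expr2 real_normK ?num_real.
have iP := L2_mul_integrable mD Lav.1 LW.
have mG : measurable_fun D (fun x => F (v x) - F (u x) - f (u x) * (v x - u x)).
  apply: measurable_funB; first by apply: measurable_funB; exact: mF.
  by apply: measurable_funM; [exact: measurable_comp_f|exact: measurable_funB].
have bd x : `|F (v x) - F (u x) - f (u x) * (v x - u x)| <= av x * weight u v x.
  exact: (primitive_taylor c0 q2 rho0 fg dF).
have iG : mu.-integrable D (EFin \o (fun x => F (v x) - F (u x) - f (u x) * (v x - u x))).
  apply: le_integrable iP => //; first exact/measurable_EFinP.
  by move=> x _ /=; rewrite lee_fin; apply: le_trans (bd x) _; exact: ler_norm.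
split => //.
apply: le_trans (le_normr_Rintegral mD iG) _.
apply: (@le_trans _ _ (\int[mu]_(x in D) (av x * weight u v x))).
  by apply: le_Rintegral => //; exact: integrable_norm.
apply: le_trans (ler_norm _) _; apply: le_trans (si_cauchy_schwarz SL Lav.1 LW) _.
by rewrite ler_wpM2r ?snrm_ge0//; exact: Lav.2.
Qed.

(** By the expansion at the zero function, [F (u x)] is the sum of the remainder, [f 0 * u x] and
    [F 0], all integrable on a set of finite measure. *)
Lemma potential_integrable (u : E) : inLq u -> L u -> mu.-integrable D (EFin \o (fun x => F (u x))).
Proof.
move=> hu Lu; have u0 : inLq (u - 0) by rewrite subr0.
have [iG _] := potential_taylor_aux inLq0 hu u0 (siD0 SL) Lu.
have iu : mu.-integrable D (EFin \o (fun x => f 0 * u x)) := L2_mul_integrable mD (cst_L2 (f 0)) Lu.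
have := integrableD mD (integrableD mD iG iu) (cst_integrable (F 0)).
apply: eq_integrable => // x _ /=; rewrite -!EFinD; congr EFin.
have -> : (0 : E) x = 0 by []. ring.
Qed.

Lemma potential_taylor (u v : E) : inLq u -> inLq v -> inLq (v - u) -> L u -> L v ->
  `|potential v - potential u - ip (f \o u) (v - u)| <= nL (v - u) * nL (weight u v).
Proof.
move=> hu hv huv Lu Lv; have [iG h] := potential_taylor_aux hu hv huv Lu Lv.
have iu := potential_integrable hu Lu; have iv := potential_integrable hv Lv.
have [Lfu _] := nemytskii_L2 hu.
have iuv := L2_mul_integrable mD Lfu (siDB SL Lv Lu).
apply: le_trans h; rewrite /potential -RintegralB// -RintegralB//.
exact: (integrableB mD iv iu).
Qed.

End Nemytskii.

(** * The first eigenvalue *)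

Section Rayleigh.
Context (R : realType) (E : lmodType R) (L H : set E) (ip form : E -> E -> R).
Hypotheses (SL : semi_inner L ip) (SH : semi_inner H form) (HL : H `<=` L).
Local Notation nL := (snrm ip).
Local Notation nH := (snrm form).
Hypothesis compactness : forall u : nat -> E, (forall n, H (u n)) ->
  (exists M : R, forall n, nH (u n) <= M) ->
  exists k : nat -> nat, {homo k : i j / (i < j)%N} /\
    exists2 w, L w & nL (u (k n) - w) @[n --> \oo] --> (0 : R).
Hypothesis complete : forall (u : nat -> E) (w : E),
  (forall n, H (u n)) -> L w -> nL (u n - w) @[n --> \oo] --> (0 : R) ->
  (forall e : R, 0 < e -> exists K, forall i j, (K <= i)%N -> (K <= j)%N ->
     nH (u i - u j) <= e) ->
  H w /\ nH (u n - w) @[n --> \oo] --> (0 : R).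

(** The direct method. A normalized minimizing sequence converges in [L] along a subsequence by
    compactness. The parallelogram identity, whose sum term is bounded below by means of [lam],
    makes it Cauchy in [H]. The minimizer is a null vector of the semidefinite form
    [form x y - lam * ip x y], and Cauchy-Schwarz for this form is the eigenvalue equation. *)
Lemma rayleigh_min : (exists2 u, H u & ip u u != 0) ->
  exists2 lam : R, (forall u, H u -> lam * ip u u <= form u u) &
  exists w, [/\ H w, ip w w = 1 & forall v, H v -> form w v = lam * ip w v].
Proof.
move=> [u0 Hu0 u00].
pose S : set R := [set form u u / ip u u | u in [set u | H u /\ ip u u != 0]].
have ip_ge0 u : H u -> 0 <= ip u u by move=> /HL; exact: (sige0 SL).
have ipp u : H u -> ip u u != 0 -> 0 < ip u u by move=> Hu; rewrite lt_def => ->; exact: ip_ge0.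
have Sl : lbound S 0.
  by move=> _ [u [Hu u1] <-]; rewrite divr_ge0 ?ip_ge0//; exact: (sige0 SH).
have S0 : S !=set0 by exists (form u0 u0 / ip u0 u0); exists u0.
have iS : has_inf S by split => //; exists 0.
pose lam := inf S.
have lam0 : 0 <= lam by apply: lb_le_inf.
have lamle u : H u -> lam * ip u u <= form u u.
  move=> Hu; have [->|u1] := eqVneq (ip u u) 0; first by rewrite mulr0 (sige0 SH).
  rewrite -ler_pdivlMr ?ipp//; apply: ge_inf; first by exists 0.
  by exists u.
exists lam => //.
have e0 n : 0 < n.+1%:R^-1 :> R by rewrite invr_gt0.
have /choice[u Hu] n : exists u, [/\ H u, ip u u = 1 & form u u <= lam + n.+1%:R^-1].
  have [_ [u [Hu u1] <-] ul] := inf_adherent (e0 n) iS.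
  have up := ipp _ Hu u1; have Lu := HL Hu.
  pose k := (Num.sqrt (ip u u))^-1.
  have k2 : k * k = (ip u u)^-1 by rewrite /k -invfM -expr2 sqr_sqrtr// ltW.
  exists (k *: u); have Hk := siDZ SH k Hu; have Lk := siDZ SL k Lu.
  split => //; first by rewrite (siscalel SL)// (siscaler SL)// mulrA k2 mulVf.
  by rewrite (siscalel SH)// (siscaler SH)// mulrA k2 mulrC ltW.
have Hun n : H (u n) by have [] := Hu n.
have Lun n : L (u n) := HL (Hun n).
have bdu : exists M : R, forall n, nH (u n) <= M.
  exists (Num.sqrt (lam + 1)) => n; rewrite /snrm ler_wsqrtr//.
  have [_ _ h] := Hu n; apply: le_trans h _; rewrite lerD2l invf_le1 ?ler1n//.
have [k [kh [w Lw vw]]] := compactness Hun bdu.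
pose v n := u (k n).
have kn n : (n <= k n)%N.
  by elim: n => // n IH; apply: leq_ltn_trans IH _; exact: kh.
have Hv n : H (v n) := Hun (k n).
have Lv n : L (v n) := Lun (k n).
have fv n : form (v n) (v n) <= lam + n.+1%:R^-1.
  have [_ _ h] := Hu (k n); apply: le_trans h _.
  by rewrite lerD2l lef_pV2 ?posrE ?ltr0Sn// ler_nat ltnS.
have iv n : ip (v n) (v n) = 1 by have [] := Hu (k n).
have inv_cvg : (fun n => n.+1%:R^-1 : R) @ \oo --> (0 : R) by exact: cvg_harmonic.
have Cv (e : R) : 0 < e -> exists K, forall i j, (K <= i)%N -> (K <= j)%N -> nH (v i - v j) <= e.
  (* The squared distance in [H] is at most [4 * de], from the two energies, plus [lam] times the
     squared distance in [L], which [et] keeps below [de]; [8 * de] leaves room. *)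
  move=> e1; pose de := e ^+ 2 / 8.
  have de0 : 0 < de by rewrite divr_gt0// exprn_gt0.
  pose et := Num.min 1 (de / 4 / (lam + 1)).
  have l1 : 0 < lam + 1 by rewrite ltr_wpDl.
  have et0 : 0 < et by rewrite lt_min ltr01/=; apply: divr_gt0 => //; exact: divr_gt0.
  have [K1 _ HK1] := cvgr_le _ inv_cvg _ de0.
  have [K2 _ HK2] := cvgr_le _ vw _ et0.
  exists (maxn K1 K2) => i j; rewrite !geq_max => /andP[i1 i2] /andP[j1 j2].
  have r1 : i.+1%:R^-1 <= de := HK1 _ i1.
  have r2 : j.+1%:R^-1 <= de := HK1 _ j1.
  have r3 : nL (v i - w) <= et := HK2 _ i2.
  have r4 : nL (v j - w) <= et := HK2 _ j2.
  have Hij := siDB SH (Hv i) (Hv j); have Lij := siDB SL (Lv i) (Lv j).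
  have r5 : nL (v i - v j) <= 2 * et.
    have := ler_snrmB SL (Lv i) Lw (Lv j); rewrite (snrm_distC SL Lw (Lv j)); lra.
  have r6 : lam * ip (v i - v j) (v i - v j) <= de.
    rewrite -(snrm_sqr SL Lij).
    apply: (@le_trans _ _ (lam * (2 * et) ^+ 2)).
      by rewrite ler_wpM2l// ler_pXn2r ?nnegrE ?snrm_ge0// mulr_ge0// ltW.
    have et1 : et ^+ 2 <= et by rewrite expr2 ger_pMr// ge_min lexx.
    have et2 : et <= de / 4 / (lam + 1) by rewrite ge_min lexx orbT.
    rewrite ler_pdivlMr// in et2.
    have : lam * et ^+ 2 <= lam * et by rewrite ler_wpM2l.
    have := mulr_ge0 lam0 (ltW et0).
    rewrite exprMn; move: et2; lra.
  have par := si_parallelogram SH (Hv i) (Hv j).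
  have parL := si_parallelogram SL (Lv i) (Lv j).
  have lij := lamle _ (siDD SH (Hv i) (Hv j)).
  rewrite !iv in parL.
  have fi := le_trans (fv i) (lerD (lexx lam) r1).
  have fj := le_trans (fv j) (lerD (lexx lam) r2).
  have : form (v i - v j) (v i - v j) <= e ^+ 2.
    have -> : e ^+ 2 = 8 * de by rewrite /de; field.
    have parL' : lam * ip (v i + v j) (v i + v j) = 4 * lam - lam * ip (v i - v j) (v i - v j).
      by rewrite parL; ring.
    rewrite parL' in lij; rewrite par; move: fi fj lij r6 de0; lra.
  by rewrite -(snrm_sqr SH Hij) ler_pXn2r ?nnegrE ?snrm_ge0// ltW.
have [Hw cw] := complete Hv Lw vw Cv.
have i1 : ip w w = 1.
  have h : (fun n => ip (v n) (v n)) @ \oo --> ip w w.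
    by apply: (si_cvg SL) => //; exact: nearW.
  have e1 : (fun n => ip (v n) (v n)) = fun=> 1 by apply/funext.
  rewrite e1 in h; exact: (cvg_unique _ h (cvg_cst _)).
have f1 : form w w <= lam.
  have h : (fun n => form (v n) (v n)) @ \oo --> form w w.
    by apply: (si_cvg SH) => //; exact: nearW.
  have h2 : (fun n => lam + n.+1%:R^-1) @ \oo --> lam + 0.
    by apply: cvgD => //; exact: cvg_cst.
  rewrite addr0 in h2.
  rewrite -(cvg_lim (@Rhausdorff R) h) -(cvg_lim (@Rhausdorff R) h2).
  by apply: ler_lim; [exact: cvgP h|exact: cvgP h2|apply: nearW => n; exact: fv].
exists w; split => // z Hz.
pose b (x y : E) := form x y - lam * ip x y.
have Sb : semi_inner H b.
  split.
  - exact: (siD0 SH).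
  - by move=> kk x y Hx Hy; exact: (siDlin SH).
  - by move=> kk x y t Hx Hy Ht; rewrite /b (silin SH)// (silin SL); [ring|exact: HL..].
  - by move=> x y Hx Hy; rewrite /b (sisym SH)// (sisym SL)//; exact: HL.
  - by move=> x Hx; rewrite /b subr_ge0 lamle.
have bw : snrm b w = 0.
  apply/eqP; rewrite /snrm sqrtr_eq0 /b i1 mulr1; move: f1; lra.
have := si_cauchy_schwarz Sb Hw Hz; rewrite bw mul0r normr_le0 /b subr_eq0.
by move/eqP.
Qed.

End Rayleigh.

(** * Damped wave equations *)

Section Damped.
Context (R : realType) (E : lmodType R) (L H : set E) (ip form : E -> E -> R).
Hypothesis WT : wave_triple L H ip form.
Let SL := wtL WT.
Let SH := wtH WT.
Let HL := wtHL WT.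
Local Notation nL := (snrm ip).
Local Notation nH := (snrm form).
(* [Nf] is the gradient of [Phi], with [omega] as modulus of differentiability. *)
Variables (Nf : E -> E) (Phi : E -> R) (omega : E -> E -> R).
Hypotheses (NL : forall u, H u -> L (Nf u))
  (Phi_taylor : forall u v, H u -> H v ->
     `|Phi v - Phi u - ip (Nf u) (v - u)| <= nL (v - u) * omega u v)
  (omega_cvg : forall (w : R -> E) t, (\forall r \near t, H (w r)) ->
     nH (w r - w t) @[r --> t] --> (0 : R) -> omega (w t) (w r) @[r --> t] --> (0 : R)).
Variables (theta C1 : R).
Hypotheses (theta0 : 0 < theta <= 2^-1)
  (coercive : forall u, H u -> theta * form u u <= form u u / 2 - Phi u + C1).
Variables (beta : R -> R).

Definition damped_on c d w wt :=
  wave_on L H ip form c d w wt (fun t => - beta t *: wt t + Nf (w t)).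

Definition total_energy (w wt : R -> E) (t : R) : R :=
  wave_energy ip form w wt t / 2 - Phi (w t).

Section OnInterval.
Variables (c d : R) (w wt : R -> E).
Hypothesis W : damped_on c d w wt.

(** [w] is differentiable in [L] only. The linear part of the expansion of [Phi] is a weak
    derivative against the fixed element [Nf (w t)]. In the remainder [nL (w r - w t)] is
    [O(|r - t|)] by [weak_mvt], and [omega] tends to 0 as [w] is continuous in [H]. *)
Lemma potential_derive t : c < t < d ->
  is_derive t 1 (fun r => Phi (w r)) (ip (Nf (w t)) (wt t)).
Proof.
move=> ct; have Ht := woH W ct; have Lt := HL Ht; have LN := NL Ht; have Lwt := woL W ct.
have dlin : is_derive t 1 (fun r : R => ip (w r) (Nf (w t))) (ip (wt t) (Nf (w t))) := wod W LN ct.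
have nw := wave_near_H W ct.
have rem : is_derive t 1 (fun r : R => Phi (w r) - ip (w r) (Nf (w t))) 0.
  apply/is_deriveP => e e0.
  have om := omega_cvg nw (wocH W ct).
  pose B := nL (wt t) + 1.
  have B0 : 0 < B by rewrite ltr_wpDl// snrm_ge0.
  have n1 := cvgr_le _ om _ (divr_gt0 e0 B0).
  have [d0 /= d00 Hd0] : \forall r \near t, c < r < d /\ nL (wt r - wt t) <= 1.
    have m1 := cvgr_le _ (wocL W ct) _ (ltr01 : (0 : R) < 1).
    have m2 := near_in_itv ct.
    by near=> r; split; near: r; [exact: m2|exact: m1].
  have Hb r : t - d0 < r < t + d0 -> c < r < d /\ nL (wt r - wt t) <= 1.
    by move=> tr; apply: Hd0 => /=; rewrite ltr_norml; apply/andP; split; lra.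
  have tt : t - d0 < t < t + d0 by lra.
  have m1 s : t - d0 < s < t + d0 -> L (w s) by move=> /Hb[cs _]; apply: HL; exact: (woH W).
  have m2 s : t - d0 < s < t + d0 -> L (wt s) by move=> /Hb[cs _]; exact: (woL W).
  have m3 v : L v -> forall s, t - d0 < s < t + d0 ->
      is_derive s 1 (fun r : R => ip (w r) v) (ip (wt s) v).
    by move=> Lv s /Hb[cs _]; exact: (wod W).
  have m4 s : t - d0 < s < t + d0 -> nL (wt s - wt t) <= 1 by move=> /Hb[].
  have n2 := near_in_itv tt.
  near=> r.
  have tr : t - d0 < r < t + d0 by near: r; exact: n2.
  have [cr _] := Hb _ tr.
  have Hr := woH W cr; have Lr := HL Hr.
  have hom : omega (w t) (w r) <= e / B by near: r; exact: n1.
  rewrite mul0r subr0.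
  have -> : Phi (w r) - ip (w r) (Nf (w t)) - (Phi (w t) - ip (w t) (Nf (w t))) =
     Phi (w r) - Phi (w t) - ip (Nf (w t)) (w r - w t).
    by rewrite (sisubr SL Lr Lt LN) (sisym SL LN Lr) (sisym SL LN Lt); ring.
  apply: le_trans (Phi_taylor Ht Hr) _.
  have Lwrt := siDB SL Lr Lt.
  have lip : nL (w r - w t) <= B * `|r - t|.
    have := weak_mvt WT Lwt m1 m2 m3 m4 tt tr; rewrite mul1r => h.
    have := snrm_le SL Lwrt (siDZ SL (r - t) Lwt).
    rewrite (snrmZ SL _ Lwt) /B mulrDl mul1r [nL (wt t) * _]mulrC; lra.
  apply: (@le_trans _ _ (nL (w r - w t) * (e / B))).
    by rewrite ler_wpM2l ?snrm_ge0.
  apply: (@le_trans _ _ (B * `|r - t| * (e / B))).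
    by rewrite ler_wpM2r// divr_ge0 ?(ltW e0) ?(ltW B0).
  by rewrite le_eqVlt; apply/orP; left; apply/eqP; field; rewrite gt_eqF.
have h := is_deriveD rem dlin; rewrite add0r (sisym SL Lwt LN) in h.
have -> : (fun r : R => Phi (w r)) = (fun r : R => Phi (w r) - ip (w r) (Nf (w t))) + (fun r : R => ip (w r) (Nf (w t))).
  by apply/funext => r; rewrite fctE subrK.
exact: h.
Unshelve. all: by end_near. Qed.

Lemma total_energy_derive t : c < t < d ->
  is_derive t 1 (total_energy w wt) (- beta t * ip (wt t) (wt t)).
Proof.
move=> ct; have Lwt := woL W ct; have LN := NL (woH W ct).
have h1 := wave_energy_derive WT W ct; have h2 := potential_derive ct.
rewrite (siaddl SL (siDZ SL (- beta t) Lwt) LN Lwt) (siscalel SL _ Lwt Lwt) in h1.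
have h3 : is_derive t 1 (fun r : R => 2^-1 * wave_energy ip form w wt r)
    (2^-1 * (2 * (- beta t * ip (wt t) (wt t) + ip (Nf (w t)) (wt t)))).
  exact: (is_deriveZ (2^-1) h1).
have h4 := is_deriveB h3 h2.
have e : 2^-1 * (2 * (- beta t * ip (wt t) (wt t) + ip (Nf (w t)) (wt t))) - ip (Nf (w t)) (wt t) = - beta t * ip (wt t) (wt t).
  by field.
rewrite e in h4.
have -> : total_energy w wt = (fun r : R => 2^-1 * wave_energy ip form w wt r) - (fun r : R => Phi (w r)).
  by apply/funext => r; rewrite fctE /total_energy mulrC.
exact: h4.
Qed.

Lemma total_energy_ge t : c < t < d ->
  theta * wave_energy ip form w wt t <= total_energy w wt t + C1.
Proof.
move=> ct; have := coercive (woH W ct); have := sige0 SL (woL W ct).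
rewrite /total_energy /wave_energy mulrDr.
set y := ip _ _; set x := form _ _ => y0 h.
have : theta * y <= y / 2.
  by rewrite mulrC ler_wpM2l//; move: theta0 => /andP[].
by move: h; lra.
Qed.

Variables (Gam : R -> R) (G : R).
Hypotheses (dGam : forall t, c < t < d -> is_derive t 1 Gam (neg_part beta t))
  (Gam_bound : forall t0 t, c < t0 -> t0 <= t -> t < d -> Gam t - Gam t0 <= G).

Lemma total_energy_bound t0 t : c < t0 -> t0 <= t -> t < d ->
  theta * wave_energy ip form w wt t <= expR (G / theta) * (total_energy w wt t0 + C1).
Proof.
move=> ct0 t0t td; move: (theta0) => /andP[th0 th1].
(* The exponential is the integrating factor of Gronwall's lemma: [Y] will be nonincreasing. *)
pose Y r := (total_energy w wt r + C1) * expR (- Gam r / theta).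
pose dY r := (- beta r * ip (wt r) (wt r)) * expR (- Gam r / theta) +
  (total_energy w wt r + C1) * (expR (- Gam r / theta) * (- neg_part beta r / theta)).
have wE r : c < r < d -> 0 <= wave_energy ip form w wt r.
  by move=> cr; rewrite addr_ge0//; [exact: (sige0 SH (woH W cr))|exact: (sige0 SL (woL W cr))].
have dYP r : c < r < d -> is_derive r 1 Y (dY r).
  move=> cr.
  have h1 : is_derive r 1 (fun r : R => total_energy w wt r + C1) (- beta r * ip (wt r) (wt r) + 0).
    exact: is_deriveD (total_energy_derive cr) (is_derive_cst C1 r 1).
  have h2 : is_derive r 1 (fun r : R => - Gam r / theta) (- neg_part beta r / theta).
    have h := is_deriveZ (- theta^-1) (dGam cr).
    have e : - theta^-1 *: neg_part beta r = - neg_part beta r / theta.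
      by rewrite [LHS]mulNr mulrC mulNr.
    rewrite e in h.
    have -> : (fun r : R => - Gam r / theta) = - theta^-1 *: Gam.
      by apply/funext => y; rewrite mulNr mulrC -mulNr.
    exact: h.
  have h3 : is_derive r 1 (fun r : R => expR (- Gam r / theta)) (expR (- Gam r / theta) * (- neg_part beta r / theta)).
    exact: (is_derive1_comp (is_derive_expR _) h2).
  have h := is_deriveM h1 h3.
  apply: (is_derive_eq h); rewrite /dY addr0 [_ *: _ in LHS]mulrC.
  by rewrite /GRing.scale/=; ring.
have dY0 r : c < r < d -> dY r <= 0.
  move=> cr.
  have -> : dY r = expR (- Gam r / theta) * (- beta r * ip (wt r) (wt r) - neg_part beta r * ((total_energy w wt r + C1) / theta)).
    by rewrite /dY; ring.
  rewrite pmulr_rle0 ?expR_gt0// subr_le0.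
  have n0 : 0 <= neg_part beta r by rewrite le_max lexx orbT.
  have nb : - beta r <= neg_part beta r by rewrite le_max lexx.
  have ipr := sige0 SL (woL W cr).
  apply: (@le_trans _ _ (neg_part beta r * ip (wt r) (wt r))); first by rewrite ler_wpM2r.
  rewrite ler_wpM2l// ler_pdivlMr// mulrC; apply: le_trans (total_energy_ge cr).
  by rewrite ler_wpM2l ?(ltW th0)// lerDr (sige0 SH (woH W cr)).
have := derive_nonincr dYP dY0 ct0 t0t td; rewrite /Y => h.
have ct : c < t < d by rewrite (lt_le_trans ct0 t0t).
have ct0d : c < t0 < d by rewrite ct0 (le_lt_trans t0t td).
apply: le_trans (total_energy_ge ct) _.
have e0 : 0 <= total_energy w wt t0 + C1.
  by apply: le_trans (total_energy_ge ct0d); rewrite mulr_ge0 ?(ltW th0)// wE.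
have : total_energy w wt t + C1 <= (total_energy w wt t0 + C1) * expR (- Gam t0 / theta) * expR (Gam t / theta).
  rewrite -ler_pdivrMr ?expR_gt0// -expRN.
  by have -> : - (Gam t / theta) = - Gam t / theta by rewrite mulNr.
move=> h'; apply: le_trans h' _; rewrite -mulrA -expRD mulrC ler_wpM2r// ler_expR.
have -> : - Gam t0 / theta + Gam t / theta = (Gam t - Gam t0) / theta by field; rewrite gt_eqF.
by rewrite ler_wpM2r ?invr_ge0 ?(ltW th0)// Gam_bound.
Qed.

End OnInterval.
End Damped.

(** * Asymptotic conditions on [f] and [beta] *)

Lemma limsup_quotient (R : realType) (f : R -> R) (mu1 : R) :
  (limf_esup (fun u : R => (f u / u)%:E) (@abs_infty R) < mu1%:E)%E ->
  exists2 k : R, k < mu1 & exists M : R, forall u, M < `|u| -> f u / u <= k.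
Proof.
move=> /ereal_inf_lt[_ [A [M HM] <-] h].
have ub u : M < `|u| -> ((f u / u)%:E <= ereal_sup [set (f u / u)%:E | u in A])%E.
  by move=> Mu; apply: ereal_sup_ubound; exists u => //; exact: HM.
move: h ub; case: (ereal_sup _) => [k| |] h ub; [|by move: h|].
  by exists k; [rewrite -lte_fin|exists M => u /ub; rewrite lee_fin].
(* A supremum [-oo] lies below every real number, so any [k] below [mu1] will do. *)
exists (mu1 - 1); first by rewrite ltrBlDr ltrDl.
by exists M => u /ub.
Qed.

(** [p] below has derivative [f x - k * x], nonpositive above [B] and nonnegative below [- B], so
    its maximum over the compact interval is global. *)
Lemma primitive_upper_bound (R : realType) (f F : R -> R) (k M : R) :
  (forall x : R, is_derive x 1 F (f x)) ->
  (forall u, M < `|u| -> f u / u <= k) ->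
  exists2 C, 0 <= C & forall x, F x <= k / 2 * x ^+ 2 + C.
Proof.
move=> dF Hf.
pose B := `|M| + 1.
have B0 : 0 < B by rewrite ltr_wpDl.
have MB : M < B by rewrite /B; have := ler_norm M; lra.
pose p x := F x - k / 2 * x ^+ 2.
have dp (x : R) : is_derive x 1 p (f x - k * x).
  have h1 : is_derive x 1 (fun x : R => x ^+ 2) (2 * x).
    have -> : (fun x : R => x ^+ 2) = (@id R) * (@id R) by apply/funext => y; rewrite expr2.
    apply: (is_derive_eq (is_deriveM (is_derive_id x 1) (is_derive_id x 1))).
    by rewrite [_ *: _]mulr1 /=; ring.
  have h2 := is_deriveB (dF x) (is_deriveZ (k / 2) h1).
  have e : f x - (k / 2) *: (2 * x) = f x - k * x by rewrite [_ *: _]mulrA divfK.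
  by rewrite e in h2.
have cp : {within `[- B, B], continuous p}.
  by apply: continuous_subspaceT => x; exact: is_derive_continuous (dp x).
have BB : - B <= B by lra.
have [x0 _ Hx0] := EVT_max BB cp.
exists `|p x0| => // x.
suff : p x <= p x0 by rewrite /p => h; have := ler_norm (p x0); rewrite /p; move: h; lra.
have inB y : - B <= y <= B -> p y <= p x0 by move=> yB; apply: Hx0; rewrite in_itv.
have [xB|xB] := leP (- B) x; last first.
  apply: le_trans (inB (- B) _); last by rewrite lexx.
  have [y + hy] := MVT xB (fun y _ => dp y) (continuous_subspaceT (fun z => is_derive_continuous (dp z))).
  rewrite in_itv/= => /andP[xy yB].
  have : f y / y <= k by apply: Hf; rewrite ltr0_norm; lra.
  rewrite ler_ndivrMr; last by lra.
  move=> h; have : 0 <= p (- B) - p x by rewrite hy mulr_ge0//; lra.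
  by lra.
have [xB'|xB'] := leP x B; first by apply: inB; rewrite xB.
apply: le_trans (inB B _); last by rewrite lexx andbT.
have [y + hy] := MVT xB' (fun y _ => dp y) (continuous_subspaceT (fun z => is_derive_continuous (dp z))).
rewrite in_itv/= => /andP[xy yB].
have : f y / y <= k by apply: Hf; rewrite gtr0_norm; lra.
rewrite ler_pdivrMr; last by lra.
move=> h; have : p x - p B <= 0 by rewrite hy mulr_le0_ge0//; lra.
by lra.
Qed.

Lemma locally_lipschitz_continuous (R : realType) (V : normedModType R) (f : V -> R) :
  [locally [lipschitz f x | x in [set: V]]] -> continuous f.
Proof.
move=> H x; have [M [_ HM]] := H (x, x) (conj I I).
have Mp : M < Num.max (M + 1) 1 by rewrite lt_max ltrDl ltr01.
have M0 : 0 < Num.max (M + 1) 1 by rewrite lt_max ltr01 orbT.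
have /= [[A B] [nA nB] AB] := HM _ Mp.
apply/cvgrPdist_le => e e0; near=> y.
have By : B y by near: y; exact: nB.
have Ax : A x := nbhs_singleton nA.
have /= h := AB (x, y) (conj Ax By) (conj I I).
apply: le_trans h _.
have : `|x - y| <= e / Num.max (M + 1) 1.
  by near: y; apply: cvgr_dist_le; [exact: cvg_id|rewrite divr_gt0].
by rewrite ler_pdivlMr// mulrC.
Unshelve. all: by end_near. Qed.

Lemma cvg_within_nbhs (U : topologicalType) (V : topologicalType) (D : set U) (x : U)
    (g : U -> V) (l : V) :
  (\forall y \near x, D y) -> g @ within D (nbhs x) --> l -> g @ x --> l.
Proof.
move=> nD cg A /cg; rewrite /within/= => h.
by apply: filterS2 nD h => y Dy; exact.
Qed.

Lemma lt_ereal_between (R : realType) (r : R) (T : \bar R) : (r%:E < T)%E ->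
  exists2 d : R, r < d & (d%:E <= T)%E.
Proof.
case: T => [T| |] rT; last by [].
  by exists T; rewrite ?lexx// -lte_fin.
by exists (r + 1); rewrite ?leey// ltrDl.
Qed.

(** An increment of the primitive is an integral of a nonnegative function, at most its integral
    over the line. The exponent in Gronwall's estimate is thereby independent of the time span. *)
Lemma integrable_primitive_bounded (R : realType) (g : R -> R) : continuous g ->
  (forall x, 0 <= g x) -> (\int[lebesgue_measure]_x (g x)%:E < +oo)%E ->
  exists Gam : R -> R, exists G : R, (forall x : R, is_derive x 1 Gam (g x)) /\
    forall x y, x <= y -> Gam y - Gam x <= G.
Proof.
move=> cg g0 gfin; have [Gam dGam] := global_primitive cg.
pose I := (\int[lebesgue_measure]_x (g x)%:E)%E.
have I0 : (0 <= I)%E by apply: integral_ge0 => x _; rewrite lee_fin.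
have Ifin : I \is a fin_num by rewrite ge0_fin_numE.
exists Gam, (fine I); split => // x y; rewrite le_eqVlt => /predU1P[->|xy].
  by rewrite subrr fine_ge0.
have cGam z : {for z, continuous Gam} by exact: (is_derive_continuous (dGam z)).
have FTC : (\int[lebesgue_measure]_(z in `[x, y]) (g z)%:E = (Gam y)%:E - (Gam x)%:E)%E.
  apply: continuous_FTC2 => //.
  - exact: continuous_subspaceT.
  - split; [|apply: cvg_at_right_filter; exact: cGam|apply: cvg_at_left_filter; exact: cGam].
    by move=> z _; exact: (@ex_derive _ _ _ _ _ _ _ (dGam z)).
  - by move=> z _; rewrite derive1E (@derive_val _ _ _ _ _ _ _ (dGam z)).
rewrite -lee_fin fineK// EFinB -FTC; apply: ge0_subset_integral => //.
  by apply/measurable_EFinP; exact: continuous_measurable_fun.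
by move=> z _; rewrite lee_fin.
Qed.

Lemma neg_part_continuous (R : realType) (beta : R -> R) :
  continuous beta -> continuous (neg_part beta).
Proof.
move=> cb x; apply: (@continuous_max _ _ (fun t => - beta t) (fun=> 0)); last exact: cvg_cst.
exact: (cvgN (cb x)).
Qed.

(** * Left limits and joining at an end time *)

Section Ends.
Context (R : realType) (E : lmodType R) (D : set E) (b : E -> E -> R).
Hypothesis S : semi_inner D b.

Lemma cauchy_at_left_limit (z : R -> E) (s T : R) : s < T ->
  (forall t, s < t < T -> D (z t)) ->
  (forall e : R, 0 < e -> exists2 t1, s < t1 < T & forall t r, t1 < t < T -> t1 < r < T ->
     snrm b (z r - z t) <= e) ->
  (forall x : nat -> E, (forall n, D (x n)) ->
     (forall e : R, 0 < e -> exists K, forall i j, (K <= i)%N -> (K <= j)%N ->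
        snrm b (x i - x j) <= e) ->
     exists2 w, D w & snrm b (x n - w) @[n --> \oo] --> (0 : R)) ->
  exists2 w, D w & snrm b (z t - w) @[t --> T^'-] --> (0 : R).
Proof.
move=> sT Dz Cz compl.
(* [n.+2] instead of [n.+1] keeps [t 0] strictly above [s]. *)
pose t (n : nat) : R := T - (T - s) / n.+2%:R.
have tn n : s < t n < T.
  have h : 0 < (T - s) / n.+2%:R by rewrite divr_gt0// subr_gt0.
  have h2 : (T - s) / n.+2%:R < T - s.
    by rewrite ltr_pdivrMr// ltr_pMr ?subr_gt0// ltr1n.
  move: h h2; rewrite /t; move: ((T - s) / _) => y h h2.
  by apply/andP; split; lra.
have tlim t1 : s < t1 < T -> exists K, forall n, (K <= n)%N -> t1 < t n < T.
  move=> /andP[_ t1T].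
  have h0 : 0 < T - t1 by rewrite subr_gt0.
  have d0 : 0 <= (T - s) / (T - t1) by rewrite divr_ge0 ?(ltW h0)// subr_ge0 ltW.
  exists (Num.bound ((T - s) / (T - t1))) => n Kn.
  have [_ ->] := andP (tn n); rewrite andbT.
  have h1 : (T - s) / (T - t1) < n.+2%:R.
    apply: lt_le_trans (archi_boundP d0) _.
    by rewrite ler_nat (leq_trans Kn)// (leq_trans (leqnSn _)).
  have : (T - s) / n.+2%:R < T - t1.
    by rewrite ltr_pdivrMr// mulrC -ltr_pdivrMr.
  by rewrite /t; move: ((T - s) / _) => y; lra.
have [w Dw cw] : exists2 w, D w & snrm b (z (t n) - w) @[n --> \oo] --> (0 : R).
  apply: (compl (fun n => z (t n))); first by move=> n; exact: Dz.
  move=> e e0; have [t1 st1 H1] := Cz _ e0; have [K HK] := tlim _ st1.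
  by exists K => i j Ki Kj; apply: H1; exact: HK.
exists w => //; apply/cvgrPdist_le => e e0.
have e20 : 0 < e / 2 by rewrite divr_gt0.
have [t1 /[dup] st1 /andP[s1 t1T] H1] := Cz _ e20; have [K HK] := tlim _ st1.
have [K' _ HK'] := cvgr_le _ cw _ e20.
pose n := maxn K K'.
near=> r.
have rT : t1 < r < T.
  apply/andP; split; near: r; first exact: nbhs_left_gt.
  exact: nbhs_left_lt.
have sr : s < r < T by case/andP: rT => r1 ->; rewrite (lt_trans s1 r1).
have Dr := Dz _ sr; have Dn := Dz _ (tn n).
rewrite sub0r normrN ger0_norm ?snrm_ge0//.
have -> : z r - w = (z r - z (t n)) + (z (t n) - w) by rewrite addrA subrK.
apply: le_trans (ler_snrmD S (siDB S Dr Dn) (siDB S Dn Dw)) _.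
have h1 : snrm b (z r - z (t n)) <= e / 2.
  by apply: H1 => //; apply: HK; rewrite leq_maxl.
have h2 : snrm b (z (t n) - w) <= e / 2 by apply: HK' => /=; rewrite leq_maxr.
lra.
Unshelve. all: by end_near. Qed.

(** The left limit [zT] and the value [z' T] may be different functions at distance 0; the triangle
    inequality absorbs the difference. *)
Lemma glue_cvg (z z' : R -> E) (I : set R) (T : R) (zT : E) :
  D zT -> D (z' T) -> (\forall r \near T, r < T -> D (z r)) ->
  (\forall r \near T, T <= r -> I r) ->
  snrm b (z r - zT) @[r --> T^'-] --> (0 : R) -> snrm b (z' T - zT) = 0 ->
  snrm b (z' r - z' T) @[r --> within I (nbhs T)] --> (0 : R) ->
  snrm b ((if r < T then z r else z' r) - (if T < T then z T else z' T)) @[r --> T] --> (0 : R).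
Proof.
rewrite ltxx => DT DT' Dz nI cl z0 cr; apply/cvgrPdist_le => e e0.
have h1 : \forall r \near T^'-, snrm b (z r - zT) <= e by exact: (cvgr_le _ cl _ e0).
have h2 : \forall r \near within I (nbhs T), snrm b (z' r - z' T) <= e.
  exact: (cvgr_le _ cr _ e0).
rewrite near_withinE in h1; rewrite near_withinE in h2.
near=> r.
have k1 : r < T -> snrm b (z r - zT) <= e by near: r; exact: h1.
have k2 : I r -> snrm b (z' r - z' T) <= e by near: r; exact: h2.
have k3 : T <= r -> I r by near: r; exact: nI.
have k4 : r < T -> D (z r) by near: r; exact: Dz.
rewrite sub0r normrN ger0_norm ?snrm_ge0//.
case: ltP => [rT|Tr]; last by apply: k2; exact: k3.
have Dr := k4 rT.
have -> : z r - z' T = (z r - zT) + (zT - z' T) by rewrite addrA subrK.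
apply: le_trans (ler_snrmD S (siDB S Dr DT) (siDB S DT DT')) _.
by rewrite (snrm_distC S DT DT') z0 addr0; exact: k1.
Unshelve. all: by end_near. Qed.

End Ends.

(** * The boundary value problem *)

Section Problem.
Context (R : realType) (N m : nat).
Variables (Omega : set 'rV[R]_N) (X : 'I_m -> 'rV[R]_N -> 'rV[R]_N)
  (a : 'rV[R]_N -> 'M[R]_N).
Local Notation RN := (caratheodory_type (leb_outer_measure R N)).
Local Notation mu := (leb R N).
Hypotheses (oO : open Omega) (bO : bounded_set Omega).
Local Notation E := ('rV[R]_N -> R).

Lemma Omega_measurable : measurable (Omega : set RN).
Proof. exact: open_leb_measurable. Qed.

Lemma Omega_finite : (mu Omega < +oo)%E.
Proof. exact: bounded_leb_fin. Qed.

Lemma inLp2_semi_inner : semi_inner (E := E) (inLp Omega 2) (L2inner Omega).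
Proof. exact: (semi_inner_L2 mu Omega_measurable). Qed.

Lemma Lpnorm2E u : inLp Omega 2 u -> Lpnorm Omega 2 u = snrm (E := E) (L2inner Omega) u.
Proof. exact: (Lnorm2_restrictE Omega_measurable). Qed.

Lemma continuous_bounded_on_Omega (g : E) : continuous g ->
  exists2 M : R, 0 <= M & forall x, Omega x -> `|g x| <= M.
Proof.
move=> cg; have [M [_ HM]] := bO.
pose K := [set x : 'rV[R]_N | `|x| <= M + 1].
have cK : compact K.
  apply: bounded_closed_compact.
    exists (M + 1); split; first exact: num_real.
    by move=> y My x /= Kx; apply: le_trans Kx _; exact: ltW.
  rewrite (_ : K = (fun x : 'rV[R]_N => `|x|) @^-1` [set y | y <= M + 1])//.
  apply: closed_comp; last exact: closed_le.
  by move=> x _; exact: norm_continuous.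
have := compact_bounded (continuous_compact (continuous_subspaceT cg) cK).
move=> [M' [_ HM']]; exists (Num.max (M' + 1) 0); first by rewrite le_max lexx orbT.
move=> x Ox; rewrite le_max; apply/orP; left; apply: (HM' (M' + 1)); first by rewrite ltrDl.
by exists x => //; apply: (HM (M + 1)) => //; rewrite ltrDl.
Qed.

Lemma continuous_inLp2 (g : E) : continuous g -> inLp Omega 2 g.
Proof.
move=> cg; apply/(L2_restrictP mu Omega_measurable).
have mg : measurable_fun (Omega : set RN) g.
  by apply: measurable_funTS; exact: continuous_leb_measurable.
split => //; apply: measurable_bounded_integrable.
- exact: Omega_measurable.
- exact: Omega_finite.
- exact: (measurable_funX 2).
- have [M M0 HM] := continuous_bounded_on_Omega cg.
  exists (M ^+ 2); split; first exact: num_real.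
  move=> y My x /= Ox; apply: le_trans (ltW My).
  by rewrite normrX ler_pXn2r ?nnegrE// HM.
Qed.

Lemma C1_lin (k : R) (u v : E) : C1 u -> C1 v -> C1 (k *: u + v).
Proof.
move=> [du cu] [dv cv]; split.
  by move=> x; apply: differentiableD => //; exact: differentiableZ.
move=> i; have -> : partial i (k *: u + v) = k *: partial i u + partial i v.
  apply/funext => x; rewrite /partial deriveD//; last exact: diff_derivable.
    by rewrite deriveZ//; exact: diff_derivable.
  by apply: derivableZ; exact: diff_derivable.
move=> x; have h : {for x, continuous (fun y => k * partial i u y + partial i v y)}.
  have h1 := cu i x. have h2 := cv i x.
  have h3 : (fun y => k * partial i u y) @ x --> k * partial i u x by apply: cvgM h1; exact: cvg_cst.
  exact: cvgD h3 h2.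
exact: h.
Qed.

Lemma partial_lin i (k : R) (u v : E) x : C1 u -> C1 v ->
  partial i (k *: u + v) x = k * partial i u x + partial i v x.
Proof.
move=> [du _] [dv _]; rewrite /partial deriveD//; last exact: diff_derivable.
  by rewrite deriveZ//; exact: diff_derivable.
by apply: derivableZ; exact: diff_derivable.
Qed.

Lemma C1_cst0 : C1 (0 : E).
Proof.
split; first by move=> x; exact: differentiable_cst.
move=> k; have -> : partial k (0 : E) = fun=> 0.
  by apply/funext => x; rewrite /partial derive_cst.
exact: cst_continuous.
Qed.

Lemma C1_0_lin (k : R) (u v : E) : C1_0 Omega u -> C1_0 Omega v ->
  C1_0 Omega (k *: u + v).
Proof.
move=> [C1u cu uO] [C1v cv vO].
have sub : closure [set x | (k *: u + v) x != 0] `<=`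
    closure [set x | u x != 0] `|` closure [set x | v x != 0].
  rewrite -closureU; apply: closure_subset => x /= h.
  have [u0|] := eqVneq (u x) 0; last by left.
  right; apply: contra_neq h => v0.
  have -> : (k *: u + v) x = k * u x + v x by [].
  by rewrite u0 v0 mulr0 addr0.
split; first exact: C1_lin.
  by apply: (subclosed_compact _ _ sub); [exact: closed_closure|exact: compactU].
by move=> x /sub[/uO|/vO].
Qed.

Lemma C1_0_cst0 : C1_0 Omega (0 : E).
Proof.
have e : closure [set x | (0 : E) x != 0] = set0.
  rewrite (_ : [set x | _] = set0) ?closure0//.
  by apply/seteqP; split => // x /=; rewrite eqxx.
by split; [exact: C1_cst0|rewrite e; exact: compact0|rewrite e].
Qed.

Lemma C1_continuous (u : E) : C1 u -> continuous u.
Proof. by move=> [du _] x; exact: differentiable_continuous. Qed.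

Lemma C1_0_inLp2 (u : E) : C1_0 Omega u -> inLp Omega 2 u.
Proof. by move=> [C1u _ _]; apply: continuous_inLp2; exact: C1_continuous. Qed.

Hypothesis Xc : forall j k, continuous (fun x => X j x ord0 k : R).

Lemma Xop_continuous j (u : E) : C1 u -> continuous (Xop X j u).
Proof.
move=> [_ cu] x; rewrite /Xop.
apply: (@continuous_big _ _ _ _ xpredT _ _ _ (fun k y => X j y ord0 k * partial k u y)).
  exact: add_continuous.
by move=> k _ y; have h1 := @Xc j k y; have h2 := cu k y; exact: cvgM h1 h2.
Qed.

Lemma Xop_lin j (k : R) (u v : E) : C1 u -> C1 v ->
  Xop X j (k *: u + v) = k *: Xop X j u + Xop X j v.
Proof.
move=> Cu Cv; apply/funext => x.
have -> : (k *: Xop X j u + Xop X j v) x = k * Xop X j u x + Xop X j v x by [].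
rewrite /Xop mulr_sumr -big_split/=; apply: eq_bigr => i _.
by rewrite partial_lin//; ring.
Qed.

(** The form whose diagonal is the square of [Hnorm0]; its extension [bext] gives [Hnorm]. *)
Definition hip (u v : E) : R := \sum_j L2inner Omega (Xop X j u) (Xop X j v).

Lemma hip_semi_inner : semi_inner (E := E) (C1_0 Omega) hip.
Proof.
have SL := inLp2_semi_inner.
have XL j u : C1_0 Omega u -> inLp Omega 2 (Xop X j u).
  by move=> [C1u _ _]; apply: continuous_inLp2; exact: Xop_continuous.
split.
- exact: C1_0_cst0.
- exact: C1_0_lin.
- move=> k u v w Cu Cv Cw; rewrite /hip mulr_sumr -big_split/=.
  apply: eq_bigr => j _; have [C1u _ _] := Cu; have [C1v _ _] := Cv.
  by rewrite Xop_lin// (silin SL)//; exact: XL.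
- by move=> u v Cu Cv; apply: eq_bigr => j _; apply: (sisym SL); exact: XL.
- by move=> u Cu; apply: sumr_ge0 => j _; apply: (sige0 SL); exact: XL.
Qed.

Lemma Hnorm0E u : C1_0 Omega u -> Hnorm0 Omega X u = snrm (E := E) hip u.
Proof.
move=> [C1u _ _]; rewrite /Hnorm0 /snrm /hip; congr Num.sqrt.
apply: eq_bigr => j _.
have XL : inLp Omega 2 (Xop X j u) by apply: continuous_inLp2; exact: Xop_continuous.
by rewrite Lpnorm2E// (snrm_sqr inLp2_semi_inner).
Qed.

Hypotheses (asym : forall x i j, a x i j = a x j i)
  (ameas : forall i j, measurable_fun [set: RN] (fun x => a x i j)).
Variables (Ca : R).
Hypotheses (Ca0 : 0 < Ca) (ell : forall x xi : 'rV[R]_N,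
    Ca^-1 * (\sum_j dotv (X j x) xi ^+ 2)
      <= \sum_i \sum_j a x i j * xi ord0 i * xi ord0 j
      <= Ca * (\sum_j dotv (X j x) xi ^+ 2)).

Definition form_density (u v : E) (x : 'rV[R]_N) : R :=
  \sum_i \sum_j a x i j * partial j u x * partial i v x.

Lemma form_density_sym u v x : form_density u v x = form_density v u x.
Proof.
rewrite /form_density exchange_big/=; apply: eq_bigr => i _; apply: eq_bigr => j _.
by rewrite asym; ring.
Qed.

Lemma form_density_lin k u v w x : C1 u -> C1 v ->
  form_density (k *: u + v) w x = k * form_density u w x + form_density v w x.
Proof.
move=> Cu Cv; rewrite /form_density mulr_sumr -big_split/=; apply: eq_bigr => i _.
rewrite mulr_sumr -big_split/=; apply: eq_bigr => j _.
by rewrite partial_lin//; ring.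
Qed.

Lemma form_density_bounds u x :
  Ca^-1 * (\sum_j Xop X j u x ^+ 2) <= form_density u u x <= Ca * (\sum_j Xop X j u x ^+ 2).
Proof.
have e : \sum_j dotv (X j x) (\row_k partial k u x) ^+ 2 = \sum_j Xop X j u x ^+ 2.
  by apply: eq_bigr => j _; congr (_ ^+ 2); apply: eq_bigr => k _; rewrite mxE.
have := ell x (\row_k partial k u x); rewrite e.
suff -> : form_density u u x = \sum_i \sum_j a x i j * (\row_k partial k u x) ord0 i * (\row_k partial k u x) ord0 j by [].
by apply: eq_bigr => i _; apply: eq_bigr => j _; rewrite !mxE; ring.
Qed.

Lemma form_density_ge0 u x : 0 <= form_density u u x.
Proof.
have /andP[+ _] := form_density_bounds u x; apply: le_trans.
by rewrite mulr_ge0 ?invr_ge0 ?(ltW Ca0)// sumr_ge0// => j _; exact: sqr_ge0.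
Qed.

Lemma form_density_CS u v x : C1 u -> C1 v ->
  `|form_density u v x| <= form_density u u x + form_density v v x.
Proof.
move=> Cu Cv.
have h1 := form_density_ge0 (1 *: u + v) x.
have h2 := form_density_ge0 (-1 *: u + v) x.
have h3 := form_density_ge0 u x; have h4 := form_density_ge0 v x.
have ex k : form_density (k *: u + v) (k *: u + v) x = k ^+ 2 * form_density u u x + 2 * k * form_density u v x + form_density v v x.
  rewrite form_density_lin// form_density_sym form_density_lin//.
  rewrite (form_density_sym v (k *: u + v)) form_density_lin// (form_density_sym v u); ring.
rewrite ex in h1; rewrite ex in h2.
by rewrite ler_norml; apply/andP; split; lra.
Qed.

(** The coefficients are merely measurable. Ellipticity dominates the diagonal density by squares of
    the continuous functions [Xop X j w], and the mixed density is dominated by the two diagonal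
    ones. *)
Lemma form_density_integrable u v : C1_0 Omega u -> C1_0 Omega v ->
  mu.-integrable Omega (EFin \o form_density u v).
Proof.
move=> [C1u _ _] [C1v _ _]; have mO := Omega_measurable.
have mfd (w z : E) : C1 w -> C1 z -> measurable_fun (Omega : set RN) (form_density w z).
  move=> [_ cw] [_ cz]; apply: measurable_funTS.
  apply: measurable_sum => i; apply: measurable_sum => j.
  apply: measurable_funM; last exact: continuous_leb_measurable.
  by apply: measurable_funM => //; exact: continuous_leb_measurable.
have int1 (w : E) : C1 w -> mu.-integrable Omega (EFin \o form_density w w).
  move=> C1w.
  have iX : mu.-integrable Omega (EFin \o (fun x => Ca * \sum_j Xop X j w x ^+ 2)).
    have -> : EFin \o (fun x => Ca * \sum_j Xop X j w x ^+ 2) = (fun x => Ca%:E * \sum_j (Xop X j w x ^+ 2)%:E)%E.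
      by apply/funext => x /=; rewrite sumEFin EFinM.
    apply: integrableZl => //; apply: integrable_sum => // j _.
    have Lj : inLp Omega 2 (Xop X j w) by apply: continuous_inLp2; exact: Xop_continuous.
    exact: ((L2_restrictP mu mO _).1 Lj).2.
  apply: le_integrable iX => //; first by apply/measurable_EFinP; exact: mfd.
  move=> x _ /=; rewrite lee_fin (ger0_norm (form_density_ge0 _ _)).
  have /andP[_ h] := form_density_bounds w x.
  by apply: le_trans h _; exact: ler_norm.
have iuv := integrableD mO (int1 _ C1u) (int1 _ C1v).
apply: le_integrable iuv => //; first by apply/measurable_EFinP; exact: mfd.
move=> x _ /=; rewrite lee_fin; apply: le_trans (form_density_CS x C1u C1v) _.
exact: ler_norm.
Qed.

Lemma form0_semi_inner : semi_inner (E := E) (C1_0 Omega) (form0 Omega a).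
Proof.
have mO := Omega_measurable.
split.
- exact: C1_0_cst0.
- exact: C1_0_lin.
- move=> k u v w Cu Cv Cw; have [C1u _ _] := Cu; have [C1v _ _] := Cv.
  rewrite /form0 -[\int[_]_(x in _) _]/(\int[mu]_(x in Omega) form_density (k *: u + v) w x).
  rewrite -RintegralZl//; last exact: form_density_integrable.
  rewrite -RintegralD//; last exact: form_density_integrable.
    by apply: eq_Rintegral => x _; rewrite form_density_lin.
  by have := integrableZl mO k (form_density_integrable Cu Cw); apply: eq_integrable.
- by move=> u v Cu Cv; apply: eq_Rintegral => x _; exact: form_density_sym.
- by move=> u Cu; apply: Rintegral_ge0 => x _; exact: form_density_ge0.
Qed.

Lemma form0_bounds u : C1_0 Omega u ->
  Ca^-1 * hip u u <= form0 Omega a u u <= Ca * hip u u.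
Proof.
move=> Cu; have [C1u _ _] := Cu; have mO := Omega_measurable.
have Lj j : inLp Omega 2 (Xop X j u) by apply: continuous_inLp2; exact: Xop_continuous.
have Ij j := L2_mul_integrable mO (Lj j) (Lj j).
have intX : mu.-integrable Omega (EFin \o (fun x => \sum_j Xop X j u x ^+ 2)).
  have -> : EFin \o (fun x => \sum_j Xop X j u x ^+ 2) = (fun x => \sum_j (Xop X j u x * Xop X j u x)%:E)%E.
    by apply/funext => x /=; rewrite sumEFin.
  by apply: integrable_sum => // j _; exact: Ij.
have hE : hip u u = \int[mu]_(x in Omega) (\sum_j Xop X j u x ^+ 2).
  apply: EFin_inj; rewrite /hip -sumEFin [RHS]fineK; last exact: integrable_fin_num.
  have -> : (\int[mu]_(x in Omega) (\sum_j Xop X j u x ^+ 2)%:E = \int[mu]_(x in Omega) \sum_j (Xop X j u x * Xop X j u x)%:E)%E.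
    by apply: eq_integral => x _; rewrite sumEFin.
  rewrite integral_sum//; apply: eq_bigr => j _.
  by rewrite /L2inner /Rintegral fineK; [|apply: integrable_fin_num => //; exact: Ij].
have ZI (k : R) : mu.-integrable Omega (EFin \o (fun x => k * \sum_j Xop X j u x ^+ 2)).
  by have := integrableZl mO k intX; apply: eq_integrable.
rewrite hE -!RintegralZl//; apply/andP; split; apply: le_Rintegral => //; try exact: form_density_integrable.
  by move=> x _; have /andP[] := form_density_bounds u x.
by move=> x _; have /andP[] := form_density_bounds u x.
Qed.

(** * The energy space as a completion *)

Hypotheses (hclos : H_closable Omega X) (hcomp : H_embeds_compactly Omega X 2).
Local Notation L := (inLp Omega 2).
Local Notation C := (C1_0 Omega).
Local Notation H := (inH Omega X).
Local Notation ip := (L2inner Omega).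
Local Notation sq := (H_seq Omega X).
Local Notation frm := (Defs.form Omega X a).
Let hemb : H_embeds Omega X 2 := hcomp.1.
Let SL : semi_inner (E := E) L ip := inLp2_semi_inner.
Let SC : semi_inner (E := E) C hip := hip_semi_inner.
Let SF : semi_inner (E := E) C (form0 Omega a) := form0_semi_inner.
Let CL : C `<=` L := C1_0_inLp2.

Lemma H_approxP u phi : L u -> H_approx Omega X u phi <-> approx_by (E := E) C ip hip u phi.
Proof.
move=> Lu.
have e1 (p : nat -> E) i j : (forall n, C (p n)) -> Hnorm0 Omega X (p i \- p j) = snrm (E := E) hip (p i - p j).
  by move=> Cp; rewrite (Hnorm0E)//; exact: (siDB SC).
have e2 (p : nat -> E) : (forall n, C (p n)) ->
   (fun n => Lpnorm Omega 2 (p n \- u)) = (fun n => snrm (E := E) ip (p n - u)).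
  move=> Cp; apply/funext => n; rewrite (Lpnorm2E)//.
  by apply: (siDB SL) => //; exact: CL.
split.
  move=> [[Cp Kp] Lp]; split => //; last by rewrite -(e2 _ Cp).
  by move=> e /Kp[K HK]; exists K => i j Ki Kj; rewrite -(e1 _ _ _ Cp); exact: HK.
move=> [Cp Kp Lp]; split; last by rewrite (e2 _ Cp).
by split => // e /Kp[K HK]; exists K => i j Ki Kj; rewrite (e1 _ _ _ Cp); exact: HK.
Qed.

Lemma inHP u : H u <-> form_completion (E := E) L C ip hip u.
Proof.
by split=> -[Lu [phi Hp]]; split => //; exists phi; apply/(H_approxP _ Lu).
Qed.

Lemma H_seqP u : form_completion (E := E) L C ip hip u -> approx_by (E := E) C ip hip u (sq u).
Proof.
move=> Hu; have [Lu [phi /(H_approxP _ Lu) Hp]] := Hu.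
by apply/(H_approxP _ Lu); apply: (@xgetPex _ _ [set phi | H_approx Omega X u phi]); exists phi.
Qed.

Lemma H_closableP phi : approx_by (E := E) C ip hip 0 phi -> snrm (E := E) hip (phi n) @[n --> \oo] --> (0 : R).
Proof.
move=> Hp; have [Cp _ _] := Hp.
have /hclos h : H_approx Omega X (0 : E) phi by apply/(H_approxP _ (siD0 SL)).
have e : (fun n => Hnorm0 Omega X (phi n)) = (fun n => snrm (E := E) hip (phi n)).
  by apply/funext => n; rewrite (Hnorm0E).
by rewrite e in h.
Qed.


Lemma form0_le u : C u -> snrm (E := E) (form0 Omega a) u <= Num.sqrt Ca * snrm (E := E) hip u.
Proof.
move=> Cu; have /andP[_ h] := form0_bounds Cu.
by rewrite /snrm -sqrtrM ?(ltW Ca0)// ler_wsqrtr.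
Qed.

Lemma form0_ge u : C u -> snrm (E := E) hip u <= Num.sqrt Ca * snrm (E := E) (form0 Omega a) u.
Proof.
move=> Cu; have /andP[h _] := form0_bounds Cu.
rewrite /snrm -sqrtrM ?(ltW Ca0)// ler_wsqrtr//.
by move: h; rewrite ler_pdivrMl.
Qed.

Lemma inH_semi_inner : semi_inner (E := E) H frm.
Proof.
have -> : H = form_completion (E := E) L C ip hip by apply/seteqP; split=> u /inHP.
exact: (semi_inner_bext SL SC CL H_closableP SF form0_le H_seqP).
Qed.

Let hip_le1 u : C u -> snrm (E := E) hip u <= 1 * snrm (E := E) hip u.
Proof. by rewrite mul1r. Qed.

Let hbx := bext (E := E) hip sq.

Lemma Hnorm_bext u : H u -> Hnorm Omega X u = snrm (E := E) (bext (E := E) hip sq) u.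
Proof.
move=> Hu; have Hu' := (inHP u).1 Hu; have [Lu _] := Hu.
have Hs := H_seqP Hu'; have [Cs _ _] := Hs.
have h := snrm_bext_cvg SL SC CL H_closableP SC hip_le1 H_seqP Lu Hs.
rewrite -(cvg_lim (@Rhausdorff R) h) /Hnorm; congr (limn _); apply/funext => n.
by rewrite (Hnorm0E).
Qed.

Lemma form_le_Hnorm u : H u -> snrm (E := E) frm u <= Num.sqrt Ca * Hnorm Omega X u.
Proof.
move=> Hu; rewrite Hnorm_bext//.
exact: (bext_dom SL SC CL H_closableP SF SC form0_le hip_le1 H_seqP form0_le ((inHP u).1 Hu)).
Qed.

Lemma Hnorm_le_form u : H u -> Hnorm Omega X u <= Num.sqrt Ca * snrm (E := E) frm u.
Proof.
move=> Hu; rewrite Hnorm_bext//.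
exact: (bext_dom SL SC CL H_closableP SC SF hip_le1 form0_le H_seqP form0_ge ((inHP u).1 Hu)).
Qed.

Lemma wave_triple_H : wave_triple (E := E) L H ip frm.
Proof.
split; [exact: SL|exact: inH_semi_inner|by move=> u []|].
have [_ [K HK]] := hemb.
exists (Num.max K 0 * Num.sqrt Ca).
  by rewrite mulr_ge0 ?sqrtr_ge0// le_max lexx orbT.
move=> u Hu; have [Lu _] := Hu; rewrite -(Lpnorm2E Lu).
apply: le_trans (HK _ Hu) _; rewrite -mulrA.
have h1 := Hnorm_le_form Hu.
have h0 : 0 <= Hnorm Omega X u by rewrite Hnorm_bext// snrm_ge0.
apply: (@le_trans _ _ (Num.max K 0 * Hnorm Omega X u)).
  by rewrite ler_wpM2r// le_max lexx.
by rewrite ler_wpM2l// le_max lexx orbT.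
Qed.

Lemma inH_null z : L z -> snrm (E := E) ip z = 0 -> H z /\ snrm (E := E) frm z = 0.
Proof.
move=> Lz z0.
have [h1 h2] := bext_null SL SC CL H_closableP SF form0_le H_seqP Lz z0.
by split; first exact/inHP.
Qed.

(** Ellipticity passes Cauchy sequences and limits between the norm of [frm] and that of [hip], with
    respect to which the completion is formed. *)
Lemma inH_complete (u : nat -> E) (w : E) :
  (forall n, H (u n)) -> L w -> snrm (E := E) ip (u n - w) @[n --> \oo] --> (0 : R) ->
  (forall e : R, 0 < e -> exists K, forall i j, (K <= i)%N -> (K <= j)%N ->
     snrm (E := E) frm (u i - u j) <= e) ->
  H w /\ snrm (E := E) frm (u n - w) @[n --> \oo] --> (0 : R).
Proof.
move=> Hu Lw uw Cu.
have SH := inH_semi_inner.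
have q0 : 0 < Num.sqrt Ca by rewrite sqrtr_gt0.
have [] := completion_complete SL SC CL H_closableP H_seqP (fun n => (inHP _).1 (Hu n)) Lw uw.
  move=> e e0; have [K HK] := Cu _ (divr_gt0 e0 q0); exists K => i j Ki Kj.
  have Hij : H (u i - u j) by exact: (siDB SH).
  rewrite -Hnorm_bext//; apply: le_trans (Hnorm_le_form Hij) _.
  by rewrite mulrC -ler_pdivlMr// HK.
move=> /inHP Hw h; split => //.
have c12 : (fun n => Num.sqrt Ca * snrm (E := E) hbx (u n - w)) @ \oo --> (0 : R).
  by rewrite -(mulr0 (Num.sqrt Ca)); apply: cvgM => //; exact: cvg_cst.
refine (cvg_dist_le _ c12); apply: nearW => n.
have Hn : H (u n - w) by exact: (siDB SH).
by rewrite subr0 ger0_norm ?snrm_ge0// -Hnorm_bext// form_le_Hnorm.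
Qed.

(** * The nonlinearity on the energy space *)

Variable q : R.
Hypotheses (q2 : 2 < q) (hembq : H_embeds Omega X q).
Local Notation nL := (snrm (E := E) ip).
Local Notation nH := (snrm (E := E) frm).
Let mO : measurable (Omega : set RN) := Omega_measurable.
Let fO : (mu Omega < +oo)%E := Omega_finite.
Let WT : wave_triple (E := E) L H ip frm := wave_triple_H.
Let SH := wtH WT.
Let HL := wtHL WT.

Lemma inH_inLq u : H u -> inLq mu Omega q u.
Proof.
move=> Hu; have [h _] := hembq.
by apply/(Lfun_restrictP mu mO u); [have := q2; lra|exact: h].
Qed.

Lemma Iq_le_nH : exists2 K : R, 0 <= K & forall u, H u -> Iq mu Omega q u <= (K * nH u) `^ q.
Proof.
have [h [K HK]] := hembq; have q0 : 0 < q by have := q2; lra.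
exists (`|K| * Num.sqrt Ca); first by rewrite mulr_ge0 ?sqrtr_ge0.
move=> u Hu; have Lqu := h _ Hu.
rewrite /Iq -(Lnorm_restrict_powR mO q0 Lqu).
apply: ge0_ler_powR; rewrite ?nnegrE ?(ltW q0)//.
- exact: Lnorm_restrict_ge0.
- by rewrite !mulr_ge0 ?sqrtr_ge0 ?snrm_ge0.
apply: le_trans (HK _ Hu) _.
have h1 := Hnorm_le_form Hu.
have h0 : 0 <= Hnorm Omega X u.
  by rewrite (Hnorm_bext Hu) snrm_ge0.
apply: (@le_trans _ _ (`|K| * Hnorm Omega X u)); first by rewrite ler_wpM2r// ler_norm.
by rewrite -mulrA ler_wpM2l.
Qed.

Lemma Iq_cvg (I : Type) (G : set_system I) {FG : Filter G} (w : I -> E) :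
  (\forall i \near G, H (w i)) -> nH (w i) @[i --> G] --> (0 : R) ->
  Iq mu Omega q (w i) @[i --> G] --> (0 : R).
Proof.
move=> hw cw; have [K K0 HK] := Iq_le_nH; have q0 : 0 < q by have := q2; lra.
apply/cvgrPdist_le => e e0.
pose r := e `^ q^-1; have r0 : 0 < r by exact: powR_gt0.
have K1 : 0 < K + 1 by rewrite ltr_wpDl.
have c1 := cvgr_le _ cw _ (divr_gt0 r0 K1).
near=> i.
have Hi : H (w i) by near: i; exact: hw.
have hi : nH (w i) <= r / (K + 1) by near: i; exact: c1.
rewrite sub0r normrN ger0_norm ?Iq_ge0//.
apply: le_trans (HK _ Hi) _.
have -> : e = r `^ q by rewrite /r -powRrM mulVf ?powRr1 ?(ltW e0)// gt_eqF.
apply: ge0_ler_powR; rewrite ?nnegrE ?(ltW q0) ?(ltW r0) ?mulr_ge0 ?snrm_ge0//.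
apply: (@le_trans _ _ ((K + 1) * (r / (K + 1)))); last by rewrite mulrCA divff ?mulr1// gt_eqF.
by apply: ler_pM; rewrite ?snrm_ge0 ?lerDl.
Unshelve. all: by end_near. Qed.

Variables (f F : R -> R) (c rho : R).
Hypotheses (c0 : 0 <= c) (rho0 : 0 < rho <= (q - 2) / 2)
  (fg : growth f c rho) (dF : forall x : R, is_derive x 1 F (f x)).

Definition growth_norm (u v : E) : R := nL (fun x => growth_weight c q (u x) (v x)).

Lemma growth_norm_cvg (I : Type) (G : set_system I) {FG : Filter G} (w : I -> E) (w0 : E) :
  H w0 -> (\forall i \near G, H (w i)) -> nH (w i - w0) @[i --> G] --> (0 : R) ->
  growth_norm w0 (w i) @[i --> G] --> (0 : R).
Proof.
move=> H0 hw cw; have [K K0 HK] := Iq_le_nH; have q0 : 0 < q by have := q2; lra.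
have hd : \forall i \near G, H (w i - w0).
  by apply: filterS hw => i Hi; exact: (siDB SH).
apply: (@weight_cvg _ _ R mu Omega mO fO c q c0 q2 _ _ _ _ _ ((K * (nH w0 + 1)) `^ q)).
- exact: inH_inLq.
- have c1 := cvgr_le _ cw _ ltr01.
  near=> i.
  have Hi : H (w i) by near: i; exact: hw.
  have hi : nH (w i - w0) <= 1 by near: i; exact: c1.
  split; [exact: inH_inLq|by apply: inH_inLq; exact: (siDB SH)|].
  apply: le_trans (HK _ Hi) _.
  apply: ge0_ler_powR; rewrite ?nnegrE ?(ltW q0) ?mulr_ge0 ?addr_ge0 ?snrm_ge0//.
  rewrite (ler_wpM2l K0)//; apply: le_trans (snrm_le SH Hi H0) _.
  by rewrite lerD2l.
- exact: Iq_cvg.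
Unshelve. all: by end_near. Qed.

Lemma nemytskii_inL u : H u -> L (f \o u).
Proof.
move=> Hu; exact: (nemytskii_L2 mO fO c0 q2 rho0 fg (inH_inLq Hu)).1.
Qed.

Lemma nemytskii_cvg (I : Type) (G : set_system I) {FG : Filter G} (w : I -> E) (w0 : E) :
  H w0 -> (\forall i \near G, H (w i)) -> nH (w i - w0) @[i --> G] --> (0 : R) ->
  nL ((f \o w i) - (f \o w0)) @[i --> G] --> (0 : R).
Proof.
move=> H0 hw cw; have c1 : growth_norm w0 (w i) @[i --> G] --> (0 : R) by exact: growth_norm_cvg.
refine (cvg_dist_le _ c1); near=> i.
have Hi : H (w i) by near: i; exact: hw.
rewrite subr0 ger0_norm ?snrm_ge0//.
apply: (nemytskii_sub mO fO c0 q2 rho0 fg); [exact: inH_inLq|exact: inH_inLq|].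
by apply: inH_inLq; exact: (siDB SH).
Unshelve. all: by end_near. Qed.

Lemma nemytskii_bounded (B : R) : exists G : R, forall u, H u -> nH u <= B -> nL (f \o u) <= G.
Proof.
have [K K0 HK] := Iq_le_nH; have q0 : 0 < q by have := q2; lra.
exists (nL (fun=> f 0) + Num.sqrt (12 * c ^+ 2 * (9 * fine (mu Omega) + 12 * (K * B) `^ q))) => u Hu uB.
apply: le_trans (nemytskii_L2 mO fO c0 q2 rho0 fg (inH_inLq Hu)).2 _.
rewrite lerD2l ler_wsqrtr// ler_wpM2l ?mulr_ge0 ?sqr_ge0// lerD2l ler_wpM2l//.
apply: le_trans (HK _ Hu) _.
have nu := snrm_ge0 (E := E) frm u.
apply: ge0_ler_powR; rewrite ?nnegrE ?(ltW q0) ?mulr_ge0//.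
  exact: le_trans nu uB.
by rewrite ler_wpM2l.
Qed.

Lemma potential_taylor_H u v : H u -> H v ->
  `|potential mu Omega F v - potential mu Omega F u - ip (f \o u) (v - u)| <= nL (v - u) * growth_norm u v.
Proof.
move=> Hu Hv; apply: (potential_taylor mO fO c0 q2 rho0 fg dF); [exact: inH_inLq|exact: inH_inLq| |exact: HL|exact: HL].
by apply: inH_inLq; exact: (siDB SH).
Qed.

Lemma compactness_form (u : nat -> E) : (forall n, H (u n)) ->
  (exists M : R, forall n, nH (u n) <= M) ->
  exists k : nat -> nat, {homo k : i j / (i < j)%N} /\
    exists2 w, L w & nL (u (k n) - w) @[n --> \oo] --> (0 : R).
Proof.
move=> Hu [M HM]; have [_ hc] := hcomp.
have [|k [kh [w Lw cw]]] := hc u Hu.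
  exists (Num.sqrt Ca * M) => n.
  apply: le_trans (Hnorm_le_form (Hu n)) _.
  by rewrite ler_wpM2l ?sqrtr_ge0.
exists k; split => //; exists w => //.
have e : (fun n => Lpnorm Omega 2 (u (k n) \- w)) = (fun n => nL (u (k n) - w)).
  by apply/funext => n; apply: (Lpnorm2E); apply: (siDB SL) => //; exact: HL.
by rewrite e in cw.
Qed.

Lemma ae_eq0_ip (u : E) : L u -> (ip u u = 0) <-> ae_eq mu Omega u (fun=> 0).
Proof.
move=> Lu; have [mu' iu] := (L2_restrictP mu mO u).1 Lu.
have e : (\int[mu]_(x in Omega) `|(u x ^+ 2)%:E| = (ip u u)%:E)%E.
  rewrite -(L2_ip_integral mO Lu); apply: eq_integral => x _ /=.
  by rewrite ger0_norm ?sqr_ge0.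
have mu2 : measurable_fun (Omega : set RN) (fun x => (u x ^+ 2)%:E).
  by apply/measurable_EFinP; exact: (measurable_funX 2).
have := ae_eq_integral_abs mu mO mu2; rewrite e => -[h1 h2]; split.
  move=> h0; have /h1 : (ip u u)%:E = 0%E by rewrite h0.
  apply: filterS => x hx Ox; have := hx Ox => /= -[/eqP].
  by rewrite sqrf_eq0 => /eqP.
move=> h; suff /h2 : ae_eq mu Omega (fun x => (u x ^+ 2)%:E) (cst 0%E) by move=> [].
by apply: filterS h => x hx Ox; rewrite hx// expr0n.
Qed.

(** * The first eigenvalue and coercivity *)

Variable mu1 : R.
Hypothesis hmu1 : first_eigenvalueA Omega X a mu1.

Lemma exists_nonzero : exists2 u, H u & ip u u != 0.
Proof.
have [[u [Hu _ _] nu] _] := hmu1; exists u => //.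
by apply/eqP => h; apply: nu; apply/ae_eq0_ip => //; exact: HL.
Qed.

(** The infimum [lam] of the Rayleigh quotient is attained, hence an eigenvalue, hence at least
    [mu1]. *)
Lemma mu1_le u : H u -> mu1 * ip u u <= frm u u.
Proof.
have compl := inH_complete.
have [lam lamle [w [Hw w1 we]]] := rayleigh_min SL SH HL compactness_form compl exists_nonzero.
have [_ hmin] := hmu1; have Lw := HL Hw.
have : mu1 <= lam.
  apply: hmin; exists w; last first.
    by move/(ae_eq0_ip Lw) => h; move: w1; rewrite h => /eqP; rewrite eq_sym oner_eq0.
  split => //; first exact: (siDZ SL lam Lw).
  by move=> v Hv; rewrite we// -(siscalel SL lam Lw (HL Hv)).
move=> ml Hu; apply: le_trans (lamle _ Hu); rewrite ler_wpM2r//.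
exact: (sige0 SL (HL Hu)).
Qed.

(** At an eigenfunction the embedding of [H] in L^2 reads [ip u u <= K ^+ 2 * (mu1 * ip u u)], with
    [ip u u > 0]. *)
Lemma mu1_gt0 : 0 < mu1.
Proof.
have [[u [Hu Lg ue] nu] _] := hmu1; have Lu := HL Hu.
have ip0 : 0 < ip u u.
  by rewrite lt_def (sige0 SL Lu) andbT; apply/eqP => h; apply: nu; apply/ae_eq0_ip.
have [K K0 HK] := wtK WT.
have fe : frm u u = mu1 * ip u u by rewrite ue// -(siscalel SL mu1 Lu Lu).
have h := HK _ Hu.
have : ip u u <= K ^+ 2 * frm u u.
  rewrite -(snrm_sqr SL Lu) -(snrm_sqr SH Hu) -exprMn ler_pXn2r ?nnegrE ?mulr_ge0 ?snrm_ge0//.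
rewrite fe => h2; rewrite ltNge; apply/negP => m0.
have : K ^+ 2 * (mu1 * ip u u) <= 0.
  by rewrite mulr_ge0_le0 ?sqr_ge0// mulr_le0_ge0// ltW.
by move: h2 ip0; lra.
Qed.

Lemma form_coercive (k C : R) : k < mu1 -> 0 <= C -> (forall x, F x <= k / 2 * x ^+ 2 + C) ->
  exists2 theta, 0 < theta <= 2^-1 & exists C1 : R, forall u, H u ->
    theta * frm u u <= frm u u / 2 - potential mu Omega F u + C1.
Proof.
move=> km C0 HF; have m0 := mu1_gt0.
(* With [k' >= 0], the inequality [mu1_le] can be multiplied by [k' / mu1], and [theta] stays at
   most [1 / 2]. *)
pose k' := Num.max k 0.
have k'm : k' < mu1 by rewrite gt_max km.
have k'0 : 0 <= k' by rewrite le_max lexx orbT.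
have kk' : k <= k' by rewrite le_max lexx.
exists ((1 - k' / mu1) / 2).
  have : k' / mu1 < 1 by rewrite ltr_pdivrMr// mul1r.
  have : 0 <= k' / mu1 by rewrite divr_ge0// ltW.
  by move=> *; apply/andP; split; lra.
exists (C * fine (mu Omega)) => u Hu; have Lu := HL Hu.
have iF := potential_integrable mO fO c0 q2 rho0 fg dF (inH_inLq Hu) Lu.
have iu2 := L2_mul_integrable mO Lu Lu.
have ik : mu.-integrable Omega (EFin \o (fun x => k' / 2 * (u x * u x))).
  by have := integrableZl mO (k' / 2) iu2; apply: eq_integrable.
have iC := cst_integrable mO fO C.
have : potential mu Omega F u <= k' / 2 * ip u u + C * fine (mu Omega).
  rewrite /potential -(Rintegral_cst mu mO C) -RintegralZl//.
  rewrite -(RintegralD mO ik iC).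
  apply: le_Rintegral => //; first exact: (integrableD mO ik iC).
  move=> x _; apply: le_trans (HF _) _; rewrite lerD2r -expr2.
  by rewrite ler_wpM2r ?sqr_ge0// ler_wpM2r.
have h1 := mu1_le Hu.
have : k' / mu1 * (mu1 * ip u u) <= k' / mu1 * frm u u.
  by rewrite ler_wpM2l// divr_ge0// ltW.
have -> : k' / mu1 * (mu1 * ip u u) = k' * ip u u by field; rewrite gt_eqF.
have -> : (1 - k' / mu1) / 2 * frm u u = frm u u / 2 - (k' / mu1 * frm u u) / 2 by field; rewrite gt_eqF.
lra.
Qed.

(** * Weak solutions: energy bound, limit at the end time, prolongation *)

Variable beta : R -> R.
Hypothesis cbeta : continuous beta.
Local Notation damped := (damped_on (E := E) L H ip frm (fun u => f \o u) beta).
Local Notation energy := (wave_energy (E := E) ip frm).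
Local Notation forcing w wt := (fun t => - beta t *: wt t + (f \o w t) : E).

Lemma forcing_cvg (w wt : R -> E) t : (\forall r \near t, H (w r)) ->
  (\forall r \near t, L (wt r)) ->
  nH (w r - w t) @[r --> t] --> (0 : R) -> nL (wt r - wt t) @[r --> t] --> (0 : R) ->
  nL (forcing w wt r - forcing w wt t) @[r --> t] --> (0 : R).
Proof.
move=> nw nwt cw cwt; have Ht := nbhs_singleton nw; have Lt := nbhs_singleton nwt.
have c1 : nL ((f \o w r) - (f \o w t)) @[r --> t] --> (0 : R).
  exact: nemytskii_cvg.
have c2 : `|beta r - beta t| * nL (wt r) @[r --> t] --> (0 : R).
  have h : (fun r : R => beta r - beta t) @ t --> (0 : R).
    by rewrite -(subrr (beta t)); apply: cvgB; [exact: cbeta|exact: cvg_cst].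
  have hn : (fun r : R => `|beta r - beta t|) @ t --> (0 : R).
    apply/cvgrPdist_le => e e0; move/cvgrPdist_le: h => /(_ _ e0).
    by apply: filterS => r; rewrite !sub0r !normrN normr_id.
  have hw : (fun r : R => nL (wt r)) @ t --> nL (wt t) by exact: (snrm_cvg SL Lt nwt cwt).
  by rewrite -[X in _ --> X](mul0r (nL (wt t))); exact: (cvgM hn hw).
have c3 : `|beta t| * nL (wt r - wt t) @[r --> t] --> (0 : R).
  by rewrite -(mulr0 `|beta t|); apply: cvgM => //; exact: cvg_cst.
have c123 : (fun r : R => `|beta r - beta t| * nL (wt r) + `|beta t| * nL (wt r - wt t)
    + nL ((f \o w r) - (f \o w t))) @ t --> (0 : R).
  rewrite -[X in _ --> X]addr0; apply: cvgD => //.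
  by rewrite -[X in _ --> X]addr0; exact: cvgD c2 c3.
refine (cvg_dist_le _ c123); near=> r.
have Hr : H (w r) by near: r; exact: nw.
have Lr : L (wt r) by near: r; exact: nwt.
rewrite subr0 ger0_norm ?snrm_ge0//.
have Lb := siDB SL Lr Lt; have Lf := siDB SL (nemytskii_inL Hr) (nemytskii_inL Ht).
have -> : forcing w wt r - forcing w wt t =
    - (beta r - beta t) *: wt r + - beta t *: (wt r - wt t) + ((f \o w r) - (f \o w t)).
  by apply/funext => x; rewrite !fctE /GRing.scale/=; ring.
apply: le_trans (ler_snrmD SL (siDD SL (siDZ SL _ Lr) (siDZ SL _ Lb)) Lf) _.
rewrite lerD2r; apply: le_trans (ler_snrmD SL (siDZ SL _ Lr) (siDZ SL _ Lb)) _.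
by rewrite !(snrmZ SL)// !normrN.
Unshelve. all: by end_near. Qed.

Lemma forcing_inL (w wt : E) t : H w -> L wt -> L (- beta t *: wt + (f \o w)).
Proof. by move=> Hw Lwt; apply: (siDD SL); [exact: (siDZ SL)|exact: nemytskii_inL]. Qed.

Lemma Hnorm_cvg (G : set_system R) {FG : Filter G} (w : R -> E) (w0 : E) :
  H w0 -> (\forall i \near G, H (w i)) ->
  Hnorm Omega X (w i \- w0) @[i --> G] --> (0 : R) <-> nH (w i - w0) @[i --> G] --> (0 : R).
Proof.
move=> H0 nw; have hB i : H (w i) -> H (w i - w0) by move=> Hi; exact: (siDB SH).
have cM (g : R -> R) : g i @[i --> G] --> (0 : R) -> Num.sqrt Ca * g i @[i --> G] --> (0 : R).
  by move=> cg; rewrite -(mulr0 (Num.sqrt Ca)); apply: cvgM => //; exact: cvg_cst.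
split=> /cM h; refine (cvg_dist_le _ h); apply: filterS nw => i /hB Hi; rewrite subr0 ger0_norm.
- exact: (form_le_Hnorm Hi).
- exact: snrm_ge0.
- exact: (Hnorm_le_form Hi).
- by rewrite (Hnorm_bext Hi) snrm_ge0.
Qed.

Lemma Lpnorm_cvg (G : set_system R) {FG : Filter G} (w : R -> E) (w0 : E) :
  L w0 -> (\forall i \near G, L (w i)) ->
  Lpnorm Omega 2 (w i \- w0) @[i --> G] --> (0 : R) <-> nL (w i - w0) @[i --> G] --> (0 : R).
Proof.
move=> L0 nw.
split=> h; refine (cvg_dist_le _ h); apply: filterS nw => i Li; have Lb := siDB SL Li L0;
  by rewrite subr0 (Lpnorm2E Lb) ger0_norm ?snrm_ge0.
Qed.

Lemma open_time_near s (T : \bar R) t : open_time s T t -> \forall r \near t, clopen_time s T r.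
Proof.
move=> [st tT].
case: T tT => [T| |] tT; last by [].
  near=> r; split; first by apply: ltW; near: r; exact: lt_nbhsr.
  by rewrite lte_fin; near: r; exact: lt_nbhsl.
near=> r; split; last by rewrite ltry.
by apply: ltW; near: r; exact: lt_nbhsr.
Unshelve. all: by end_near. Qed.

Lemma weak_solution_damped s (T : \bar R) u0 u1 u ut d :
  weak_solution Omega X a beta f s T u0 u1 u ut -> (d%:E <= T)%E -> damped s d u ut.
Proof.
move=> [[sT uV cu cut] [du _ _ ddu]] dT.
have sub t : s < t < d -> open_time s T t.
  by move=> /andP[st td]; split => //; apply: lt_le_trans dT.
have Hu t : s < t < d -> H (u t).
  by move=> /sub[st tT]; have [] := uV t (conj (ltW st) tT).
have Lu t : s < t < d -> L (ut t).
  by move=> /sub[st tT]; have [] := uV t (conj (ltW st) tT).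
have nHu t : s < t < d -> \forall r \near t, H (u r).
  by move=> st; apply: filterS (near_in_itv st) => r; exact: Hu.
have nLu t : s < t < d -> \forall r \near t, L (ut r).
  by move=> st; apply: filterS (near_in_itv st) => r; exact: Lu.
have c1 t : s < t < d -> nH (u r - u t) @[r --> t] --> (0 : R).
  move=> st; apply/(Hnorm_cvg (Hu _ st) (nHu _ st)); have ot := sub _ st.
  apply: (cvg_within_nbhs (open_time_near ot)); apply: cu.
  by case: ot => /ltW.
have c2 t : s < t < d -> nL (ut r - ut t) @[r --> t] --> (0 : R).
  move=> st; apply/(Lpnorm_cvg (Lu _ st) (nLu _ st)); have ot := sub _ st.
  apply: (cvg_within_nbhs (open_time_near ot)); apply: cut.
  by case: ot => /ltW.
have d1 v : L v -> forall t, s < t < d -> is_derive t 1 (fun r : R => ip (u r) v) (ip (ut t) v).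
  move=> Lv t st; have ot := sub _ st.
  have nLt : \forall r \near t, L (u r) by apply: filterS (nHu _ st) => r; exact: HL.
  apply: (snrm_derive_weak SL nLt (Lu _ st) Lv).
  have cth : (fun h : R => t + h) @ (0 : R)^' --> t.
    apply: cvg_trans (_ : (fun h : R => t + h) @ (0 : R) --> t); first by apply: cvg_app; exact: cvg_within.
    by rewrite -[X in _ --> X]addr0; apply: cvgD; [exact: cvg_cst|exact: cvg_id].
  have := du _ ot; move=> h; refine (cvg_dist_le _ h); near=> k.
  have Lk : L (u (t + k)) by near: k; exact: (cth _ nLt).
  have Lx : L (k^-1 *: (u (t + k) - u t) - ut t).
    by apply: (siDB SL) (Lu _ st); apply: (siDZ SL); apply: (siDB SL) Lk _; exact: HL (Hu _ st).
  have e : (fun x => k^-1 * (u (t + k) x - u t x) - ut t x) = k^-1 *: (u (t + k) - u t) - ut t by [].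
  by rewrite e (Lpnorm2E Lx) subr0 ger0_norm ?snrm_ge0.
split; [exact: Hu|exact: Lu| |exact: c1|exact: c2| |exact: d1|].
- by move=> t st; apply: forcing_inL; [exact: Hu|exact: Lu].
- by move=> t st; apply: forcing_cvg; [exact: nHu|exact: nLu|exact: c1|exact: c2].
- move=> v Hv t st; have ot := sub _ st; have Lv := HL Hv.
  have [_ h2 h3] := ddu v Hv t ot.
  (* The first derivative equals [ip (ut r) v] on a neighbourhood of [t], so the second derivative
     in the weak formulation is the derivative of that function. *)
  have e : \forall r \near t, derive1 (fun r : R => ip (u r) v) r = ip (ut r) v.
    apply: filterS (near_in_itv st) => r sr; rewrite derive1E.
    exact: (@derive_val _ _ _ _ _ _ _ (d1 v Lv r sr)).
  apply: (is_derive_near e); apply: DeriveDef => //.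
  have -> : 'D_1 (derive1 (fun r : R => ip (u r) v)) t = derive1n 2 (fun r : R => ip (u r) v) t.
    by rewrite derive1nS derive1n1 derive1E.
  rewrite (siaddl SL (siDZ SL _ (Lu _ st)) (nemytskii_inL (Hu _ st)) Lv) (siscalel SL _ (Lu _ st) Lv).
  move: h3; rewrite (nbhs_singleton e) => /eqP; rewrite -subr_eq => /eqP; lra.
Unshelve. all: by end_near. Qed.

Lemma damped_weak_solution s (T : \bar R) u0 u1 (u ut : R -> E) : (s%:E < T)%E ->
  (forall t, clopen_time s T t -> inV Omega X (u t) (ut t)) ->
  nH (u r - u s) @[r --> within (clopen_time s T) (nbhs s)] --> (0 : R) ->
  nL (ut r - ut s) @[r --> within (clopen_time s T) (nbhs s)] --> (0 : R) ->
  ae_eq mu Omega (u s) u0 -> ae_eq mu Omega (ut s) u1 ->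
  (forall t, open_time s T t -> exists c' d', c' < t < d' /\ damped c' d' u ut) ->
  weak_solution Omega X a beta f s T u0 u1 u ut.
Proof.
move=> sT uV cu cut us uts Hd.
have nH' (t0 : R) : \forall r \near within (clopen_time s T) (nbhs t0), H (u r).
  by rewrite near_withinE; apply: nearW => r /uV[].
have nL' (t0 : R) : \forall r \near within (clopen_time s T) (nbhs t0), L (ut r).
  by rewrite near_withinE; apply: nearW => r /uV[].
split; split; [exact: sT|exact: uV| | | |exact: us|exact: uts|].
- move=> t0 ct0; have [Ht0 _] := uV _ ct0; apply/(Hnorm_cvg Ht0 (nH' _)).
  have [+ tT] := ct0; rewrite le_eqVlt => /predU1P[<-//|st].
  have [c' [d' [ct D]]] := Hd _ (conj st tT).
  exact: cvg_trans (cvg_app _ (@cvg_within _ _ _ _)) (wocH D ct).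
- move=> t0 ct0; have [_ Lt0] := uV _ ct0; apply/(Lpnorm_cvg Lt0 (nL' _)).
  have [+ tT] := ct0; rewrite le_eqVlt => /predU1P[<-//|st].
  have [c' [d' [ct D]]] := Hd _ (conj st tT).
  exact: cvg_trans (cvg_app _ (@cvg_within _ _ _ _)) (wocL D ct).
- move=> t ot; have [c' [d' [ct D]]] := Hd _ ot.
  have h := wave_on_derive WT D ct; have Lt := HL (woH D ct).
  have cth : (fun h : R => t + h) @ (0 : R)^' --> t.
    apply: cvg_trans (_ : (fun h : R => t + h) @ (0 : R) --> t); first by apply: cvg_app; exact: cvg_within.
    by rewrite -[X in _ --> X]addr0; apply: cvgD; [exact: cvg_cst|exact: cvg_id].
  refine (cvg_dist_le _ h); near=> k.
  have Lk : L (u (t + k)) by apply: HL; near: k; exact: (cth _ (wave_near_H D ct)).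
  have Lx : L (k^-1 *: (u (t + k) - u t) - ut t).
    by apply: (siDB SL) (woL D ct); apply: (siDZ SL); apply: (siDB SL) Lk _.
  have e : (fun x => k^-1 * (u (t + k) x - u t x) - ut t x) = k^-1 *: (u (t + k) - u t) - ut t by [].
  by rewrite e (Lpnorm2E Lx) subr0 ger0_norm ?snrm_ge0.
- move=> v Hv t ot; have [c' [d' [ct D]]] := Hd _ ot; have Lv := HL Hv.
  have e : \forall r \near t, ip (ut r) v = derive1 (fun r : R => ip (u r) v) r.
    apply: filterS (near_in_itv ct) => r sr; rewrite derive1E.
    by apply/esym; exact: (@derive_val _ _ _ _ _ _ _ (wod D Lv sr)).
  have dd := is_derive_near e (wodd D Hv ct).
  split; [exact: (@ex_derive _ _ _ _ _ _ _ (wod D Lv ct))|exact: (@ex_derive _ _ _ _ _ _ _ dd)|].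
  rewrite -(nbhs_singleton e) derive1nS derive1n1 derive1E (@derive_val _ _ _ _ _ _ _ dd).
  have Lwt := woL D ct; have LN := nemytskii_inL (woH D ct).
  rewrite (siaddl SL (siDZ SL _ Lwt) LN Lv) (siscalel SL _ Lwt Lv); ring.
Unshelve. all: by end_near. Qed.

(** Gronwall's estimate has to start at a time [r0 > s], since the equation holds only after [s].
    With [r0] close to [s], continuity at [s] bounds the energy up to [r0]. *)
Lemma energy_bounded (theta C1 : R) (theta0 : 0 < theta <= 2^-1)
  (coercive : forall u, H u -> theta * frm u u <= frm u u / 2 - potential mu Omega F u + C1)
  (bneg : (\int[lebesgue_measure]_t (neg_part beta t)%:E < +oo)%E)
  s T u0 u1 u ut : weak_solution Omega X a beta f s T u0 u1 u ut ->
  exists M : R, forall t, clopen_time s T t -> energy u ut t <= M.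
Proof.
move=> W; have [[sT uV cu cut] _] := W.
have cs : clopen_time s T s by split.
have [Hs Ls] := uV _ cs.
have [Gam [G [dGam GamG]]] : exists Gam : R -> R, exists G : R,
    (forall x : R, is_derive x 1 Gam (neg_part beta x)) /\ forall x y, x <= y -> Gam y - Gam x <= G.
  apply: integrable_primitive_bounded => //; first exact: neg_part_continuous.
  by move=> x; rewrite le_max lexx orbT.
have nHs : \forall r \near within (clopen_time s T) (nbhs s), H (u r).
  by rewrite near_withinE; apply: nearW => r /uV[].
have nLs : \forall r \near within (clopen_time s T) (nbhs s), L (ut r).
  by rewrite near_withinE; apply: nearW => r /uV[].
have h1 : \forall r \near within (clopen_time s T) (nbhs s), nH (u r - u s) <= 1.
  refine (cvgr_le _ _ _ (ltr01 : (0 : R) < 1)).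
  exact: (Hnorm_cvg Hs nHs).1 (cu _ cs).
have h2 : \forall r \near within (clopen_time s T) (nbhs s), nL (ut r - ut s) <= 1.
  refine (cvgr_le _ _ _ (ltr01 : (0 : R) < 1)).
  exact: (Lpnorm_cvg Ls nLs).1 (cut _ cs).
rewrite near_withinE in h1; rewrite near_withinE in h2.
have [d0 /= d00 Hd0] := filterI h1 h2.
have [d1 sd1 d1T] := lt_ereal_between sT.
have [r0 [sr0 r0d1 r0d0]] : exists r0, [/\ s < r0, r0 < d1 & r0 - s < d0].
  have [h|h] := ltP (d0 / 2) (d1 - s).
    by exists (s + d0 / 2); split; lra.
  by exists ((s + d1) / 2); split; lra.
pose A := (nH (u s) + 1) ^+ 2 + (nL (ut s) + 1) ^+ 2.
have A0 : 0 <= A by rewrite addr_ge0// sqr_ge0.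
pose K := expR (G / theta) * (total_energy (E := E) ip frm (potential mu Omega F) u ut r0 + C1).
have th0 : 0 < theta by case/andP: theta0.
exists (A + `|K / theta|) => t ct; have [st tT] := ct; have [Ht Lt] := uV _ ct.
have [tr0|r0t] := leP t r0.
  apply: (@le_trans _ _ A); last by rewrite lerDl.
  have ts : `|s - t| < d0 by rewrite ltr_norml; apply/andP; split; lra.
  have [k1 k2] := Hd0 _ ts; have {}k1 := k1 ct; have {}k2 := k2 ct.
  rewrite /wave_energy -(snrm_sqr SH Ht) -(snrm_sqr SL Lt).
  have n1 := snrm_ge0 (E := E) frm (u t); have n2 := snrm_ge0 (E := E) ip (ut t).
  apply: lerD; rewrite lerXn2r ?nnegrE ?addr_ge0 ?snrm_ge0//.
    by apply: le_trans (snrm_le SH Ht Hs) _; rewrite lerD2l.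
  by apply: le_trans (snrm_le SL Lt Ls) _; rewrite lerD2l.
apply: (@le_trans _ _ `|K / theta|); last by rewrite lerDr.
apply: (@le_trans _ _ (K / theta)); last exact: ler_norm.
rewrite ler_pdivlMr// mulrC.
have [d td dT] := lt_ereal_between tT.
have D : damped s d u ut.
  exact: (weak_solution_damped W dT).
apply: (@total_energy_bound R E L H ip frm WT (fun u => f \o u) (potential mu Omega F)
  growth_norm nemytskii_inL _ _ theta C1 theta0 coercive beta s d u ut D Gam G) => //.
- move=> v w Hv Hw.
  exact: (potential_taylor_H).
- move=> w r nw cw.
  exact: (growth_norm_cvg (nbhs_singleton nw) nw cw).
- by move=> x y _ xy _; exact: GamG.
- exact: ltW.
Qed.

Lemma inLp2_complete (x : nat -> E) : (forall n, L (x n)) ->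
  (forall e : R, 0 < e -> exists K, forall i j, (K <= i)%N -> (K <= j)%N ->
     nL (x i - x j) <= e) ->
  exists2 w, L w & nL (x n - w) @[n --> \oo] --> (0 : R).
Proof. exact: (L2_complete (Omega_measurable)). Qed.

Lemma inH_form_complete (x : nat -> E) : (forall n, H (x n)) ->
  (forall e : R, 0 < e -> exists K, forall i j, (K <= i)%N -> (K <= j)%N ->
     nH (x i - x j) <= e) ->
  exists2 w, H w & nH (x n - w) @[n --> \oo] --> (0 : R).
Proof.
move=> Hx Cx; have [k k0 Hk] := wtK WT.
have k1 : 0 < k + 1 by rewrite ltr_wpDl.
have [w Lw cw] : exists2 w, L w & nL (x n - w) @[n --> \oo] --> (0 : R).
  apply: inLp2_complete; first by move=> n; apply: HL; exact: Hx.
  move=> e e0; have [K HK] := Cx _ (divr_gt0 e0 k1); exists K => i j Ki Kj.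
  apply: le_trans (Hk _ (siDB SH (Hx i) (Hx j))) _.
  apply: (@le_trans _ _ ((k + 1) * (e / (k + 1)))); last by rewrite mulrC divfK ?gt_eqF.
  by apply: ler_pM; rewrite ?snrm_ge0 ?lerDl//; exact: HK.
have [Hw cH] := inH_complete Hx Lw cw Cx.
by exists w.
Qed.

Lemma continuous_itv_bounded (g : R -> R) (x y : R) : continuous g -> x <= y ->
  exists B : R, forall t, x <= t <= y -> `|g t| <= B.
Proof.
move=> cg xy.
have cn : {within `[x, y], continuous (fun t : R => `|g t|)}.
  by apply: continuous_subspaceT => t; apply: cvg_norm; exact: cg.
have [z _ Hz] := EVT_max xy cn.
by exists `|g z| => t xt; apply: Hz; rewrite in_itv.
Qed.

Lemma bounded_energy_limit s (T : R) u0 u1 u ut (M : R) :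
  weak_solution Omega X a beta f s T%:E u0 u1 u ut ->
  (forall t, clopen_time s T%:E t -> energy u ut t <= M) ->
  exists uT utT, [/\ H uT, L utT, nH (u t - uT) @[t --> T^'-] --> (0 : R) &
    nL (ut t - utT) @[t --> T^'-] --> (0 : R)].
Proof.
move=> W HM; have [[+ uV _ _] _] := W; rewrite lte_fin => sT.
have D := weak_solution_damped W (lexx _).
have sub t : s < t < T -> clopen_time s T%:E t.
  by move=> /andP[st tT]; split; [exact: ltW|rewrite lte_fin].
have Hu t : s < t < T -> H (u t) by move=> /sub/uV[].
have Lu t : s < t < T -> L (ut t) by move=> /sub/uV[].
have [bH bL] : (forall t, s < t < T -> nH (u t) <= Num.sqrt M) /\
    (forall t, s < t < T -> nL (ut t) <= Num.sqrt M).
  split=> t st; apply: ler_wsqrtr; have := HM _ (sub _ st); apply: le_trans.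
    by rewrite lerDl (sige0 SL)//; exact: Lu.
  by rewrite lerDr (sige0 SH)//; exact: Hu.
(* The finite end time enters here: [beta] is bounded on the compact interval [[s, T]]. *)
have [B HB] := continuous_itv_bounded cbeta (ltW sT).
have [G HG] := nemytskii_bounded (Num.sqrt M).
have gG t : s < t < T -> nL (- beta t *: ut t + (f \o u t)) <= B * Num.sqrt M + G.
  move=> st; have Lt := Lu _ st; have Ht := Hu _ st.
  apply: le_trans (ler_snrmD SL (siDZ SL _ Lt) (nemytskii_inL Ht)) _.
  apply: lerD; last by apply: HG => //; exact: bH.
  rewrite (snrmZ SL _ Lt) normrN; apply: ler_pM; rewrite ?snrm_ge0//.
    by apply: HB; case/andP: st => /ltW -> /ltW ->.
  exact: bL.
have Cz := wave_cauchy WT D sT gG bL.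
have Cz' (e : R) : 0 < e -> exists2 t1, s < t1 < T & forall t r, t1 < t < T -> t1 < r < T ->
    nH (u r - u t) <= e /\ nL (ut r - ut t) <= e.
  move=> e0; have e20 : 0 < e ^+ 2 by rewrite exprn_gt0.
  have [t1 st1 H1] := Cz _ e20; exists t1 => // t r tt rt; have h := H1 _ _ tt rt.
  have [s1 _] := andP st1.
  have st : s < t < T by case/andP: tt => h1 ->; rewrite (lt_trans s1 h1).
  have sr : s < r < T by case/andP: rt => h1 ->; rewrite (lt_trans s1 h1).
  have p1 := sige0 SH (siDB SH (Hu _ sr) (Hu _ st)).
  have p2 := sige0 SL (siDB SL (Lu _ sr) (Lu _ st)).
  have -> : e = Num.sqrt (e ^+ 2) by rewrite sqrtr_sqr gtr0_norm.
  split; apply: ler_wsqrtr; apply: le_trans h; first by rewrite lerDl.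
  by rewrite lerDr.
have [uT HT cT] : exists2 w, H w & nH (u t - w) @[t --> T^'-] --> (0 : R).
  apply: (cauchy_at_left_limit SH sT Hu); last exact: inH_form_complete.
  move=> e e0; have [t1 st1 H1] := Cz' _ e0; exists t1 => // t r tt rt.
  exact: (H1 _ _ tt rt).1.
have [utT LT cT'] : exists2 w, L w & nL (ut t - w) @[t --> T^'-] --> (0 : R).
  apply: (cauchy_at_left_limit SL sT Lu); last exact: inLp2_complete.
  move=> e e0; have [t1 st1 H1] := Cz' _ e0; exists t1 => // t r tt rt.
  exact: (H1 _ _ tt rt).2.
by exists uT, utT.
Qed.

Lemma ae_eq_nL v w : L v -> L w -> ae_eq mu Omega v w -> nL (v - w) = 0.
Proof.
move=> Lv Lw vw; have Lb := siDB SL Lv Lw.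
have /(ae_eq0_ip Lb) h : ae_eq mu Omega (v - w) (fun=> 0).
  by apply: filterS vw => x h Ox; have := h Ox; rewrite !fctE => ->; rewrite subrr.
by rewrite /snrm h sqrtr0.
Qed.

(** The restarted solution takes its initial values only almost everywhere. The jump at [T] thus has
    norm zero in [L] and, for the first component, by [inH_null] also in the energy norm;
    [wave_on_glue] then gives the equation across [T]. *)
Lemma weak_solution_extend s (T : R) T' u0 u1 u ut uT utT u' ut' :
  weak_solution Omega X a beta f s T%:E u0 u1 u ut ->
  H uT -> L utT -> nH (u t - uT) @[t --> T^'-] --> (0 : R) ->
  nL (ut t - utT) @[t --> T^'-] --> (0 : R) ->
  weak_solution Omega X a beta f T T' uT utT u' ut' ->
  weak_solution Omega X a beta f s T' u0 u1
    (fun t => if t < T then u t else u' t) (fun t => if t < T then ut t else ut' t).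
Proof.
move=> W HT LT cuT cutT W'; set U := fun t => _; set Ut := fun t => _.
have [[+ uV cu cut] [_ us uts _]] := W; rewrite lte_fin => sT.
have [[TT' uV' cu' cut'] [_ us' uts' _]] := W'.
have U1 t : t < T -> U t = u t by rewrite /U => ->.
have Ut1 t : t < T -> Ut t = ut t by rewrite /Ut => ->.
have U2 t : T <= t -> U t = u' t by rewrite /U ltNge => ->.
have Ut2 t : T <= t -> Ut t = ut' t by rewrite /Ut ltNge => ->.
have cT : clopen_time T T' T by split.
have [HT' LT'] := uV' _ cT.
have UV t : clopen_time s T' t -> inV Omega X (U t) (Ut t).
  move=> [st tT']; have [tT|Tt] := ltP t T.
    by rewrite U1// Ut1//; apply: uV; split => //; rewrite lte_fin.
  by rewrite U2// Ut2//; apply: uV'.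
have nT : \forall r \near T, T <= r -> clopen_time T T' r.
  have [d Td dT'] := lt_ereal_between TT'.
  near=> r => Tr; split => //; apply: lt_le_trans dT'; rewrite lte_fin.
  by near: r; exact: lt_nbhsl.
have nU : \forall r \near T, r < T -> inV Omega X (u r) (ut r).
  near=> r => rT; apply: uV; split; last by rewrite lte_fin.
  by apply: ltW; near: r; exact: lt_nbhsr.
have zL := ae_eq_nL LT' LT uts'.
have zH : nH (u' T - uT) = 0.
  have z := ae_eq_nL (HL HT') (HL HT) us'.
  by have [] := inH_null (siDB SL (HL HT') (HL HT)) z.
have nHT : \forall r \near within (clopen_time T T') (nbhs T), H (u' r).
  by rewrite near_withinE; apply: nearW => r /uV'[].
have nLT : \forall r \near within (clopen_time T T') (nbhs T), L (ut' r).
  by rewrite near_withinE; apply: nearW => r /uV'[].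
have cUT : nH (U r - U T) @[r --> T] --> (0 : R).
  apply: (glue_cvg SH HT HT' _ nT cuT zH); first by apply: filterS nU => r h /h[].
  exact: (Hnorm_cvg HT' nHT).1 (cu' _ cT).
have cUtT : nL (Ut r - Ut T) @[r --> T] --> (0 : R).
  apply: (glue_cvg SL LT LT' _ nT cutT zL); first by apply: filterS nU => r h /h[].
  exact: (Lpnorm_cvg LT' nLT).1 (cut' _ cT).
clearbody U Ut.
have DU d : T < d -> (d%:E <= T')%E -> damped s d U Ut.
  move=> Td dT'; have D1 := weak_solution_damped W (lexx _); have D2 := weak_solution_damped W' dT'.
  have sub t : s < t < d -> clopen_time s T' t.
    by move=> /andP[st td]; split; [exact: ltW|apply: lt_le_trans dT'].
  have HU t : s < t < d -> H (U t) by move=> /sub/UV[].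
  have LU t : s < t < d -> L (Ut t) by move=> /sub/UV[].
  have nHU t : s < t < d -> \forall r \near t, H (U r).
    by move=> st; apply: filterS (near_in_itv st) => r; exact: HU.
  have nLU t : s < t < d -> \forall r \near t, L (Ut r).
    by move=> st; apply: filterS (near_in_itv st) => r; exact: LU.
  have near1 (t : R) : t < T -> \forall r \near t, r < T by exact: lt_nbhsl.
  have near2 (t : R) : T < t -> \forall r \near t, T <= r.
    by move=> Tt; near=> r; apply: ltW; near: r; exact: lt_nbhsr.
  have cU t : s < t < d -> nH (U r - U t) @[r --> t] --> (0 : R).
    move=> /andP[st td]; have [tT|Tt|->//] := ltgtP t T.
    - have stT : s < t < T by rewrite st.
      refine (cvg_dist_le _ (wocH D1 stT)); apply: filterS (near1 _ tT) => r rT.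
      by rewrite (U1 _ rT) (U1 _ tT) subr0 ger0_norm ?snrm_ge0.
    - have Ttd : T < t < d by rewrite Tt.
      refine (cvg_dist_le _ (wocH D2 Ttd)); apply: filterS (near2 _ Tt) => r Tr.
      by rewrite (U2 _ Tr) (U2 _ (ltW Tt)) subr0 ger0_norm ?snrm_ge0.
  have cUt t : s < t < d -> nL (Ut r - Ut t) @[r --> t] --> (0 : R).
    move=> /andP[st td]; have [tT|Tt|->//] := ltgtP t T.
    - have stT : s < t < T by rewrite st.
      refine (cvg_dist_le _ (wocL D1 stT)); apply: filterS (near1 _ tT) => r rT.
      by rewrite (Ut1 _ rT) (Ut1 _ tT) subr0 ger0_norm ?snrm_ge0.
    - have Ttd : T < t < d by rewrite Tt.
      refine (cvg_dist_le _ (wocL D2 Ttd)); apply: filterS (near2 _ Tt) => r Tr.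
      by rewrite (Ut2 _ Tr) (Ut2 _ (ltW Tt)) subr0 ger0_norm ?snrm_ge0.
  have sTd : s < T < d by rewrite sT.
  apply: (wave_on_glue WT sTd HU LU _ cU cUt).
  - move=> t st.
    exact: (forcing_inL t (HU _ st) (LU _ st)).
  - move=> t st.
    exact: (forcing_cvg (nHU _ st) (nLU _ st) (cU _ st) (cUt _ st)).
  - move=> v Lv t /andP[st td]; rewrite neq_lt => /orP[tT|Tt].
      have stT : s < t < T by rewrite st.
      rewrite Ut1//; apply: (is_derive_near _ (wod D1 Lv stT)).
      by apply: filterS (near1 _ tT) => r rT; rewrite U1.
    have Ttd : T < t < d by rewrite Tt.
    rewrite Ut2 ?(ltW Tt)//; apply: (is_derive_near _ (wod D2 Lv Ttd)).
    by apply: filterS (near2 _ Tt) => r rT; rewrite U2.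
  - move=> v Hv t /andP[st td]; rewrite neq_lt => /orP[tT|Tt].
      have stT : s < t < T by rewrite st.
      rewrite U1// Ut1//; apply: (is_derive_near _ (wodd D1 Hv stT)).
      by apply: filterS (near1 _ tT) => r rT; rewrite Ut1.
    have Ttd : T < t < d by rewrite Tt.
    rewrite U2 ?(ltW Tt)// Ut2 ?(ltW Tt)//; apply: (is_derive_near _ (wodd D2 Hv Ttd)).
    by apply: filterS (near2 _ Tt) => r rT; rewrite Ut2.
have cs : clopen_time s T%:E s by split; rewrite ?lte_fin.
have [Hs Ls] := uV _ cs.
have nHs : \forall r \near within (clopen_time s T%:E) (nbhs s), H (u r).
  by rewrite near_withinE; apply: nearW => r /uV[].
have nLs : \forall r \near within (clopen_time s T%:E) (nbhs s), L (ut r).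
  by rewrite near_withinE; apply: nearW => r /uV[].
have cHs := (Hnorm_cvg Hs nHs).1 (cu _ cs).
have cLs := (Lpnorm_cvg Ls nLs).1 (cut _ cs).
have restrict (g g' : R -> R) : (forall r, r < T -> g' r = g r) ->
    g r @[r --> within (clopen_time s T%:E) (nbhs s)] --> (0 : R) ->
    g' r @[r --> within (clopen_time s T') (nbhs s)] --> (0 : R).
  move=> gg' /cvgrPdist_le cg; apply/cvgrPdist_le => e e0.
  have h := cg _ e0; rewrite near_withinE in h; rewrite near_withinE.
  have h2 : \forall r \near s, r < T by exact: lt_nbhsl.
  apply: filterS2 h h2 => r h rT [sr _]; rewrite gg'//; apply: h.
  by split => //; rewrite lte_fin.
apply: (damped_weak_solution).
- by apply: lt_trans TT'; rewrite lte_fin.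
- exact: UV.
- by refine (restrict _ _ _ (cHs _)) => r rT; rewrite (U1 _ rT) (U1 _ sT).
- by refine (restrict _ _ _ (cLs _)) => r rT; rewrite (Ut1 _ rT) (Ut1 _ sT).
- by rewrite U1.
- by rewrite Ut1.
- move=> t [st tT'].
  have [d [td Td dT']] : exists d : R, [/\ t < d, T < d & (d%:E <= T')%E].
    have [tT|Tt] := leP t T.
      by have [d Td dT'] := lt_ereal_between TT'; exists d; split => //; exact: le_lt_trans Td.
    by have [d td dT'] := lt_ereal_between tT'; exists d; split => //; exact: lt_trans td.
  exists s, d; split; [by rewrite st|exact: (DU _ Td dT')].
Unshelve. all: by end_near. Qed.

End Problem.

Theorem mainTheorem3 (R : realType) (N m : nat)
    (Omega : set 'rV[R]_N) (X : 'I_m -> 'rV[R]_N -> 'rV[R]_N)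
    (a : 'rV[R]_N -> 'M[R]_N) (Q mu1 : R) (f beta : R -> R)
    (c rho Cbeta : R)
    (hOmega : smooth_bounded_domain Omega)
    (hX : standing_hypotheses X a)
    (hQ : 2 < Q <= N%:R)
    (hH : sobolev_embeddings Omega X Q)
    (hmu1 : first_eigenvalueA Omega X a mu1)
    (hf_lip : [locally [lipschitz f x | x in [set: R]]])
    (hc : 0 <= c)
    (hrho : 0 < rho <= (crit_exp Q - 2) / 2)
    (hf_growth : growth f c rho)
    (hf_limsup : (limf_esup (fun u : R => (f u / u)%:E) (@abs_infty R)
                    < mu1%:E)%E)
    (hbeta_cont : continuous beta)
    (hCbeta : 1 <= Cbeta)
    (hbeta_int : forall t : R,
       1 <= \int[lebesgue_measure]_(tau in `[t, t + 1]) beta tau <= Cbeta)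
    (hbeta_neg : (\int[lebesgue_measure]_tau (neg_part beta tau)%:E < +oo)%E)
    (hwp : well_posed Omega X a beta f)
    (s : R) (T : \bar R) (u0 u1 : 'rV[R]_N -> R) (u ut : R -> 'rV[R]_N -> R)
    (hdata : inV Omega X u0 u1)
    (hu : maximal_weak_solution Omega X a beta f s T u0 u1 u ut) :
  (exists M : R, forall t, clopen_time s T t ->
     Vnorm Omega X a (u t) (ut t) <= M)
  /\ T = +oo%E.
Proof.
have [oO _ _ bO _] := hOmega.
have [[lipX asym ameas [Ca Ca0 ell]] _] := hX.
have Xc j k : continuous (fun x => X j x ord0 k : R) by exact: (locally_lipschitz_continuous (lipX j k)).
have [hclos hemb hcomp] := hH.
set q := crit_exp Q in hrho hemb hcomp.
have q2 : 2 < q.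
  have /andP[Q2 _] := hQ.
  by rewrite /q /crit_exp ltr_pdivlMr ?subr_gt0//; lra.
have hembq : H_embeds Omega X q by apply: hemb; apply/andP; split; lra.
(* The exponent 2 is subcritical because [2 < q]. *)
have hcomp2 : H_embeds_compactly Omega X 2 by apply: hcomp; apply/andP; split; lra.
have cf := growth_continuous hc q2 hrho hf_growth.
have [F dF] := global_primitive cf.
have [k km [K HK]] := limsup_quotient hf_limsup.
have [C C0 HF] := primitive_upper_bound dF HK.
have [theta th0 [C1 coercive]] :=
  form_coercive oO bO Xc asym ameas Ca0 ell hclos hcomp2 q2 hembq hc hrho hf_growth dF hmu1 km C0 HF.
have [W maxW] := hu.
have [M HM] := energy_bounded oO bO Xc asym ameas Ca0 ell hclos hcomp2 q2 hembq hc hrho hf_growth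
  dF hbeta_cont th0 coercive hbeta_neg W.
have [[sT uV _ _] _] := W; split.
  exists (Num.sqrt M) => t ct; have [_ Lt] := uV _ ct.
  rewrite /Vnorm (Lpnorm2E oO Lt) (snrm_sqr (inLp2_semi_inner oO) Lt).
  by apply: ler_wsqrtr; exact: HM.
(* [+oo] is the claim and [-oo] contradicts [sT], so only a finite [T] has to be excluded. *)
move: W maxW HM sT {hu uV}; case: T => [T| |] W maxW HM sT; [|by []|by []].
have [uT [utT [HT LT cuT cutT]]] := bounded_energy_limit oO bO Xc asym ameas Ca0 ell hclos hcomp2
  q2 hembq hc hrho hf_growth hbeta_cont W HM.
have [T' [u' [ut' [[W' _] _]]]] := hwp T uT utT (conj HT LT).
have E := weak_solution_extend oO bO Xc asym ameas Ca0 ell hclos hcomp2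
  q2 hembq hc hrho hf_growth hbeta_cont W HT LT cuT cutT W'.
have [[TT' _ _ _] _] := W'.
(* The prolonged solution lives up to [T' > T] and coincides with [u] before [T] by construction,
   against maximality. *)
have := maxW _ _ _ E; rewrite leNgt TT' => h; exfalso; apply: notF; apply: h.
move=> t [_ tT] _; rewrite lte_fin in tT.
by rewrite tT; apply: aeW.
Qed.
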